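(* Assume that conditions (A1) and (A2) stated in the context hold, with $r$ and $\mathsf{D}$ the integer and the set given by (A1). Then for every initial distribution $\chi\in\mathcal{M}(\mathsf{D},r)$ and every bounded measurable function $h:\mathsf{X}\to\mathbb{R}$, the sequence of random variables $\big(\bar\sigma_\chi^2\langle Y_0^{n}\rangle(h)\big)_{n\in\mathbb{N}^*}$ is tight, i.e. for every $\epsilon>0$ there is $a>0$ such that $\mathbb{P}\big(|\bar\sigma_\chi^2\langle Y_0^{n}\rangle(h)|>a\big)\le\epsilon$ for all $n\in\mathbb{N}^*$.
   Context: Notation: $\mathbb{N}=\{0,1,2,\dots\}$, $\mathbb{N}^*=\{1,2,\dots\}$; $\ln^+x=\max(\ln x,0)$, $\ln^-x=\max(-\ln x,0)$; $u_k^m=(u_k,\dots,u_m)$; $\|f\|_\infty=\sup_{x\in\mathsf{X}}|f(x)|$; for a measure $\mu$, a kernel $\mathbf{K}$ and a function $f$: $\mu f=\int f\,d\mu$, $\mathbf{K}f(x)=\int f(x')\mathbf{K}(x,dx')$, $\mu\mathbf{K}f=\int\mu(dx)\mathbf{K}f(x)$. Model: $(\mathsf{X},\mathcal{X})$ (with $\mathcal{X}$ countably generated) and $(\mathsf{Y},\mathcal{Y})$ are measurable spaces, $\mathbf{Q}$ is a Markov kernel on $(\mathsf{X},\mathcal{X})$, $\nu$ is a $\sigma$-finite measure on $(\mathsf{Y},\mathcal{Y})$, and $g:\mathsf{X}\times\mathsf{Y}\to(0,\infty)$ is measurable with $\int g(x,y)\,\nu(dy)=1$ for all $x$. Write $g\langle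 y\rangle(x)=g(x,y)$. For $k\le m$ let $$\mathbf{L}\langle y_k^m\rangle(x_k,\mathsf{A})=\int\cdots\int \mathbf{1}_{\mathsf{A}}(x_{m+1})\prod_{\ell=k}^m g(x_\ell,y_\ell)\,\mathbf{Q}(x_\ell,dx_{\ell+1}),$$ and $\mathbf{L}\langle y_k^m\rangle(x,\mathsf{A})=\delta_x(\mathsf{A})$ for $k>m$. For a probability measure $\chi$ on $(\mathsf{X},\mathcal{X})$ (initial distribution) let $\phi_\chi\langle y_k^m\rangle(\mathsf{A})=\chi\mathbf{L}\langle y_k^m\rangle\mathbf{1}_{\mathsf{A}}/\chi\mathbf{L}\langle y_k^m\rangle\mathbf{1}_{\mathsf{X}}$ (predictor), so $\phi_\chi\langle y_k^m\rangle=\chi$ when $k>m$. The filter is $\bar\phi_\chi\langle y_0^n\rangle(\mathsf{A})=\int\mathbf{1}_{\mathsf{A}}(x)g(x,y_n)\,\phi_\chi\langle y_0^{n-1}\rangle(dx)\big/\int g(x,y_n)\,\phi_\chi\langle y_0^{n-1}\rangle(dx)$. Asymptotic variances of the bootstrap particle predictor and filter: for bounded measurable $h$, $$\sigma_\chi^2\langle y_0^{n-1}\rangle(h)=\sum_{k=0}^n\int\phi_\chi\langle y_0^{k-1}\rangle(dx)\left(\frac{\mathbf{L}\langle y_k^{n-1}\rangle h(x)-\phi_\chi\langle y_0^{n-1}\rangle h\times\mathbf{L}\langle y_k^{n-1}\rangle\mathbf{1}_{\mathsf{X}}(x)}{\phi_\chi\langle y_0^{k-1}\rangle\mathbf{L}\langle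 y_k^{n-1}\rangle\mathbf{1}_{\mathsf{X}}}\right)^2,$$ $$\bar\sigma_\chi^2\langle y_0^n\rangle(h)=\frac{\sigma_\chi^2\langle y_0^{n-1}\rangle\big(g\langle y_n\rangle\{h-\bar\phi_\chi\langle y_0^n\rangle h\}\big)}{\big(\phi_\chi\langle y_0^{n-1}\rangle g\langle y_n\rangle\big)^2}.$$ Observations: $(Y_n)_{n\in\mathbb{Z}}$ is a $\mathsf{Y}$-valued stationary process on a probability space with probability $\mathbb{P}$ and expectation $\mathbb{E}$; it is not assumed to be generated by the hidden Markov model with transition kernel $\mathbf{Q}$ and observation density $g$. Local Doeblin sets: let $r\in\mathbb{N}^*$. A set $\mathsf{C}\in\mathcal{X}$ is $r$-local Doeblin with respect to $\{\mathbf{Q},g\}$ if there exist positive functions $\epsilon_{\mathsf{C}}^-,\epsilon_{\mathsf{C}}^+$ on $\mathsf{Y}^r$, probability measures $\{\mu_{\mathsf{C}}\langle z\rangle;z\in\mathsf{Y}^r\}$ and positive functions $\{\varphi_{\mathsf{C}}\langle z\rangle;z\in\mathsf{Y}^r\}$ such that for all $z\in\mathsf{Y}^r$, $\mu_{\mathsf{C}}\langle z\rangle(\mathsf{C})=1$ and for all $\mathsf{A}\in\mathcal{X}$, $x\in\mathsf{C}$, $$\epsilon_{\mathsf{C}}^-\langle z\rangle\varphi_{\mathsf{C}}\langle z\rangle(x)\mu_{\mathsf{C}}\langle z\rangle(\mathsf{A})\le\mathbf{L}\langle z\rangle(x,\mathsf{A}\cap\mathsf{C})\le\epsilon_{\mathsf{C}}^+\langle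 z\rangle\varphi_{\mathsf{C}}\langle z\rangle(x)\mu_{\mathsf{C}}\langle z\rangle(\mathsf{A}).$$ (A1) The process $(Y_n)_{n\in\mathbb{Z}}$ is strictly stationary and ergodic, and there exist $r\in\mathbb{N}^*$ and $\mathsf{K}\in\mathcal{Y}^{\otimes r}$ such that: (i) the process $(Z_n)_{n\in\mathbb{Z}}$, $Z_n=Y_{nr}^{(n+1)r-1}$, is ergodic and $\mathbb{P}(Z_0\in\mathsf{K})>2/3$; (ii) for all $\eta>0$ there exists an $r$-local Doeblin set $\mathsf{C}\in\mathcal{X}$ such that for all $y_0^{r-1}\in\mathsf{K}$, $\sup_{x\in\mathsf{C}^c}\mathbf{L}\langle y_0^{r-1}\rangle(x,\mathsf{X})\le\eta\,\|\mathbf{L}\langle y_0^{r-1}\rangle(\cdot,\mathsf{X})\|_\infty<\infty$, and $\inf_{y_0^{r-1}\in\mathsf{K}}\epsilon_{\mathsf{C}}^-\langle y_0^{r-1}\rangle/\epsilon_{\mathsf{C}}^+\langle y_0^{r-1}\rangle>0$, with $\epsilon_{\mathsf{C}}^\pm$ the functions in the definition of local Doeblin set; (iii) there exists $\mathsf{D}\in\mathcal{X}$ such that $\mathbb{E}\big[\ln^-\inf_{x\in\mathsf{D}}\delta_x\mathbf{L}\langle Y_0^{r-1}\rangle\mathbf{1}_{\mathsf{D}}\big]<\infty$. (A2) (i) $g(x,y)>0$ for all $(x,y)\in\mathsf{X}\times\mathsf{Y}$; (ii) $\mathbb{E}[\ln^+\|g\langle Y_0\rangle\|_\infty]<\infty$.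 For $r$ and $\mathsf{D}$ as in (A1), $\mathcal{M}(\mathsf{D},r)$ is the set of probability measures $\chi$ on $(\mathsf{X},\mathcal{X})$ such that $\mathbb{E}\big[\ln^-\chi\mathbf{L}\langle Y_0^{\ell-1}\rangle\mathbf{1}_{\mathsf{D}}\big]<\infty$ for all $\ell\in\{0,\dots,r\}$. *)

(* Defs.v *)
From mathcomp Require Import all_boot all_order all_algebra.
From mathcomp Require Import all_classical all_reals all_analysis.
From mathcomp Require Import measurable_realfun.
Set Implicit Arguments.
Unset Strict Implicit.
Unset Printing Implicit Defensive.
Import Order.TTheory GRing.Theory Num.Theory.
Import numFieldNormedType.Exports.
Local Open Scope classical_set_scope.
Local Open Scope ring_scope.
Local Open Scope ereal_scope.

Section ExtendedLog.
Context (R : realType).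

(* [lne] is -oo on [-oo, 0] and +oo at +oo, so [lnm 0 = +oo] and [lnm +oo = 0]. *)
Definition lnp (x : \bar R) : \bar R := maxe (lne x) 0.
Definition lnm (x : \bar R) : \bar R := maxe (- lne x) 0.

Definition supnorm (T : Type) (f : T -> \bar R) : \bar R :=
  ereal_sup [set `|f x| | x in [set: T]].

End ExtendedLog.

Section Processes.
Context (R : realType) (dO dT : measure_display) (Omega : measurableType dO)
  (T : measurableType dT) (P : probability Omega R).

(* product sigma-algebra on the two-sided path space T^Z *)
Definition path_measurable : set_system (int -> T) :=
  <<s \bigcup_(n in [set: int])
        preimage_set_system [set: int -> T] (fun u => u n) measurable >>.

Definition shift_path (u : int -> T) : int -> T := fun n => u (n + 1)%R.

Definition trajectory (Y : int -> Omega -> T) (w : Omega) : int -> T :=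
  fun n => Y n w.

Definition stationary_process (Y : int -> Omega -> T) : Prop :=
  forall A, path_measurable A ->
    P (trajectory Y @^-1` (shift_path @^-1` A)) = P (trajectory Y @^-1` A).

Definition ergodic_process (Y : int -> Omega -> T) : Prop :=
  forall A, path_measurable A -> shift_path @^-1` A = A ->
    P (trajectory Y @^-1` A) = 0 \/ P (trajectory Y @^-1` A) = 1.

(* Y_k^{k+m-1}; the block is empty when m = 0 *)
Definition block (Y : int -> Omega -> T) (k : int) (m : nat) (w : Omega) :
    m.-tuple T :=
  [tuple Y (k + (i : nat)%:Z)%R w | i < m].

(* E[F(Z)] < oo for a nonnegative F. In the uses below F is a supremum or an
   infimum over a possibly uncountable set, so that its measurability, without
   which E[F(Z)] has no meaning, has to be part of the condition. *)
Definition finite_mean (F : T -> \bar R) (Z : Omega -> T) : Prop :=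
  measurable_fun [set: T] F /\ \int[P]_w F (Z w) < +oo.

End Processes.

Definition countably_generated d (T : measurableType d) : Prop :=
  exists G : nat -> set T, @measurable d T = <<s range G >>.

Section StateSpaceModel.
Context (R : realType) (dX dY : measure_display) (X : measurableType dX)
  (Y : measurableType dY) (Q : R.-pker X ~> X) (g : X -> Y -> R).

(* Observation vectors y_k^m are sequences, the empty one standing for k > m.
   [Lker], [predictor] and [filtering] are plain set functions, meant to be
   evaluated on measurable sets; they are measures once g is nonnegative and
   jointly measurable. *)
Fixpoint Lker (s : seq Y) (x : X) (A : set X) : \bar R :=
  if s is y :: s' then \int[Q x]_x' ((g x y)%:E * Lker s' x' A)
  else \d_x A.

Section InitialDistribution.
Context (chi : probability X R).

Definition predictor (s : seq Y) (A : set X) : \bar R :=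
  (\int[chi]_x Lker s x A) / (\int[chi]_x Lker s x [set: X]).

(* [filtering s y] is the filter given y_0^{n-1} = s and y_n = y *)
Definition filtering (s : seq Y) (y : Y) (A : set X) : \bar R :=
  (\int[predictor s]_x ((\1_A x)%:E * (g x y)%:E))
  / (\int[predictor s]_x (g x y)%:E).

(* With n = size s, [take k s] is y_0^{k-1} and [drop k s] is y_k^{n-1}. *)
Definition predictor_variance (s : seq Y) (h : X -> \bar R) : \bar R :=
  \sum_(k < (size s).+1)
    \int[predictor (take k s)]_x
      (((\int[Lker (drop k s) x]_x' h x')
         - (\int[predictor s]_x' h x') * Lker (drop k s) x [set: X])
       / (\int[predictor (take k s)]_x' Lker (drop k s) x' [set: X])) ^+ 2.

Definition filter_variance (s : seq Y) (y : Y) (h : X -> R) : \bar R :=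
  predictor_variance s
    (fun x => (g x y)%:E * ((h x)%:E - \int[filtering s y]_x' (h x')%:E))
  / (\int[predictor s]_x (g x y)%:E) ^+ 2.

End InitialDistribution.

(* The witnesses are explicit because the assumptions bound em z / ep z. *)
Definition local_doeblin_with (r : nat) (C : set X) (em ep : r.-tuple Y -> R)
    (mu : r.-tuple Y -> probability X R) (phi : r.-tuple Y -> X -> R) : Prop :=
  measurable C /\
  forall z : r.-tuple Y,
    [/\ (0 < em z)%R, (0 < ep z)%R, forall x, (0 < phi z x)%R, mu z C = 1 &
        forall (A : set X) (x : X), measurable A -> C x ->
          (em z)%:E * (phi z x)%:E * mu z A <= Lker z x (A `&` C)
          <= (ep z)%:E * (phi z x)%:E * mu z A].

Section Assumptions.
Context (dO : measure_display) (Omega : measurableType dO)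
  (P : probability Omega R) (Yn : int -> {RV P >-> Y}).

Definition assumption_A1_i (r : nat) (K : set (r.-tuple Y)) : Prop :=
  let Z := fun n : int => block Yn (n * r%:Z)%R r in
  ergodic_process P Z /\ (2 / 3)%:E < P (Z 0%R @^-1` K).

Definition assumption_A1_ii (r : nat) (K : set (r.-tuple Y)) : Prop :=
  forall eta : R, (0 < eta)%R ->
  exists C em ep mu phi,
    [/\ local_doeblin_with C em ep mu phi,
        forall z : r.-tuple Y, K z ->
          ereal_sup [set Lker z x [set: X] | x in ~` C]
            <= eta%:E * supnorm (fun x => Lker z x [set: X]) < +oo &
        0 < ereal_inf [set (em z / ep z)%:E | z in K]].

Definition assumption_A1_iii (r : nat) (D : set X) : Prop :=
  measurable D /\
  finite_mean P
    (fun z : r.-tuple Y => lnm (ereal_inf [set Lker z x D | x in D]))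
    (block Yn 0%R r).

Definition assumption_A1 (r : nat) (D : set X) : Prop :=
  [/\ (0 < r)%N, stationary_process P Yn, ergodic_process P Yn &
      (exists K : set (r.-tuple Y),
         [/\ measurable K, assumption_A1_i K & assumption_A1_ii K])
      /\ assumption_A1_iii r D].

Definition assumption_A2 : Prop :=
  (forall x y, 0 < g x y)%R /\
  finite_mean P (fun y => lnp (supnorm (fun x => (g x y)%:E))) (Yn 0).

(* the class M(D, r) of initial distributions *)
Definition initial_class (D : set X) (r : nat) (chi : probability X R) : Prop :=
  forall l : nat, (l <= r)%N ->
    \int[P]_w lnm (\int[chi]_x Lker (block Yn 0%R l w) x D) < +oo.

End Assumptions.

End StateSpaceModel.

(* Main.v *)
From HB Require Import structures.
Require Import Defs.
From mathcomp Require Import all_boot all_order all_algebra.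
From mathcomp Require Import all_classical all_reals all_analysis.
From mathcomp Require Import measurable_realfun.
From mathcomp Require Import ring lra zify.
Import Order.TTheory GRing.Theory Num.Theory.
Import numFieldNormedType.Exports.
Local Open Scope classical_set_scope.
Local Open Scope ring_scope.
Local Open Scope ereal_scope.
Set Implicit Arguments.
Unset Strict Implicit.
Unset Printing Implicit Defensive.

(** The k-th summand of the asymptotic variance of the filter is controlled by
    the cross difference
      L_k (g_n h) (x) * chi L g_n - L_k g_n (x) * chi L (g_n h),
    where g_n = g(., y_n), L = L<y_0^{n-1}> and L_k = L<y_k^{n-1}>: subtracting
    the filter mean from h makes the predictor mean of g_n {h - ...} vanish, and
    [filter_variance_le] reads off the variance from a bound on these
    differences. If, for all x and k, the cross difference times
    chi L<y_0^{k-1}> 1 is at most A exp (- w (n - k) / r) (chi L g_n)^2, then the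
    variance is at most A^2 times a convergent geometric series, and it remains
    to choose A independently of n outside an event of small probability.

    The deterministic part fixes the residue of n - k modulo r and cuts the
    observations into blocks of length r counted backwards in time. A cross
    difference compares two likelihoods started from two points, so it is
    transported by the product of two copies of the block operators. On a block
    with observations in K, the local Doeblin property makes two copies in C
    share a component of mass kappa^2, on which the cross difference cancels,
    and a copy outside C carries at most a fraction tau^2 of the largest possible
    likelihood. Lemma [coupling] keeps the account of both gains; since more than
    two blocks out of three have their observations in K, both occur with a
    positive frequency. The second gain is relative to the largest possible
    likelihood and not to the actual one. Staying in D during a block costs the
    logarithm of the likelihood at most M in mean, which is why tau is taken to
    be exp (- 64 (M + 1)). The initial law is known to charge D only at the
    initial time, and the comparison at intermediate times is obtained by
    exchanging, through the coupling, the initial law and a point of D: lemmas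
    [psi_step] and [ratio_bound], combined in [stable_bound].

    The probabilistic part controls the cost of every window of blocks. A window
    sum is the difference of two sums over an initial segment of blocks, and by
    the maximal ergodic inequality the supremum of the sums of
    f - E f - epsilon is almost surely finite. By stationarity the law of this
    supremum does not depend on the time from which blocks are counted
    backwards, so a single constant serves all n ([ergodic_windows]); the r
    residues are collected by a union bound.

    The predictor and the filter are set functions defined by quotients of
    integrals. Integrals against them are identified with monotone continuous
    positive functionals ([integral_daniell_signed]), from which both the
    measurability of the variance in the observations and its expression by
    real-valued positive operators follow. *)

(** * Positive functionals of bounded measurable functions *)

Section PositiveFunctionals.
Local Open Scope ring_scope.
Context {R : realType} {d : measure_display} {X : measurableType d}.
Implicit Types (f g p q e : X -> R) (L : (X -> R) -> R) (B : (X -> R) -> X -> R).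

Definition bounded_meas f := measurable_fun [set: X] f /\ exists M, forall x, `|f x| <= M.

Lemma bounded_meas_cst (a : R) : bounded_meas (fun=> a).
Proof. by split; [exact: measurable_cst | exists `|a|]. Qed.

Lemma bounded_measD f g : bounded_meas f -> bounded_meas g -> bounded_meas (fun x => f x + g x).
Proof.
move=> [mf [F Ff]] [mg [G Gg]]; split; first exact: measurable_funD.
by exists (F + G) => x; rewrite (le_trans (ler_normD _ _))// lerD.
Qed.

Lemma bounded_measM f g : bounded_meas f -> bounded_meas g -> bounded_meas (fun x => f x * g x).
Proof.
move=> [mf [F Ff]] [mg [G Gg]]; split; first exact: measurable_funM.
by exists (F * G) => x; rewrite normrM ler_pM.
Qed.

Lemma bounded_measZ a f : bounded_meas f -> bounded_meas (fun x => a * f x).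
Proof. by move=> bf; apply: bounded_measM => //; exact: bounded_meas_cst. Qed.

Lemma bounded_meas_indic (A : set X) : measurable A -> bounded_meas (\1_A : X -> R).
Proof.
move=> mA; split; first exact: measurable_indic.
by exists 1 => x; rewrite indicE; case: (_ \in _); rewrite ?normr0 ?normr1.
Qed.

(** The operators of the filter preserve bounded measurable functions, and only
    linearity and positivity on these are used: working with functionals rather
    than measures makes the normalizations and restrictions below immediate. *)
Definition posfun L :=
  (forall a f g, bounded_meas f -> bounded_meas g -> L (fun x => a * f x + g x) = a * L f + L g) /\
  (forall f, bounded_meas f -> (forall x, 0 <= f x) -> 0 <= L f).

Definition posop B := (forall x, posfun (B ^~ x)) /\ (forall f, bounded_meas f -> bounded_meas (B f)).

Lemma posfun0 L : posfun L -> L (fun=> 0) = 0.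
Proof.
move=> [lin _]; have := lin 1 _ _ (bounded_meas_cst 0) (bounded_meas_cst 0).
by under eq_fun do rewrite mul1r addr0; rewrite mul1r; lra.
Qed.

Lemma posfunD L f g : posfun L -> bounded_meas f -> bounded_meas g ->
  L (fun x => f x + g x) = L f + L g.
Proof.
move=> [lin _] bf bg; rewrite -[L f]mul1r -lin//; congr L.
by apply/funext => x; rewrite mul1r.
Qed.

Lemma posfunZ L a f : posfun L -> bounded_meas f -> L (fun x => a * f x) = a * L f.
Proof.
move=> pL bf; have [lin _] := pL.
have := lin a _ _ bf (bounded_meas_cst 0); rewrite (posfun0 pL) addr0 => <-.
by congr L; apply/funext => x; rewrite addr0.
Qed.

Lemma posfun_ge0 L f : posfun L -> bounded_meas f -> (forall x, 0 <= f x) -> 0 <= L f.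
Proof. by move=> [_]; apply. Qed.

Lemma posfun_le L f g : posfun L -> bounded_meas f -> bounded_meas g ->
  (forall x, f x <= g x) -> L f <= L g.
Proof.
move=> pL bf bg fg; have [lin pos] := pL.
rewrite -subr_ge0; have -> : L g - L f = L (fun x => - 1 * f x + g x).
  by rewrite lin//; lra.
apply: pos; first by apply: bounded_measD => //; exact: bounded_measZ.
by move=> x; rewrite mulN1r addrC subr_ge0.
Qed.

Lemma posfun_lin3 L f1 f2 f3 a1 a2 a3 : posfun L ->
  bounded_meas f1 -> bounded_meas f2 -> bounded_meas f3 ->
  L (fun x => a1 * f1 x + a2 * f2 x + a3 * f3 x) =
  a1 * L f1 + a2 * L f2 + a3 * L f3.
Proof.
move=> pL b1 b2 b3; rewrite (posfunD pL); last 2 first.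
- by apply: bounded_measD; exact: bounded_measZ.
- exact: bounded_measZ.
rewrite (posfunD pL) ?(posfunZ _ pL)//; exact: bounded_measZ.
Qed.

Lemma posfun_split L (C : set X) f : posfun L -> measurable C -> bounded_meas f ->
  L f = L (fun x => \1_C x * f x) + L (fun x => \1_(~` C) x * f x).
Proof.
move=> pL mC bf; rewrite -(posfunD pL).
- congr L; apply/funext => x; rewrite -mulrDl !indicE in_setC.
  by case: (x \in C); rewrite /= ?addr0 ?add0r mul1r.
- by apply: bounded_measM => //; exact: bounded_meas_indic.
- by apply: bounded_measM => //; apply: bounded_meas_indic; exact: measurableC.
Qed.

Lemma posop_posfun B L : posop B -> posfun L -> posfun (fun f => L (B f)).
Proof.
move=> [Bx Bb] pL; split=> [a f g bf bg|f bf f0].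
  have -> : B (fun x => a * f x + g x) = (fun x => a * B f x + B g x).
    by apply/funext => x; have [lin _] := Bx x; exact: lin.
  by have [lin _] := pL; rewrite lin//; exact: Bb.
apply: posfun_ge0 => //; first exact: Bb.
by move=> x; exact: (posfun_ge0 (Bx x)).
Qed.

Lemma posop_comp B B' : posop B -> posop B' -> posop (fun f => B (B' f)).
Proof.
move=> [Bx Bb] pB'; split=> [x|f bf]; first exact: (posop_posfun pB' (Bx x)).
by apply: Bb; case: pB' => _; exact.
Qed.

Lemma posop_id : posop (fun f => f).
Proof. by split=> // x; split=> // f _; exact. Qed.

Section TwoPoints.
Variables (a b c : R) (p1 q1 e1 p2 q2 e2 : X -> R).
Hypotheses (bp1 : bounded_meas p1) (bq1 : bounded_meas q1) (be1 : bounded_meas e1).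
Hypotheses (bp2 : bounded_meas p2) (bq2 : bounded_meas q2) (be2 : bounded_meas e2).
Hypothesis G0 : forall x y,
  0 <= a * (p1 x * q2 y) + b * (q1 x * p2 y) + c * (e1 x * e2 y).

(** Positivity of the product of two functionals on a function of two variables.
    Three product terms suffice for cross differences, and integrating one
    variable at a time avoids product measures. *)
Lemma posfun2_ge0 L1 L2 : posfun L1 -> posfun L2 ->
  0 <= a * (L1 p1 * L2 q2) + b * (L1 q1 * L2 p2) + c * (L1 e1 * L2 e2).
Proof.
move=> pL1 pL2.
have H x : 0 <= (a * L2 q2) * p1 x + (b * L2 p2) * q1 x + (c * L2 e2) * e1 x.
  have -> : (a * L2 q2) * p1 x + (b * L2 p2) * q1 x + (c * L2 e2) * e1 x =
     L2 (fun y => (a * p1 x) * q2 y + (b * q1 x) * p2 y + (c * e1 x) * e2 y).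
    by rewrite posfun_lin3//; ring.
  apply: posfun_ge0 => //; first by do ?apply: bounded_measD; exact: bounded_measZ.
  by move=> y; have := G0 x y; rewrite !mulrA.
have : 0 <= L1 (fun x => (a * L2 q2) * p1 x + (b * L2 p2) * q1 x + (c * L2 e2) * e1 x).
  by apply: posfun_ge0 => //; do ?apply: bounded_measD; exact: bounded_measZ.
by rewrite posfun_lin3//; lra.
Qed.

(** Domination of each factor by a common functional passes to the product; this
    is how the component shared by two copies of a kernel is split off. *)
Lemma posfun2_dom L1 L2 m c1 c2 : posfun L1 -> posfun L2 -> posfun m ->
  0 <= c1 -> 0 <= c2 ->
  (forall f, bounded_meas f -> (forall x, 0 <= f x) -> c1 * m f <= L1 f) ->
  (forall f, bounded_meas f -> (forall x, 0 <= f x) -> c2 * m f <= L2 f) ->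
  c1 * c2 * (a * (m p1 * m q2) + b * (m q1 * m p2) + c * (m e1 * m e2)) <=
  a * (L1 p1 * L2 q2) + b * (L1 q1 * L2 p2) + c * (L1 e1 * L2 e2).
Proof.
move=> pL1 pL2 pm c10 c20 d1 d2.
have bG x : bounded_meas (fun y => (a * p1 x) * q2 y + (b * q1 x) * p2 y + (c * e1 x) * e2 y).
  by do ?apply: bounded_measD; exact: bounded_measZ.
have H x : 0 <= (a * L2 q2 - c2 * (a * m q2)) * p1 x +
    (b * L2 p2 - c2 * (b * m p2)) * q1 x + (c * L2 e2 - c2 * (c * m e2)) * e1 x.
  have Gx y : 0 <= (a * p1 x) * q2 y + (b * q1 x) * p2 y + (c * e1 x) * e2 y.
    by have := G0 x y; rewrite !mulrA.
  by have := d2 _ (bG x) Gx; rewrite !posfun_lin3//; lra.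
have Hm x : 0 <= (a * m q2) * p1 x + (b * m p2) * q1 x + (c * m e2) * e1 x.
  have -> : (a * m q2) * p1 x + (b * m p2) * q1 x + (c * m e2) * e1 x =
     m (fun y => (a * p1 x) * q2 y + (b * q1 x) * p2 y + (c * e1 x) * e2 y).
    by rewrite posfun_lin3//; ring.
  by apply: posfun_ge0 => // y; have := G0 x y; rewrite !mulrA.
have bH : bounded_meas (fun x => (a * m q2) * p1 x + (b * m p2) * q1 x + (c * m e2) * e1 x).
  by do ?apply: bounded_measD; exact: bounded_measZ.
have := d1 _ bH Hm; rewrite !posfun_lin3// => H1.
have : 0 <= L1 (fun x => (a * L2 q2 - c2 * (a * m q2)) * p1 x +
    (b * L2 p2 - c2 * (b * m p2)) * q1 x + (c * L2 e2 - c2 * (c * m e2)) * e1 x).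
  by apply: posfun_ge0 => //; do ?apply: bounded_measD; exact: bounded_measZ.
rewrite posfun_lin3// => H2.
have := ler_wpM2l c20 H1.
lra.
Qed.

End TwoPoints.

End PositiveFunctionals.

(** * Coupling of two copies of a product of positive operators *)

Section Coupling.
Local Open Scope ring_scope.
Context {R : realType} {d : measure_display} {X : measurableType d}.
Implicit Types (f g p q e : X -> R).

(** Operators are indexed backwards in time: the operator of the largest index is
    applied last to the function, hence acts first on the trajectory. *)
Fixpoint window_op (B : nat -> (X -> R) -> X -> R) lo m f :=
  if m is m'.+1 then B (lo + m')%N (window_op B lo m' f) else f.

Definition bad_count (good_block : nat -> bool) lo m : nat := \sum_(i < m) ~~ good_block (lo + i)%N.

(** The local Doeblin condition for the restriction to C, normalized so that the
    upper bound has constant 1. *)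
Definition minorized (C : set X) (kappa : R) (B : (X -> R) -> X -> R) :=
  exists mu phi, [/\ posfun mu, forall x, 0 <= phi x &
    forall f x, bounded_meas f -> (forall y, 0 <= f y) -> C x ->
      kappa * (phi x * mu f) <= B (fun y => \1_C y * f y) x <= phi x * mu f].

Variables (B : nat -> (X -> R) -> X -> R) (good_block : nat -> bool) (C : set X) (tau kappa : R).
Hypotheses (mC : measurable C) (tau01 : 0 < tau <= 1) (kappa01 : 0 <= kappa <= 1).
Hypothesis pB : forall j, posop (B j).
Hypothesis B1 : forall j x, B j (fun=> 1) x <= 1.
Hypothesis BC : forall j x, good_block j -> ~ C x -> B j (fun=> 1) x <= tau ^+ 2.
Hypothesis Bm : forall j, good_block j -> minorized C kappa (B j).

Lemma posop_window_op lo m : posop (window_op B lo m).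
Proof. by elim: m => [|m IH] /=; [exact: posop_id|exact: posop_comp]. Qed.

Lemma window_opD lo m n f : window_op B lo (m + n) f = window_op B (lo + m) n (window_op B lo m f).
Proof. by elim: n => [|n IH]; rewrite ?addn0// addnS /= IH addnA. Qed.

Lemma window_op_ge0 lo m f : bounded_meas f -> (forall x, 0 <= f x) -> forall x, 0 <= window_op B lo m f x.
Proof. by move=> bf f0 x; apply: (posfun_ge0 ((posop_window_op lo m).1 x)). Qed.

Lemma window_op_le lo m f s : bounded_meas f -> 0 <= s -> (forall x, f x <= s) ->
  forall x, window_op B lo m f x <= s.
Proof.
move=> bf s0 fs; elim: m => [//|m IH] x /=.
have [pBx _] := pB (lo + m).
apply: (@le_trans _ _ (B (lo + m) (fun=> s * 1) x)).
  apply: (posfun_le (pBx x)) => //; first by case: (posop_window_op lo m) => _; exact.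
    exact: bounded_measZ (bounded_meas_cst _).
  by move=> y; rewrite mulr1.
by rewrite (posfunZ _ (pBx x)) ?ler_piMr//; exact: bounded_meas_cst.
Qed.

Variables (p q : X -> R) (sp sq : R) (lo : nat).
Hypotheses (bp : bounded_meas p) (bq : bounded_meas q).
Hypotheses (p0 : forall x, 0 <= p x) (q0 : forall x, 0 <= q x).
Hypotheses (ps : forall x, p x <= sp) (qs : forall x, q x <= sq).

Let pm m := window_op B lo m p.
Let qm m := window_op B lo m q.

Let good (x y : X) : bool := (x \in C) && (y \in C).
Let rho := 1 - kappa ^+ 2.

Let sp0 : 0 <= sp. Proof. by apply: le_trans (p0 point) (ps point). Qed.
Let sq0 : 0 <= sq. Proof. by apply: le_trans (q0 point) (qs point). Qed.

(** rho ^ T collects the losses of common components, tau ^ U the visits outside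
    C; the second term is only relative to the uniform bounds sp and sq. *)
Let claim m T U x y :=
  `|pm m x * qm m y - qm m x * pm m y| <=
  rho ^+ T * (pm m x * qm m y + qm m x * pm m y) + tau ^+ U * (sp * sq).

(** Induction on the number of operators. On a good step started from a pair of
    points of C, the pairs that stay in C x C share a component of mass kappa ^ 2,
    symmetric in the two copies, to which the cross difference contributes
    nothing: one power of rho is gained. A pair of which one point is outside C
    pays tau ^ 2, two powers of tau. Half of this gain is set aside as the unit
    ~~ good x y of the budget, and is used up by the step that leads outside
    C x C. A bad step gains nothing and may also lose this unit, which is why bad
    steps count twice. *)
Lemma coupling m T U x y :
  (T + U + 2 * bad_count good_block lo m + 1 <= m + ~~ good x y)%N -> claim m T U x y.
Proof.
have rho0 : 0 <= rho.
  by rewrite subr_ge0; case/andP: kappa01 => k0 k1; exact: exprn_ile1.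
have [tau0 tau1] := andP tau01.
have bpm k : bounded_meas (pm k) by case: (posop_window_op lo k) => _; exact.
have bqm k : bounded_meas (qm k) by case: (posop_window_op lo k) => _; exact.
have pm0 k z : 0 <= pm k z by exact: window_op_ge0.
have qm0 k z : 0 <= qm k z by exact: window_op_ge0.
have pms k z : pm k z <= sp by exact: window_op_le.
have qms k z : qm k z <= sq by exact: window_op_le.
have T0 k U' z w : claim k 0 U' z w.
  rewrite /claim expr0 mul1r; have := mulr_ge0 (pm0 k z) (qm0 k w).
  have := mulr_ge0 (qm0 k z) (pm0 k w).
  have := mulr_ge0 (exprn_ge0 U' (ltW tau0)) (mulr_ge0 sp0 sq0).
  rewrite ler_norml; lra.
have U0 k T' z w : claim k T' 0 z w.
  rewrite /claim expr0 mul1r; have h1 := mulr_ge0 (pm0 k z) (qm0 k w).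
  have h2 := mulr_ge0 (qm0 k z) (pm0 k w).
  have h3 := ler_pM (pm0 k z) (qm0 k w) (pms k z) (qms k w).
  have h4 := ler_pM (qm0 k z) (pm0 k w) (qms k z) (pms k w).
  have := mulr_ge0 (exprn_ge0 T' rho0) (addr_ge0 h1 h2).
  rewrite ler_norml; nra.
elim: m T U x y => [|m IH] T U x y.
  case: T => [|T]; first by move=> _; exact: T0.
  case: U => [|U]; first by move=> _; exact: U0.
  by case: (~~ _) => /=; clear; move: (bad_count _ _ _) => nb; lia.
case: T => [|T]; first by move=> _; exact: T0.
case: U => [|U]; first by move=> _; exact: U0.
rewrite {1}/bad_count big_ord_recr /= -/(bad_count good_block lo m) => H.
set j := (lo + m)%N in H *.
have [pBx _] := pB j.
have b1 : bounded_meas ((fun=> 1) : X -> R) := bounded_meas_cst 1.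
have pmE z : pm m.+1 z = B j (pm m) z by [].
have qmE z : qm m.+1 z = B j (qm m) z by [].
have B0 z : 0 <= B j (fun=> 1) z by exact: (posfun_ge0 (pBx z)).
(* a bound valid for every pair of successors passes through the product kernel *)
have glob T' U' : (forall z w, claim m T' U' z w) ->
    `|pm m.+1 x * qm m.+1 y - qm m.+1 x * pm m.+1 y| <=
    rho ^+ T' * (pm m.+1 x * qm m.+1 y + qm m.+1 x * pm m.+1 y) +
    tau ^+ U' * (sp * sq) * (B j (fun=> 1) x * B j (fun=> 1) y).
  move=> cl; rewrite !pmE !qmE ler_norml.
  have P1 : forall z w, 0 <= (rho ^+ T' + 1) * (pm m z * qm m w) +
      (rho ^+ T' - 1) * (qm m z * pm m w) + (tau ^+ U' * (sp * sq)) * (1 * 1).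
    by move=> z w; have := cl z w; rewrite /claim ler_norml; lra.
  have P2 : forall z w, 0 <= (rho ^+ T' - 1) * (pm m z * qm m w) +
      (rho ^+ T' + 1) * (qm m z * pm m w) + (tau ^+ U' * (sp * sq)) * (1 * 1).
    by move=> z w; have := cl z w; rewrite /claim ler_norml; lra.
  have := posfun2_ge0 (bpm m) (bqm m) b1 (bpm m) (bqm m) b1 P1 (pBx x) (pBx y).
  have := posfun2_ge0 (bpm m) (bqm m) b1 (bpm m) (bqm m) b1 P2 (pBx x) (pBx y).
  by lra.
have ss0 : 0 <= sp * sq by rewrite mulr_ge0.
have BB0 : 0 <= B j (fun=> 1) x * B j (fun=> 1) y by rewrite mulr_ge0.
have [kj|nkj] := boolP (good_block j); last first.
  have cl z w : claim m T.+1 U.+1 z w.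
    apply: IH; move: H; rewrite nkj; case: (~~ good x y); case: (~~ good z w) => /=;
    by clear; move: (bad_count _ _ _) => nb; lia.
  apply: le_trans (glob _ _ cl) _; rewrite lerD2l.
  rewrite ler_piMr ?mulr_ge0 ?exprn_ge0// ?(ltW tau0)//.
  by rewrite mulr_ile1.
move: H; rewrite kj /= addn0.
have [gxy|bxy] := boolP (good x y); last first.
  move=> H.
  have BB : B j (fun=> 1) x * B j (fun=> 1) y <= tau ^+ 2.
    move: bxy; rewrite negb_and => /orP[/negP|/negP] nC.
      have Cx : ~ C x by move=> Cx; apply: nC; exact/mem_set.
      by have := BC kj Cx; have := B1 j y; have := B0 x; have := B0 y; nra.
    have Cy : ~ C y by move=> Cy; apply: nC; exact/mem_set.
    by have := BC kj Cy; have := B1 j x; have := B0 x; have := B0 y; nra.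
  case: U H => [|U] H.
    have cl z w : claim m T.+1 0 z w by exact: U0.
    apply: le_trans (glob _ _ cl) _; rewrite lerD2l expr0 expr1 mul1r mulrC.
    by apply: ler_wpM2r => //; apply: le_trans BB _; rewrite expr2; nra.
  have cl z w : claim m T.+1 U z w.
    apply: IH; move: H; case: (~~ good z w) => /=;
    by clear; move: (bad_count _ _ _) => nb; lia.
  apply: le_trans (glob _ _ cl) _; rewrite lerD2l.
  have := ler_wpM2l (mulr_ge0 (exprn_ge0 U (ltW tau0)) ss0) BB.
  by rewrite -(addn2 U) exprD [X in _ -> _ <= X]mulrAC.
move=> H.
have [Cx Cy] : C x /\ C y by move: gxy => /andP[/set_mem ? /set_mem ?].
have clg z w : good z w -> claim m T U.+1 z w.
  move=> gzw; apply: IH; move: H; rewrite gzw /=.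
  by clear; move: (bad_count _ _ _) => nb; lia.
have clb z w : ~~ good z w -> claim m T.+1 U.+1 z w.
  move=> gzw; apply: IH; move: H; rewrite gzw /=.
  by clear; move: (bad_count _ _ _) => nb; lia.
have mCc : measurable (~` C) by exact: measurableC.
pose r (A : set X) f : X -> R := fun z => \1_A z * f z.
have br (A : set X) f : measurable A -> bounded_meas f -> bounded_meas (r A f).
  by move=> mA bf; apply: bounded_measM => //; exact: bounded_meas_indic.
have bCp := br _ _ mC (bpm m). have bCq := br _ _ mC (bqm m). have bC1 := br _ _ mC b1.
have bDp := br _ _ mCc (bpm m). have bDq := br _ _ mCc (bqm m). have bD1 := br _ _ mCc b1.
have nCin z : z \notin C -> \1_C z = 0 :> R by rewrite indicE => /negbTE ->.
have Cin z : z \in C -> \1_C z = 1 :> R by rewrite indicE => ->.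
have nDin z : z \notin C -> \1_(~` C) z = 1 :> R by rewrite indicE in_setC => ->.
have Din z : z \in C -> \1_(~` C) z = 0 :> R by rewrite indicE in_setC => ->.
(* pairs leaving C x C, in two pieces: the first point outside C, or only the second *)
have regb L1 L2 : posfun L1 -> posfun L2 -> forall s, s = 1 \/ s = -1 ->
    (0 <= (rho ^+ T.+1 + s) * (L1 (r (~` C) (pm m)) * L2 (qm m)) +
      (rho ^+ T.+1 - s) * (L1 (r (~` C) (qm m)) * L2 (pm m)) +
      (tau ^+ U.+1 * (sp * sq)) * (L1 (r (~` C) (fun=> 1)) * L2 (fun=> 1))) /\
    (0 <= (rho ^+ T.+1 + s) * (L1 (r C (pm m)) * L2 (r (~` C) (qm m))) +
      (rho ^+ T.+1 - s) * (L1 (r C (qm m)) * L2 (r (~` C) (pm m))) +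
      (tau ^+ U.+1 * (sp * sq)) * (L1 (r C (fun=> 1)) * L2 (r (~` C) (fun=> 1)))).
  move=> pL1 pL2 s hs; split.
    apply: (posfun2_ge0 bDp bDq bD1 (bpm m) (bqm m) b1) => // z w.
    rewrite /r; have [zC|zC] := boolP (z \in C); first by rewrite Din//; lra.
    have := @clb z w; rewrite /good (negbTE zC) /= => /(_ isT).
    by rewrite nDin// /claim ler_norml; case: hs => ->; lra.
  apply: (posfun2_ge0 bCp bCq bC1 bDp bDq bD1) => // z w.
  rewrite /r; have [zC|zC] := boolP (z \in C); last by rewrite nCin//; lra.
  have [wC|wC] := boolP (w \in C); first by rewrite (Din w)//; lra.
  have := @clb z w; rewrite /good (negbTE wC) andbF /= => /(_ isT).
  by rewrite Cin// nDin// /claim ler_norml; case: hs => ->; lra.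
(* on C x C the bound with exponent T improves to T + 1 once the common component is removed *)
have regg : forall s, s = 1 \/ s = -1 ->
    0 <= (rho ^+ T.+1 + s) * (B j (r C (pm m)) x * B j (r C (qm m)) y) +
      (rho ^+ T.+1 - s) * (B j (r C (qm m)) x * B j (r C (pm m)) y) +
      (tau ^+ U.+1 * (sp * sq)) * (B j (r C (fun=> 1)) x * B j (r C (fun=> 1)) y).
  move=> s hs.
  have [mu [phi [pmu phi0 Hmu]]] := Bm kj.
  have G z w : 0 <= (rho ^+ T + s) * (r C (pm m) z * r C (qm m) w) +
      (rho ^+ T - s) * (r C (qm m) z * r C (pm m) w) +
      (tau ^+ U.+1 * (sp * sq)) * (r C (fun=> 1) z * r C (fun=> 1) w).
    rewrite /r; have [zC|zC] := boolP (z \in C); last by rewrite nCin//; lra.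
    have [wC|wC] := boolP (w \in C); last by rewrite (nCin w)//; lra.
    have := @clg z w; rewrite /good zC wC /= => /(_ isT).
    by rewrite !Cin// /claim ler_norml; case: hs => ->; lra.
  pose LL z f := B j (r C f) z.
  have pLL z : posfun (LL z).
    have [lin pos] := pBx z; split=> [a f g bf bg|f bf f0].
      rewrite /LL -lin; [|exact: br|exact: br].
      by congr (B j _ z); apply/funext => w; rewrite /r; ring.
    by apply: pos; [exact: br|move=> w; rewrite mulr_ge0// indicE].
  have k0 : 0 <= kappa by case/andP: kappa01.
  have dom z : C z -> forall f, bounded_meas f -> (forall w, 0 <= f w) ->
      (kappa * phi z) * mu f <= LL z f.
    by move=> Cz f bf f0; have /andP[+ _] := Hmu f z bf f0 Cz; rewrite mulrA.
  have rr f : r C (r C f) = r C f.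
    apply/funext => w; rewrite /r mulrA; congr (_ * _).
    by rewrite indicE; case: (_ \in _); rewrite ?mulr1 ?mulr0.
  have LLr z f : LL z (r C f) = B j (r C f) z by rewrite /LL rr.
  have kx z : 0 <= kappa * phi z by rewrite mulr_ge0.
  have := posfun2_dom bCp bCq bC1 bCp bCq bC1 G (pLL x) (pLL y) pmu (kx x) (kx y)
     (dom _ Cx) (dom _ Cy).
  rewrite !LLr.
  have rC0 f : (forall w, 0 <= f w) -> forall w, 0 <= r C f w.
    by move=> f0 w; rewrite mulr_ge0// indicE.
  have up z f : C z -> bounded_meas f -> (forall w, 0 <= f w) -> B j (r C f) z <= phi z * mu (r C f).
    move=> Cz bf f0; have /andP[_] := Hmu (r C f) z (br _ _ mC bf) (rC0 _ f0) Cz.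
    by rewrite -/(r C _) rr.
  have BP z f : bounded_meas f -> (forall w, 0 <= f w) -> 0 <= B j (r C f) z.
    by move=> bf f0; apply: (posfun_ge0 (pBx z)); [exact: br|exact: rC0].
  have upp := ler_pM (BP x _ (bpm m) (pm0 m)) (BP y _ (bqm m) (qm0 m))
    (up _ _ Cx (bpm m) (pm0 m)) (up _ _ Cy (bqm m) (qm0 m)).
  have upq := ler_pM (BP x _ (bqm m) (qm0 m)) (BP y _ (bpm m) (pm0 m))
    (up _ _ Cx (bqm m) (qm0 m)) (up _ _ Cy (bpm m) (pm0 m)).
  set a := mu (r C (pm m)) in upp upq *. set b := mu (r C (qm m)) in upp upq *.
  set o := mu (r C (fun=> 1)).
  set X1 := B j (r C (pm m)) x * _ in upp *.
  set X2 := B j (r C (qm m)) x * _ in upq *.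
  set c := tau ^+ U.+1 * (sp * sq).
  have c0 : 0 <= c by rewrite mulr_ge0// exprn_ge0// ltW.
  set O := B j (r C (fun=> 1)) x * _.
  set t := rho ^+ T.
  have t0 : 0 <= t by exact: exprn_ge0.
  have lhs : kappa * phi x * (kappa * phi y) *
      ((t + s) * (a * b) + (t - s) * (b * a) + c * (o * o)) =
      kappa ^+ 2 * t * (phi x * a * (phi y * b) + phi x * b * (phi y * a)) +
      c * (kappa * phi x * (kappa * phi y) * (o * o)) by ring.
  rewrite lhs => main.
  have n1 : 0 <= c * (kappa * phi x * (kappa * phi y) * (o * o)).
    by rewrite mulr_ge0// -!expr2 mulr_ge0 ?sqr_ge0// mulr_ge0.
  have k2t : 0 <= kappa ^+ 2 * t by rewrite mulr_ge0// sqr_ge0.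
  have := ler_wpM2l k2t (lerD upp upq).
  by rewrite [rho ^+ T.+1]exprS -/t /rho; lra.
rewrite /claim !pmE !qmE.
rewrite (posfun_split (pBx x) mC (bpm m)) (posfun_split (pBx y) mC (bpm m)).
rewrite (posfun_split (pBx x) mC (bqm m)) (posfun_split (pBx y) mC (bqm m)).
have := ler_piMr (mulr_ge0 (exprn_ge0 U.+1 (ltW tau0)) ss0)
  (mulr_ile1 (B0 x) (B0 y) (B1 j x) (B1 j y)).
have R1 := regb _ _ (pBx x) (pBx y) 1 (or_introl erefl).
have R2 := regb _ _ (pBx x) (pBx y) (-1) (or_intror erefl).
have G1 := regg 1 (or_introl erefl). have G2 := regg (-1) (or_intror erefl).
move: R1 R2 G1 G2.
rewrite (posfun_split (pBx y) mC (bpm m)) (posfun_split (pBx y) mC (bqm m)).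
rewrite (posfun_split (pBx x) mC b1) (posfun_split (pBx y) mC b1).
rewrite -!/(r _ _) => -[R1 R1'] [R2 R2'] G1 G2 one.
rewrite ler_norml; apply/andP; split; lra.
Qed.

End Coupling.

(** * Stability of products of operators under frequency bounds *)

Section Recursion.
Local Open Scope ring_scope.
Context {R : realType} {d : measure_display} {X : measurableType d}.
Implicit Types (f : X -> R).

(** Index 0 stands for the last, possibly incomplete block, so [BD0] only bounds a
    mass, while [BD] also asks for a return to D. The functional psi is the
    initial law carried through an initial stretch shorter than a block, the only
    time at which it is known to charge D. *)

Variables (B : nat -> (X -> R) -> X -> R) (good_block : nat -> bool) (C D : set X).
Variables (M kappa C0 : R) (v : nat -> R) (N : nat) (psi : (X -> R) -> R) (q : nat).
Hypotheses (mC : measurable C) (mD : measurable D).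
Hypotheses (M0 : 0 <= M) (C00 : 0 <= C0) (kappa01 : 0 < kappa < 1) (q0 : (0 < q)%N).
Let m1 := M + 1.
Let tau := expR (- (64 * m1)).
Let rho := 1 - kappa ^+ 2.
Hypothesis pB : forall j, posop (B j).
Hypothesis B1 : forall j x, B j (fun=> 1) x <= 1.
Hypothesis BC : forall j x, good_block j -> ~ C x -> B j (fun=> 1) x <= tau ^+ 2.
Hypothesis Bm : forall j, good_block j -> minorized C kappa (B j).
Hypothesis v0 : forall j, 0 <= v j.
Hypothesis BD0 : forall x, D x -> expR (- v 0%N) <= B 0%N (fun=> 1) x.
Hypothesis BD : forall j x, D x -> expR (- v j.+1) <= B j.+1 \1_D x.
Hypothesis ppsi : posfun psi.
Hypothesis psi1 : psi (fun=> 1) <= 1.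
Hypothesis psiD : expR (- C0) <= psi \1_D.

Definition window_sum (w : nat -> R) lo m : R := \sum_(i < m) w (lo + i)%N.

Hypothesis hv : forall lo m, (lo + m <= N)%N ->
  window_sum v lo m <= M * m%:R + (lo + m)%:R / (200 * q%:R) + C0.
Hypothesis hn : forall lo m, (lo + m <= N)%N ->
  (bad_count good_block lo m)%:R <= m%:R / 3 + (lo + m)%:R / (200 * q%:R) + C0.

Let q200 : 0 < 200 * q%:R :> R. Proof. by apply: mulr_gt0; rewrite ltr0n. Qed.

Let pw lo m : posop (window_op B lo m) := posop_window_op pB lo m.
Let b1 : bounded_meas ((fun=> 1) : X -> R) := bounded_meas_cst 1.
Let bw lo m f : bounded_meas f -> bounded_meas (window_op B lo m f). Proof. by case: (pw lo m) => _; exact. Qed.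
Let w1_le lo m x : window_op B lo m (fun=> 1) x <= 1.
Proof. by apply: (window_op_le pB B1) => //; exact: bounded_meas_cst. Qed.
Let w1_ge0 lo m x : 0 <= window_op B lo m (fun=> 1) x.
Proof. by apply: (window_op_ge0 pB) => //; exact: bounded_meas_cst. Qed.

(** The total likelihood when the k most recent operators are removed. All
    operators have norm at most 1, so Psi is nondecreasing. *)
Let Psi k := psi (window_op B k (N - k) (fun=> 1)).

Let psiW k : posfun (fun f => psi (window_op B k (N - k) f)).
Proof. exact: posop_posfun. Qed.

Let PsiE e k : (e <= k)%N -> (k <= N)%N ->
  Psi e = psi (window_op B k (N - k) (window_op B e (k - e) (fun=> 1))).
Proof.
move=> ek kN; rewrite /Psi; congr psi.
have -> : (N - e = (k - e) + (N - k))%N by move: ek kN; clear; lia.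
by rewrite window_opD subnKC.
Qed.

Let Psi_le e k : (e <= k)%N -> (k <= N)%N -> Psi e <= Psi k.
Proof.
by move=> ek kN; rewrite (PsiE ek kN); apply: (posfun_le (psiW k)) => //; exact: bw.
Qed.

Let Psi_le1 k : Psi k <= 1.
Proof.
by apply: le_trans psi1; apply: (posfun_le ppsi) => //; exact: bw.
Qed.

(** Remain in D at each of the m steps. *)
Let w1_geD lo m x : expR (- window_sum v lo m) * \1_D x <= window_op B lo m (fun=> 1) x.
Proof.
elim: m x => [|m IH] x; first by rewrite /window_sum big_ord0 oppr0 expR0 mul1r indicE/=; case: (_ \in _).
have [xD|xD] := boolP (x \in D); last by rewrite indicE (negbTE xD) mulr0.
rewrite indicE xD mulr1 /window_sum big_ord_recr/= -/(window_sum v lo m) opprD expRD.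
have Dx : D x by exact: set_mem.
case: lo m IH => [|lo] [|m] IH; last 3 first.
- set S := expR _; have BDx : S * B m.+1 \1_D x <= B m.+1 (window_op B 0 m.+1 (fun=> 1)) x.
    rewrite -(posfunZ _ ((pB m.+1).1 x)); last exact: bounded_meas_indic.
    by apply: (posfun_le ((pB m.+1).1 x)) => //; [apply: bounded_measZ; exact: bounded_meas_indic|exact: bw].
  apply: le_trans BDx; rewrite ler_wpM2l ?expR_ge0//; exact: BD.
- rewrite addn0 /window_sum big_ord0 oppr0 expR0 mul1r.
  apply: le_trans (BD lo Dx) _; apply: (posfun_le ((pB lo.+1).1 x)) => //.
    exact: bounded_meas_indic.
  by move=> y; rewrite indicE; case: (_ \in _).
- set S := expR _; rewrite addSn.
  have BDx : S * B (lo + m.+1).+1 \1_D x <= B (lo + m.+1).+1 (window_op B lo.+1 m.+1 (fun=> 1)) x.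
    rewrite -(posfunZ _ ((pB (lo + m.+1).+1).1 x)); last exact: bounded_meas_indic.
    by apply: (posfun_le ((pB (lo + m.+1).+1).1 x)) => //; [apply: bounded_measZ; exact: bounded_meas_indic|exact: bw].
  apply: le_trans BDx; rewrite ler_wpM2l ?expR_ge0//; exact: BD.
- by rewrite addn0 /window_sum big_ord0 oppr0 expR0 mul1r; exact: BD0.
Qed.

Let Psi_ge k : (k <= N)%N -> expR (- (window_sum v k (N - k) + C0)) <= Psi k.
Proof.
move=> kN; rewrite opprD expRD.
apply: (@le_trans _ _ (expR (- window_sum v k (N - k)) * psi \1_D)).
  by rewrite ler_wpM2l ?expR_ge0.
rewrite -(posfunZ _ ppsi); last exact: bounded_meas_indic.
by apply: (posfun_le ppsi) => //; [apply: bounded_measZ; exact: bounded_meas_indic|exact: bw].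
Qed.

Let Psi_gt0 k : (k <= N)%N -> 0 < Psi k.
Proof. by move=> kN; apply: lt_le_trans (Psi_ge kN); exact: expR_gt0. Qed.

Let D_nonempty : exists x, D x.
Proof.
apply: contrapT => nD; have D0 : \1_D = (fun=> 0) :> (X -> R).
  by apply/funext => x; rewrite indicE memNset// => Dx; apply: nD; exists x.
by have := psiD; rewrite D0 (posfun0 ppsi) leNgt expR_gt0.
Qed.

Let tau01 : 0 < tau <= 1.
Proof.
rewrite /tau expR_gt0 -[X in _ <= X]expR0 ler_expR.
by have := M0; rewrite /m1; lra.
Qed.

Let rho01 : 0 < rho < 1. Proof. by have := kappa01; rewrite /rho; nra. Qed.

Let kappa01' : 0 <= kappa <= 1.
Proof. by have /andP[? ?] := kappa01; rewrite !ltW. Qed.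

(** Up to a constant and the coupling error, the operators e to k - 1 reduce the
    mass carried from x through the operators s - 1 down to k by the same ratio as
    the mass carried from psi. *)
Let swap e k s U sp x : (e <= k)%N -> (k <= s)%N -> (s <= N)%N ->
  (U + 2 * bad_count good_block k (s - k) + 2 <= s - k)%N ->
  (forall y, window_op B e (k - e) (fun=> 1) y <= sp) ->
  (1 - rho) * window_op B e (s - e) (fun=> 1) x * Psi k <=
  2 * window_op B k (s - k) (fun=> 1) x * Psi e + tau ^+ U * sp * Psi s.
Proof.
move=> ek ks sN HU Hsp; have es := leq_trans ek ks; have kN := leq_trans ks sN.
have HT y : (1 + U + 2 * bad_count good_block k (s - k) + 1 <=
    (s - k) + ~~ ((x \in C) && (y \in C)))%N.
  by apply: leq_trans (leq_addr _ _); move: HU; clear; move: (bad_count _ _ _) => nb; lia.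
set p := window_op B e (k - e) (fun=> 1).
have bp : bounded_meas p by exact: bw.
have p0 y : 0 <= p y by exact: w1_ge0.
have cp y := coupling mC tau01 kappa01' pB B1 BC Bm (lo := k) bp b1 p0
  (fun=> ler01) Hsp (fun=> lexx 1) (HT y).
have pE : window_op B k (s - k) p = window_op B e (s - e) (fun=> 1).
  have -> : (s - e = (k - e) + (s - k))%N by move: ek ks; clear; lia.
  by rewrite window_opD subnKC.
rewrite pE in cp.
set P := window_op B e (s - e) (fun=> 1) in cp *.
set Q := window_op B k (s - k) (fun=> 1) in cp *.
have bP : bounded_meas P by exact: bw.
have bQ : bounded_meas Q by exact: bw.
rewrite (PsiE ks sN) (PsiE es sN) -/P -/Q.
have H : psi (window_op B s (N - s) (fun y => ((1 - rho) * P x) * Q y)) <=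
    psi (window_op B s (N - s) (fun y => (2 * Q x) * P y + (tau ^+ U * sp) * 1)).
  apply: (posfun_le (psiW s)); [exact: bounded_measZ| |].
    by apply: bounded_measD; exact: bounded_measZ.
  move=> y; have := cp y; rewrite ler_norml expr1 -/rho => /andP[_].
  have := mulr_ge0 (w1_ge0 k (s - k) x) (w1_ge0 e (s - e) y); rewrite -/P -/Q => QP.
  have /andP[_ r1] := rho01; have : rho * (Q x * P y) <= Q x * P y.
    by rewrite ler_piMl// ltW.
  lra.
move: H; rewrite (posfunZ _ (psiW s))// (posfunD (psiW s)); last 2 first.
- exact: bounded_measZ.
- exact: bounded_measZ.
by rewrite !(posfunZ _ (psiW s)).
Qed.

Section Step.
Variables (j0 q' : nat).
Hypotheses (q'0 : (0 < q')%N) (q'q : (q' <= q)%N).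
Hypothesis j08 : 200 * (C0 + 2) <= j0%:R.
Hypothesis j0e : expR (- j0%:R) <= (1 - rho) / 4.
Let d0 := (q * j0)%N.
(** The length of the windows used at k. It is at least k / q, so that the error
    (lo + m) / (200 q) of the frequency bounds is a small fraction of it. With
    q' = 1 the window reaches index 0; with q' = q its cost (M + 1) k / q is at
    most w k / 4. *)
Let jj k := (k %/ q')%N.

Let j0_ge8 : (8 <= j0)%N.
Proof. rewrite -(ler_nat R); have := C00; have := j08; lra. Qed.

Let jj_ge k : (d0 <= k)%N -> (j0 <= jj k)%N.
Proof.
move=> dk; rewrite /jj leq_divRL//; apply: leq_trans dk.
by rewrite mulnC leq_mul2r q'q orbT.
Qed.

Let slack k : (2 * k)%:R / (200 * q%:R) <= ((jj k)%:R + 1) / 100 :> R.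
Proof.
have k1 : (k <= q * (jj k).+1)%N.
  apply: leq_trans (_ : q' * (jj k).+1 <= _)%N; last by rewrite leq_mul2r q'q orbT.
  by rewrite mulnC; apply/ltnW; rewrite /jj ltn_ceil.
have qR : (0 : R) < q%:R by rewrite ltr0n.
rewrite ler_pdivrMr; last lra.
by move: k1; rewrite -(ler_nat R) !natrM -natr1; lra.
Qed.

Let jd k : (jj k <= k)%N. Proof. exact: leq_div. Qed.

(** The budget of the coupling is met with U = j / 4: one step out of three is bad
    and counts twice, and 1/4 + 2/3 < 1. *)
Let nbad_win k lo : (d0 <= k)%N -> (lo <= k)%N -> (lo + jj k <= N)%N ->
  (jj k %/ 4 + 2 * bad_count good_block lo (jj k) + 2 <= jj k)%N.
Proof.
move=> dk lok kN; have := hn kN; have := slack k; have := jj_ge dk.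
have lk : ((lo + jj k)%:R : R) / (200 * q%:R) <= (2 * k)%:R / (200 * q%:R).
  rewrite ler_wpM2r ?invr_ge0 ?(ltW q200)// ler_nat.
  by have := jd k; move: lok; clear; lia.
have d4 : (jj k %/ 4)%:R <= (jj k)%:R / 4 :> R.
  by rewrite ler_pdivlMr// -natrM ler_nat leq_trunc_div.
have := C00; have := j08.
rewrite -(ler_nat R) => h1 h2 h3 h4 h5.
by rewrite -(ler_nat R) natrD natrD natrM; lra.
Qed.

Let vs_win k m : (d0 <= k)%N -> (m <= 2 * jj k)%N -> (k - jj k + m <= N)%N ->
  window_sum v (k - jj k) m <= (2 * M + 1) * (jj k)%:R.
Proof.
move=> dk mk kN; have := hv kN; have := slack k; have := jj_ge dk.
have lk : ((k - jj k + m)%:R : R) / (200 * q%:R) <= (2 * k)%:R / (200 * q%:R).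
  rewrite ler_wpM2r ?invr_ge0 ?(ltW q200)// ler_nat.
  by have := jd k; move: mk; clear; lia.
have Mm : M * m%:R <= M * (2 * (jj k)%:R).
  by rewrite ler_wpM2l// -natrM ler_nat.
have := C00; have := j08.
rewrite -(ler_nat R) => h1 h2 h3 h4 h5.
by lra.
Qed.

Let Z k : R := expR (- (m1 * (jj k)%:R)).

Let m1_ge1 : 1 <= m1. Proof. by have := M0; rewrite /m1; lra. Qed.

Let Z01 k : 0 < Z k <= 1.
Proof.
rewrite /Z expR_gt0 -[X in _ <= X]expR0 ler_expR oppr_le0 mulr_ge0//.
by have := m1_ge1; lra.
Qed.

Let expRNj k : (d0 <= k)%N -> 4 <= (1 - rho) * expR (jj k)%:R.
Proof.
move=> dk; have /andP[_ r1] := rho01.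
have : expR j0%:R <= expR (jj k)%:R :> R by rewrite ler_expR ler_nat jj_ge.
have := j0e; rewrite expRN; have e0 : 0 < expR j0%:R :> R by exact: expR_gt0.
rewrite -(ler_pM2r e0) mulVf ?gt_eqF// => h1 h2.
have : (1 - rho) * expR j0%:R <= (1 - rho) * expR (jj k)%:R by rewrite ler_wpM2l//; lra.
lra.
Qed.

(** Since j %/ 4 is at least j / 8, the constant 64 of tau provides the power 8,
    beyond the powers 4 and 2 spent in [ratio_bound] and [psi_step]. *)
Let tauU k : (d0 <= k)%N -> tau ^+ (jj k %/ 4) <= Z k ^+ 8.
Proof.
move=> dk; rewrite /tau /Z -!expRM_natl ler_expR.
have j4 : (jj k)%:R <= (jj k %/ 4)%:R * 8 :> R.
  rewrite -natrM ler_nat; have := leq_trans j0_ge8 (jj_ge dk).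
  by move: (jj k) => j; clear; lia.
have := ler_wpM2l (le_trans ler01 m1_ge1) j4.
lra.
Qed.

(** Applying also the operators k - j to k - 1, where j = jj k, costs at most a
    factor exp (2 (M + 1) j). A direct bound would need psi to charge D at the
    time of k; a point x of D is exchanged for psi by [swap] instead. The
    remainder of the coupling involves Psi (k + j), bounded in terms of Psi k by
    the statement at k + j: the induction goes from N downwards, and near N the
    bound of psi on D applies. *)
Lemma psi_step k : (d0 <= k)%N -> (k <= N)%N -> Z k ^+ 2 * Psi k <= Psi (k - jj k).
Proof.
have [n] := ubnP (N - k); elim: n k => // n IH k kn dk kN.
have j1 : (0 < jj k)%N.
  by apply: leq_trans (jj_ge dk); apply: leq_trans j0_ge8.
have /andP[z0 z1] := Z01 k.
set j := jj k in j1 *; have jk : (j <= k)%N := jd k.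
set z := Z k in z0 z1 *.
have zE : z ^+ 2 * expR j%:R = expR (- ((2 * M + 1) * j%:R)).
  by rewrite /z /Z -expRM_natl -expRD /m1; congr expR; rewrite -/j; ring.
have Pk0 := Psi_gt0 kN.
have e1 : 1 <= expR j%:R :> R by rewrite -[X in X <= _]expR0 ler_expR.
have [sN|sN] := leqP (k + j) N; last first.
  have kjN : (k - j <= N)%N by apply: leq_trans kN; exact: leq_subr.
  have := Psi_ge kjN.
  have wn : window_sum v (k - j) (N - (k - j)) <= (2 * M + 1) * j%:R.
    apply: vs_win => //; first by move: sN jk; clear; lia.
    by rewrite subnKC.
  have : expR (- ((2 * M + 1) * j%:R + C0)) <= expR (- (window_sum v (k - j) (N - (k - j)) + C0)).
    by rewrite ler_expR lerN2 lerD2r.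
  rewrite opprD expRD -zE => h1 h2; apply: le_trans (le_trans h1 h2).
  rewrite -mulrA; apply: ler_wpM2l; first exact: exprn_ge0 (ltW z0).
  rewrite -expRD; apply: (le_trans (Psi_le1 k)); rewrite -[X in X <= _]expR0 ler_expR.
  have := jj_ge dk; rewrite -/j -(ler_nat R); have := j08; have := C00; lra.
have ds : (d0 <= k + j)%N by exact: leq_trans dk (leq_addr _ _).
have ns : (N - (k + j) < n)%N by move: kn j1 sN; clear; lia.
have := IH _ ns ds sN.
have js1 : (j <= jj (k + j))%N by apply: leq_div2r; exact: leq_addr.
have js3 : (jj (k + j) <= 3 * j)%N.
  rewrite /jj -ltnS ltn_divLR//.
  have := ltn_ceil k q'0; rewrite -/(jj k) -/j.
  have : (2 * (j.+1 * q') <= (3 * j).+1 * q')%N.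
    by rewrite mulnA leq_mul2r; apply/orP; right; move: j1; clear; lia.
  move: jk; clear; move: (j.+1 * q')%N ((3 * j).+1 * q')%N => A A'; lia.
have Ps : Psi (k + j - jj (k + j)) <= Psi k.
  by apply: Psi_le => //; move: js1; clear; lia.
have z6 : z ^+ 6 <= Z (k + j) ^+ 2.
  rewrite /z /Z -!expRM_natl ler_expR -/j.
  have : (jj (k + j))%:R <= 3 * j%:R :> R by rewrite -natrM ler_nat.
  by move=> /(ler_wpM2l (le_trans ler01 m1_ge1)); lra.
move=> IHs.
have Ps0 := Psi_gt0 sN.
have S6 : z ^+ 6 * Psi (k + j) <= Psi k.
  apply: le_trans Ps; apply: le_trans IHs; rewrite ler_wpM2r// ltW//.
have [x Dx] := D_nonempty.
have HU := nbad_win dk (leqnn k) sN.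
have kj : (k - j <= k)%N by exact: leq_subr.
have HU' : (j %/ 4 + 2 * bad_count good_block k (k + j - k) + 2 <= k + j - k)%N.
  by rewrite addKn.
have := swap x kj (leq_addr j k) sN HU' (w1_le (k - j) (k - (k - j))).
have wsp : z ^+ 2 * expR j%:R <= window_op B (k - j) (k + j - (k - j)) (fun=> 1) x.
  rewrite zE; have := w1_geD (k - j) (k + j - (k - j)) x.
  rewrite indicE mem_set// mulr1; apply: le_trans; rewrite ler_expR lerN2.
  apply: vs_win => //; first by rewrite -/j; move: jk; clear; lia.
  by rewrite subnKC//; move: jk; clear; lia.
have w2 := w1_le k (k + j - k) x.
have P0 := Psi_gt0 (leq_trans kj kN).
set W := window_op _ _ _ _ _ in wsp *; set W2 := window_op _ _ _ _ _ in w2 *.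
have tz := tauU dk; rewrite -/j -/z in tz.
have e4 := expRNj dk; rewrite -/j in e4.
have z20 : 0 <= z ^+ 2 by rewrite exprn_ge0// ltW.
have /andP[_ r1] := rho01.
have h1 : 4 * z ^+ 2 <= (1 - rho) * W.
  have rr : 0 <= 1 - rho by lra.
  have := ler_wpM2l rr wsp; have := ler_wpM2l z20 e4; lra.
have h2 : 4 * z ^+ 2 * Psi k <= (1 - rho) * W * Psi k by rewrite ler_wpM2r// ltW.
have h3 : tau ^+ (j %/ 4) * 1 * Psi (k + j) <= z ^+ 2 * Psi k.
  rewrite mulr1; apply: (@le_trans _ _ (z ^+ 8 * Psi (k + j))).
    by rewrite ler_wpM2r// ltW.
  by rewrite (exprD z 2 6) -mulrA ler_wpM2l.
have h4 : 2 * W2 * Psi (k - j) <= 2 * Psi (k - j).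
  by rewrite ler_wpM2r ?(ltW P0)//; lra.
have : 0 <= z ^+ 2 * Psi k by rewrite mulr_ge0// ltW.
lra.
Qed.

(** The likelihood from an arbitrary point is compared with the one from psi, by
    induction on k: the statement at k - j supplies the uniform bound sp of the
    coupling, multiplied there by tau ^ U, at most Z k ^ 8. The factor Z k ^ 4 thus
    does not accumulate along the induction, and it absorbs the loss of
    [psi_step] and the constants. *)
Lemma ratio_bound A1 : 1 <= A1 ->
  (forall k, (k <= d0)%N -> (k <= N)%N -> Psi k <= A1 * Psi 0) ->
  forall k x, (k <= N)%N ->
  window_op B 0 k (fun=> 1) x * Psi k * Z k ^+ 4 <= A1 * Psi 0.
Proof.
move=> A11 HA k; have [n] := ubnP k; elim: n k => // n IH k kn x kN.
have /andP[z0 z1] := Z01 k.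
have a0 := w1_ge0 0 k x; have a1 := w1_le 0 k x.
have Pk0 := Psi_gt0 kN.
have [dk|/ltnW dk] := leqP d0 k; last first.
  have := HA k dk kN; apply: le_trans.
  rewrite -[X in _ <= X]mulr1 ler_pM ?exprn_ge0 ?(ltW z0)// ?exprn_ile1 ?(ltW z0)//.
    by rewrite mulr_ge0// ltW.
  by rewrite ler_piMl// ltW.
have j1 : (0 < jj k)%N.
  by apply: leq_trans (jj_ge dk); apply: leq_trans j0_ge8.
set j := jj k in j1 *; have jk : (j <= k)%N := jd k.
set z := Z k in z0 z1 *.
have kjk : (k - j <= k)%N by exact: leq_subr.
have kjN := leq_trans kjk kN.
have Pkj := Psi_gt0 kjN.
set sp := A1 * Psi 0 / (Psi (k - j) * z ^+ 4).
have z40 : 0 < z ^+ 4 by rewrite exprn_gt0.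
have Hsp y : window_op B 0 (k - j - 0) (fun=> 1) y <= sp.
  rewrite subn0 /sp ler_pdivlMr ?mulr_gt0//.
  have kjn : (k - j < n)%N by move: kn j1 jk; clear; lia.
  have := IH _ kjn y kjN; apply: le_trans; rewrite mulrA ler_wpM2l//.
    by rewrite mulr_ge0// ltW.
  rewrite /z /Z -!expRM_natl ler_expR.
  have : (jj (k - j))%:R <= j%:R :> R.
    by rewrite ler_nat leq_div2r.
  by move=> /(ler_wpM2l (le_trans ler01 m1_ge1)); rewrite -/j; lra.
have HU := nbad_win (lo := k - j) dk kjk.
rewrite -/j subnK// in HU; have {}HU := HU kN.
have HU' : (j %/ 4 + 2 * bad_count good_block (k - j) (k - (k - j)) + 2 <= k - (k - j))%N.
  by rewrite subKn.
have := swap x (leq0n (k - j)) kjk kN HU' Hsp.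
rewrite subn0; set a := window_op _ _ _ _ _ in a0 a1 *; set W2 := window_op _ _ _ _ _.
have w2 : W2 <= 1 by exact: w1_le.
have P00 := Psi_gt0 (leq0n N).
have tz := tauU dk; rewrite -/j -/z in tz.
have st := psi_step dk kN; rewrite -/j -/z in st.
have e4 := expRNj dk; rewrite -/j in e4.
have ze : z * expR j%:R <= 1.
  rewrite /z /Z -/j -expRD -[X in _ <= X]expR0 ler_expR.
  have : 1 * j%:R <= m1 * j%:R by rewrite ler_wpM2r.
  lra.
have z4 : 4 * z <= 1 - rho.
  have /andP[_ r1] := rho01.
  have := ler_wpM2l (ltW z0) e4.
  have rr : 0 <= 1 - rho by lra.
  by have := ler_wpM2l rr ze; lra.
have spE : sp * Psi (k - j) * z ^+ 4 = A1 * Psi 0.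
  by rewrite /sp; field; rewrite !gt_eqF.
have sp0 : 0 <= sp by rewrite /sp divr_ge0 ?mulr_ge0 ?ltW//; lra.
have z2 : 0 < z ^+ 2 by rewrite exprn_gt0.
set P := Psi (k - j) in Pkj spE st *.
move=> sw.
have /andP[_ r1] := rho01.
have rr : 0 < 1 - rho by lra.
have h1 : (1 - rho) * (a * Psi k * z ^+ 4) <= z ^+ 2 * ((1 - rho) * a * P).
  have -> : (1 - rho) * (a * Psi k * z ^+ 4) =
    ((1 - rho) * a * z ^+ 2) * (z ^+ 2 * Psi k) by ring.
  have -> : z ^+ 2 * ((1 - rho) * a * P) = ((1 - rho) * a * z ^+ 2) * P by ring.
  by rewrite ler_wpM2l// !mulr_ge0// ltW.
have h2 : z ^+ 2 * (tau ^+ (j %/ 4) * sp * Psi k) <= z ^+ 4 * (A1 * Psi 0).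
  apply: (@le_trans _ _ (z ^+ 2 * (z ^+ 8 * sp * Psi k))).
    by rewrite ler_wpM2l ?(ltW z2)// ler_wpM2r ?(ltW Pk0)// ler_wpM2r.
  have -> : z ^+ 2 * (z ^+ 8 * sp * Psi k) = (z ^+ 8 * sp) * (z ^+ 2 * Psi k) by ring.
  have -> : z ^+ 4 * (A1 * Psi 0) = (z ^+ 8 * sp) * P by rewrite -spE; ring.
  by rewrite ler_wpM2l// mulr_ge0// exprn_ge0// ltW.
have h3 : 2 * W2 * Psi 0 <= 2 * (A1 * Psi 0).
  have : W2 * Psi 0 <= 1 * Psi 0 by rewrite ler_wpM2r// ltW.
  have : 1 * Psi 0 <= A1 * Psi 0 by rewrite ler_wpM2r// ltW.
  lra.
have h4 := ler_wpM2l (ltW z2) sw.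
have h5 := ler_wpM2l (ltW z2) h3.
have AP : 0 <= A1 * Psi 0 by rewrite mulr_ge0 ?(ltW P00)//; lra.
have z2z : z ^+ 2 <= z by rewrite expr2 ler_piMl// ltW.
have z4z : z ^+ 4 <= z ^+ 2.
  by rewrite (exprD z 2 2) ler_piMl ?(ltW z2)// (le_trans z2z).
have zA := mulr_ge0 (ltW z0) AP.
have h6 := ler_wpM2r AP z2z. have h7 := ler_wpM2r AP z4z. have h8 := ler_wpM2r AP z4.
have : (1 - rho) * (a * Psi k * z ^+ 4) <= (1 - rho) * (A1 * Psi 0) by lra.
by rewrite ler_pM2l.
Qed.

End Step.

Variables (w Bh : R) (h : X -> R).
Hypotheses (w01 : 0 < w <= 1) (rhow : rho <= expR (- (64 * w))) (qw : 4 * m1 <= w * q%:R).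
Hypotheses (bh : bounded_meas h) (hB : forall x, `|h x| <= Bh).
Variable j0 : nat.
Hypothesis j08 : 200 * (C0 + 2) <= j0%:R.
Hypothesis j0e : expR (- j0%:R) <= (1 - rho) / 4.

Let d0 := (q * j0)%N.
Let A1 := expR (2 * m1 * d0%:R + 2 * C0).

Let Bh0 : 0 <= Bh. Proof. exact: le_trans (normr_ge0 (h point)) (hB point). Qed.

Let A11 : 1 <= A1.
Proof.
rewrite /A1 -[X in X <= _]expR0 ler_expR; have := M0; have := C00.
have : 0 <= M * d0%:R by rewrite mulr_ge0.
have : 0 <= d0%:R :> R by [].
by rewrite /m1; lra.
Qed.

Let psi_init k : (k <= d0)%N -> (k <= N)%N -> Psi k <= A1 * Psi 0.
Proof.
move=> kd kN; have P0 := Psi_gt0 (leq0n N).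
have M_d : 0 <= M * d0%:R by rewrite mulr_ge0.
have d00 : 0 <= d0%:R :> R by [].
have [dN|dN] := leqP d0 N.
  apply: le_trans (Psi_le kd dN) _.
  have := psi_step (ltn0Sn 0) q0 j08 j0e (leqnn d0) dN; rewrite divn1 subnn.
  rewrite -expRM_natl -(ler_pM2l (expR_gt0 (2 * m1 * d0%:R))) mulrA -expRD.
  have -> : 2 * m1 * d0%:R + 2 * - (m1 * d0%:R) = 0 by ring.
  rewrite expR0 mul1r => /le_trans; apply; rewrite ler_wpM2r ?(ltW P0)//.
  by rewrite ler_expR; have := C00; lra.
apply: (le_trans (Psi_le1 k)).
have := Psi_ge (leq0n N); rewrite subn0 -(ler_pM2l (expR_gt0 (2 * m1 * d0%:R + 2 * C0))).
rewrite -expRD; apply: le_trans; rewrite -[X in X <= _]expR0 ler_expR.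
have := hv (leqnn (0 + N)); rewrite add0n.
have Nd : N%:R <= d0%:R :> R by rewrite ler_nat ltnW.
have N2 : N%:R / (200 * q%:R) <= N%:R :> R.
  rewrite ler_pdivrMr//.
  by apply: ler_peMr => //; rewrite -natrM ler1n muln_gt0.
have := ler_wpM2l M0 Nd.
have := C00; rewrite /m1; lra.
Qed.

(** For k beyond d0 the coupling with T = k / 16 and U = k / 4 gives two terms: the
    first decays at rate rho and is controlled by [ratio_bound], the second by
    tau against the growth of Psi given by [psi_step]. For k below d0 the decay is
    absorbed in the constant. *)
Lemma stable_bound k x : (k <= N)%N ->
  `|window_op B 0 k h x * Psi 0 - window_op B 0 k (fun=> 1) x * psi (window_op B 0 N h)| * Psi k <=
  (4 * Bh * A1 + 2 * Bh) * expR (w * d0%:R) * expR (- (w * k%:R)) * Psi 0 ^+ 2.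
Proof.
move=> kN.
set a := window_op B 0 k (fun=> 1); set b := window_op B 0 k h; set H := psi _.
pose p y := h y + Bh * 1.
have bp : bounded_meas p by apply: bounded_measD => //; exact: bounded_measZ.
have p0 y : 0 <= p y by have := hB y; rewrite /p ler_norml; lra.
have p2 y : p y <= 2 * Bh by have := hB y; rewrite /p ler_norml; lra.
have pE n y : window_op B 0 n p y = window_op B 0 n h y + Bh * window_op B 0 n (fun=> 1) y.
  have pwy := (pw 0 n).1 y.
  by rewrite /p (posfunD pwy) ?(posfunZ _ pwy)//; exact: bounded_measZ.
have a0 y : 0 <= a y by exact: w1_ge0.
have ba y : `|b y| <= Bh * a y.
  have pwy := (pw 0 k).1 y; rewrite ler_norml /a /b.
  rewrite -(posfunZ Bh pwy)// -mulN1r -(posfunZ (-1) pwy); last exact: bounded_measZ.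
  apply/andP; split; apply: (posfun_le pwy) => //; try exact: bounded_measZ.
  - by do 2 apply: bounded_measZ.
  - by move=> y'; have := hB y'; rewrite ler_norml; lra.
  - by move=> y'; have := hB y'; rewrite ler_norml; lra.
have [Pk0 P00] : 0 < Psi k /\ 0 < Psi 0 by split; exact: Psi_gt0.
have bba : bounded_meas a by exact: bw.
have bbb : bounded_meas b by exact: bw.
have Pa : Psi 0 = psi (window_op B k (N - k) a) by rewrite (PsiE (leq0n k) kN) subn0.
have Hb : H = psi (window_op B k (N - k) b).
  by rewrite /H; congr psi; rewrite -[in LHS](subnKC kN) window_opD.
have bnd T U : (T + U + 2 * bad_count good_block 0 k + 1 <= k)%N ->
    `|b x * Psi 0 - a x * H| <= 4 * Bh * rho ^+ T * a x * Psi 0 + 2 * Bh * tau ^+ U * Psi k.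
  move=> HTU.
  have HT y : (T + U + 2 * bad_count good_block 0 k + 1 <= k + ~~ ((x \in C) && (y \in C)))%N.
    exact: leq_trans HTU (leq_addr _ _).
  have cp y := coupling mC tau01 kappa01' pB B1 BC Bm (lo := 0) bp b1 p0
    (fun=> ler01) p2 (fun=> lexx 1) (HT y).
  have rT0 : 0 <= rho ^+ T by have /andP[/ltW r0 _] := rho01; exact: exprn_ge0.
  have pt y : `|b x * a y - a x * b y| <= 4 * Bh * rho ^+ T * a x * a y + 2 * Bh * tau ^+ U * 1.
    have := cp y; rewrite !pE -/a -/b -/rho.
    have -> : (b x + Bh * a x) * a y - a x * (b y + Bh * a y) = b x * a y - a x * b y by ring.
    move=> /le_trans; apply; rewrite !mulr1.
    have -> : 2 * Bh * tau ^+ U = tau ^+ U * (2 * Bh) by ring.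
    rewrite lerD2r.
    have -> : 4 * Bh * rho ^+ T * a x * a y = rho ^+ T * (2 * Bh * a x * a y + a x * (2 * Bh * a y)) by ring.
    rewrite ler_wpM2l//.
    have h1 : b x + Bh * a x <= 2 * Bh * a x by have := ba x; rewrite ler_norml; lra.
    have h2 : b y + Bh * a y <= 2 * Bh * a y by have := ba y; rewrite ler_norml; lra.
    by rewrite lerD// ?ler_wpM2r// ler_wpM2l.
  rewrite Pa Hb; set L := fun f => psi (window_op B k (N - k) f).
  have pL : posfun L := psiW k.
  have rE : 4 * Bh * rho ^+ T * a x * L a + 2 * Bh * tau ^+ U * Psi k =
     L (fun y => (4 * Bh * rho ^+ T * a x) * a y + (2 * Bh * tau ^+ U) * 1).
    by rewrite (posfunD pL) ?(posfunZ _ pL)//; exact: bounded_measZ.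
  have lE s : s * (b x * L a - a x * L b) = L (fun y => (s * b x) * a y + (- s * a x) * b y).
    by rewrite (posfunD pL) ?(posfunZ _ pL)//; [ring|exact: bounded_measZ|exact: bounded_measZ].
  rewrite -/(L a) -/(L b) rE ler_norml -[b x * L a - _]mul1r lE.
  apply/andP; split; last first.
    apply: (posfun_le pL); try by apply: bounded_measD; exact: bounded_measZ.
    by move=> y; have := pt y; rewrite ler_norml; lra.
  rewrite lerNl -mulN1r -(posfunZ (-1) pL); last by apply: bounded_measD; exact: bounded_measZ.
  apply: (posfun_le pL); [apply: bounded_measZ| |]; try by apply: bounded_measD; exact: bounded_measZ.
  by move=> y; have := pt y; rewrite ler_norml; lra.
have /andP[w0 w1] := w01.
have M_d : 0 <= M * d0%:R by rewrite mulr_ge0.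
have A10 := le_trans ler01 A11.
have [dk|/ltnW dk] := leqP d0 k; last first.
  have h1 : `|b x * Psi 0 - a x * H| <= 2 * Bh * a x * Psi 0.
    have HB : `|H| <= Bh * Psi 0.
      rewrite Pa Hb; set L := fun f => psi (window_op B k (N - k) f).
      have pL : posfun L := psiW k.
      rewrite -/(L a) -/(L b) -(posfunZ Bh pL)// ler_norml -mulN1r -(posfunZ (-1) pL); last exact: bounded_measZ.
      apply/andP; split; apply: (posfun_le pL) => //; try exact: bounded_measZ.
      - by do 2 apply: bounded_measZ.
      - by move=> y; have := ba y; rewrite ler_norml; lra.
      - by move=> y; have := ba y; rewrite ler_norml; lra.
    apply: le_trans (ler_normB _ _) _; rewrite !normrM (ger0_norm (ltW P00)) (ger0_norm (a0 x)).
    have := ler_wpM2l (a0 x) HB; have := ler_wpM2r (ltW P00) (ba x); lra.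
  apply: le_trans (ler_wpM2r (ltW Pk0) h1) _.
  have h2 : 2 * Bh * a x * Psi 0 * Psi k <= 2 * Bh * A1 * Psi 0 ^+ 2.
    have -> : 2 * Bh * A1 * Psi 0 ^+ 2 = 2 * Bh * Psi 0 * (A1 * Psi 0) by ring.
    have -> : 2 * Bh * a x * Psi 0 * Psi k = 2 * Bh * Psi 0 * (a x * Psi k) by ring.
    rewrite ler_wpM2l ?mulr_ge0 ?(ltW P00)//; apply: le_trans (psi_init dk kN).
    by rewrite ler_piMl ?(ltW Pk0)//; exact: w1_le.
  apply: (le_trans h2); rewrite ler_wpM2r ?exprn_ge0 ?(ltW P00)//.
  rewrite -[X in _ <= X]mulrA -expRD.
  have : 1 <= expR (w * d0%:R + - (w * k%:R)).
    rewrite -[X in X <= _]expR0 ler_expR subr_ge0 ler_pM2l// ler_nat //.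
  have BA : 0 <= Bh * A1 by rewrite mulr_ge0.
  have c0 : 0 <= 4 * Bh * A1 + 2 * Bh by have := Bh0; lra.
  move=> /(ler_wpM2l c0); have := Bh0; lra.
have jr : (200 * (C0 + 2) <= k%:R)%R.
  apply: (le_trans j08); rewrite ler_nat; apply: leq_trans dk.
  by rewrite /d0 -{1}[j0]mul1n leq_mul2r q0 orbT.
have k16 : (16 <= k)%N by rewrite -(ler_nat R); have := C00; have := jr; lra.
have HTU : (k %/ 16 + k %/ 4 + 2 * bad_count good_block 0 k + 1 <= k)%N.
  have := hn (lo := 0) (m := k); rewrite add0n => /(_ kN).
  have d4 : (k %/ 4)%:R <= k%:R / 4 :> R.
    by rewrite ler_pdivlMr// -natrM ler_nat leq_trunc_div.
  have d16 : (k %/ 16)%:R <= k%:R / 16 :> R.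
    by rewrite ler_pdivlMr// -natrM ler_nat leq_trunc_div.
  have N2 : k%:R / (200 * q%:R) <= k%:R / 200 :> R.
    rewrite ler_wpM2l// lef_pV2 ?posrE ?mulr_gt0 ?ltr0n//.
    by apply: ler_peMr; rewrite ?ler0n ?ler1n.
  (* 1/16 + 1/4 + 2/3 < 1 *)
  rewrite -(ler_nat R) 3!natrD natrM; have := C00; have := jr; lra.
apply: le_trans (ler_wpM2r (ltW Pk0) (bnd _ _ HTU)) _.
have rT : rho ^+ (k %/ 16) <= expR (- (2 * w * k%:R)).
  apply: (@le_trans _ _ (expR (- (64 * w)) ^+ (k %/ 16))).
    by rewrite lerXn2r ?nnegrE ?expR_ge0//; have /andP[/ltW] := rho01.
  rewrite -expRM_natl ler_expR.
  have k32 : k%:R <= (k %/ 16)%:R * 32 :> R.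
    by rewrite -natrM ler_nat; move: k16; clear; lia.
  by have := ler_wpM2l (ltW w0) k32; lra.
have tU : tau ^+ (k %/ 4) <= expR (- (8 * m1 * k%:R)).
  rewrite /tau -expRM_natl ler_expR.
  have k8 : k%:R <= (k %/ 4)%:R * 8 :> R.
    by rewrite -natrM ler_nat; move: k16; clear; lia.
  have m10 : 0 <= m1 by have := M0; rewrite /m1; lra.
  by have := ler_wpM2l m10 k8; lra.
have ra : a x * Psi k <= A1 * expR (w * k%:R) * Psi 0.
  have := ratio_bound q0 (leqnn q) j08 j0e A11 psi_init x kN.
  rewrite -/a -expRM_natl -(ler_pM2r (expR_gt0 (w * k%:R))).
  have -> : A1 * expR (w * k%:R) * Psi 0 = A1 * Psi 0 * expR (w * k%:R) by ring.
  apply: le_trans; rewrite -[X in _ <= X]mulrA -expRD ler_peMr ?mulr_ge0 ?(ltW Pk0)//.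
  rewrite -[X in X <= _]expR0 ler_expR.
  have kq : (k %/ q)%:R * q%:R <= k%:R :> R by rewrite -natrM ler_nat leq_trunc_div.
  have := ler_wpM2l (ltW w0) kq.
  have := ler_wpM2r (ler0n R (k %/ q)) qw.
  lra.
have pk : Psi k <= expR (2 * m1 * k%:R) * Psi 0.
  have := psi_step (ltn0Sn 0) q0 j08 j0e dk kN; rewrite divn1 subnn.
  rewrite -expRM_natl -(ler_pM2l (expR_gt0 (2 * m1 * k%:R))) mulrA -expRD.
  have -> : 2 * m1 * k%:R + 2 * - (m1 * k%:R) = 0 by ring.
  by rewrite expR0 mul1r.
set e := expR (- (w * k%:R)).
have e0 : 0 < e by exact: expR_gt0.
have t1 : rho ^+ (k %/ 16) * (a x * Psi k) <= A1 * e * Psi 0.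
  have ax0 : 0 <= a x * Psi k by rewrite mulr_ge0// ltW.
  have rr0 : 0 <= rho ^+ (k %/ 16) by have /andP[/ltW r0 _] := rho01; exact: exprn_ge0.
  have := ler_pM rr0 ax0 rT ra; move/le_trans; apply.
  have -> : e = expR (- (2 * w * k%:R)) * expR (w * k%:R).
    by rewrite -expRD /e; congr expR; ring.
  lra.
have t2 : tau ^+ (k %/ 4) * (Psi k * Psi k) <= e * Psi 0 ^+ 2.
  have PP : Psi k * Psi k <= (expR (2 * m1 * k%:R) * Psi 0) * (expR (2 * m1 * k%:R) * Psi 0).
    by rewrite ler_pM ?(ltW Pk0).
  have ta0 : 0 <= tau ^+ (k %/ 4) by have /andP[/ltW t0 _] := tau01; exact: exprn_ge0.
  have := ler_pM ta0 (mulr_ge0 (ltW Pk0) (ltW Pk0)) tU PP; move/le_trans; apply.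
  have -> : expR (- (8 * m1 * k%:R)) * (expR (2 * m1 * k%:R) * Psi 0 * (expR (2 * m1 * k%:R) * Psi 0)) =
     (expR (- (8 * m1 * k%:R)) * expR (2 * m1 * k%:R) * expR (2 * m1 * k%:R)) * Psi 0 ^+ 2 by ring.
  rewrite ler_wpM2r ?exprn_ge0 ?(ltW P00)// -!expRD /e ler_expR.
  have : w * k%:R <= 1 * k%:R by rewrite ler_wpM2r.
  have : 0 <= M * k%:R by rewrite mulr_ge0.
  have : 0 <= k%:R :> R by [].
  rewrite /m1; lra.
have c4 : 0 <= 4 * Bh * Psi 0 by rewrite !mulr_ge0 ?(ltW P00).
have c2 : 0 <= 2 * Bh by rewrite mulr_ge0.
have h1 := ler_wpM2l c4 t1. have h2 := ler_wpM2l c2 t2.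
apply: (@le_trans _ _ ((4 * Bh * A1 + 2 * Bh) * e * Psi 0 ^+ 2)); first lra.
rewrite ler_wpM2r ?exprn_ge0 ?(ltW P00)// ler_wpM2r ?(ltW e0)//.
rewrite ler_peMr//; first by have : 0 <= Bh * A1 by [rewrite mulr_ge0|]; have := Bh0; lra.
by rewrite -[X in X <= _]expR0 ler_expR mulr_ge0// ltW.
Qed.

End Recursion.

(** * Maximal ergodic inequality and suprema of partial sums *)

Section MaximalErgodic.
Context {R : realType} {d : measure_display} {U : measurableType d}.
Variables (mu : probability U R) (tau : U -> U) (phi : nat -> U -> R).
Hypothesis mtau : measurable_fun [set: U] tau.
Hypothesis inv : forall A, measurable A -> mu (tau @^-1` A) = mu A.
Hypothesis erg : forall A, measurable A -> tau @^-1` A = A -> mu A = 0 \/ mu A = 1.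
(** phi j plays the part of phi 0 composed with the j-th power of the inverse of
    tau, which need not exist: partial sums run backwards along orbits. *)
Hypothesis phiS : forall j u, phi j.+1 (tau u) = phi j u.
Hypothesis mphi : forall j, measurable_fun [set: U] (phi j).
Hypothesis iphi : mu.-integrable [set: U] (EFin \o phi 0%N).

Definition partial_sum k u : R := (\sum_(j < k) phi j u)%R.

Let S := partial_sum.

Let SS k u : S k.+1 (tau u) = (phi 0%N (tau u) + S k u)%R.
Proof.
rewrite /S /partial_sum big_ord_recl; congr (_ + _)%R.
by apply: eq_bigr => i _; rewrite lift0 phiS.
Qed.

Let mS k : measurable_fun [set: U] (S k).
Proof.
rewrite (_ : S k = (fun u => \sum_(j < k) phi j u)%R); last exact/funext.
exact: measurable_sum.
Qed.

Fixpoint partial_max N u : R := if N is n.+1 then Num.max (partial_max n u) (S n.+1 u) else 0%R.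

Let M := partial_max.

Let M_ge k N u : (k <= N)%N -> (S k u <= M N u)%R.
Proof.
elim: N => [|N IH]; first by rewrite leqn0 => /eqP ->; rewrite /S /partial_sum big_ord0.
rewrite leq_eqVlt => /predU1P[->|]; first by rewrite /= le_max lexx orbT.
by rewrite ltnS => /IH; rewrite /= le_max => ->.
Qed.

Let M_ge0 N u : (0 <= M N u)%R.
Proof. by elim: N => [//|N IH] /=; rewrite le_max IH. Qed.

Let M_ach N u : M N u = 0%R \/ exists2 k, (k < N)%N & M N u = S k.+1 u.
Proof.
elim: N => [|N IH]; first by left.
rewrite /= -/(M N u); have [le|lt] := leP (M N u) (S N.+1 u).
  by right; exists N.
by case: IH => [->|[k kN ->]]; [left|right; exists k => //; exact: ltnW].
Qed.

Let mM N : measurable_fun [set: U] (M N).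
Proof. by elim: N => [|N IH] /=; [exact: measurable_cst|exact: measurable_maxr]. Qed.

(** Where the maximum at tau u is positive it is attained by a nonempty sum, whose
    first term is phi 0 (tau u) and whose remainder is a partial sum at u. *)
Let garsia N u : (M N (tau u) - M N u <=
  phi 0%N (tau u) * \1_[set v | 0 < M N v] (tau u))%R.
Proof.
rewrite indicE; have [i0|/negP i0] := boolP (tau u \in [set v | (0 < M N v)%R]).
  move: i0; rewrite inE /= mulr1 => M0.
  have [M00|[k kN ->]] := M_ach N (tau u); first by move: M0; rewrite M00 ltxx.
  by rewrite SS -addrA gerDl subr_le0 M_ge// ltnW.
rewrite mulr0; have [->|[k kN Mk]] := M_ach N (tau u).
  by rewrite sub0r oppr_le0.
suff -> : M N (tau u) = 0%R by rewrite sub0r oppr_le0.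
apply/eqP; rewrite eq_le M_ge0 andbT leNgt; apply/negP => M0.
by apply: i0; rewrite inE.
Qed.

Let int_tau (f : U -> \bar R) : measurable_fun [set: U] f ->
  (forall x, 0 <= f x) -> \int[mu]_u f (tau u) = \int[mu]_u f u.
Proof.
move=> mf f0; have -> : \int[mu]_u f (tau u) = \int[pushforward mu tau]_u f u.
  by rewrite ge0_integral_pushforward.
by apply: eq_measure_integral => A mA _; rewrite /= /pushforward inv.
Qed.

Let itau (f : U -> R) : mu.-integrable [set: U] (EFin \o f) ->
  mu.-integrable [set: U] (EFin \o (f \o tau)).
Proof.
move=> /integrableP[mf f0]; apply/integrableP; split.
  by apply: measurableT_comp => //; apply: measurableT_comp => //; exact/measurable_EFinP.
apply: le_lt_trans f0.
by rewrite -(@int_tau (fun v => `|(f v)%:E|))//; exact: measurableT_comp.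
Qed.

Let int_tauR (f : U -> R) : mu.-integrable [set: U] (EFin \o f) ->
  \int[mu]_u (f (tau u))%:E = \int[mu]_u (f u)%:E.
Proof.
move=> /integrableP[mf f0]; rewrite [LHS]integralE [RHS]integralE; congr (_ - _).
  rewrite (_ : (fun x => _)^\+ = (EFin \o f)^\+ \o tau); last by rewrite -funepos_comp.
  by apply: int_tau => //; exact: measurable_funepos.
rewrite (_ : (fun x => _)^\- = (EFin \o f)^\- \o tau); last by rewrite -funeneg_comp.
by apply: int_tau => //; exact: measurable_funeneg.
Qed.

Let iphij j : mu.-integrable [set: U] (EFin \o phi j).
Proof.
elim: j => [//|j /integrableP[mf f0]]; apply/integrableP; split.
  exact/measurable_EFinP.
rewrite -(@int_tau (fun u => `|(phi j.+1 u)%:E|))//; last first.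
  by apply: measurableT_comp => //; exact/measurable_EFinP.
by under eq_integral do rewrite /= phiS.
Qed.

Let iS k : mu.-integrable [set: U] (EFin \o S k).
Proof.
rewrite (_ : EFin \o S k = fun u => \sum_(j < k) (EFin \o phi j) u); last first.
  by apply/funext => u; rewrite /S /partial_sum /= sumEFin.
exact: integrable_sum.
Qed.

Let iM N : mu.-integrable [set: U] (EFin \o M N).
Proof.
elim: N => [|N IH]; first exact: integrable0.
apply: (@le_integrable _ _ _ _ _ measurableT _
    (fun u => `|(EFin \o M N) u| + `|(EFin \o S N.+1) u|)).
- exact/measurable_EFinP.
- move=> u _ /=; rewrite lee_fin ger0_norm ?le_max ?M_ge0//.
  apply: le_trans (ler_norm _); rewrite ge_max.
  apply/andP; split; apply: (le_trans (ler_norm _)); by rewrite ?lerDl ?lerDr.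
- by apply: integrableD => //; exact: integrable_abse.
Qed.

Let ind_int N : mu.-integrable [set: U]
  (fun u => (phi 0%N u * \1_[set v | 0 < M N v] u)%:E)%R.
Proof.
apply: (@le_integrable _ _ _ _ _ measurableT _ (EFin \o phi 0%N)) => //.
  apply/measurable_EFinP; apply: measurable_funM => //.
  apply: measurable_indic; rewrite -[X in measurable X]setTI.
  by apply: measurable_fun_ltr => //; exact: measurable_cst.
move=> u _ /=; rewrite lee_fin normrM indicE; case: (_ \in _) => /=.
  by rewrite normr1 mulr1.
by rewrite normr0 mulr0.
Qed.

(** Garsia's maximal inequality: integrate the pointwise bound, the left-hand side
    of which has integral zero by invariance. *)
Lemma maximal_ergodic N :
  0 <= \int[mu]_u (phi 0%N u * \1_[set v | 0 < M N v] u)%:E%R.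
Proof.
rewrite -(int_tauR (ind_int N)).
apply: (@le_trans _ _ (\int[mu]_u ((M N (tau u))%:E - (M N u)%:E))).
  rewrite (integralB measurableT (itau (iM N)) (iM N)).
  by rewrite (int_tauR (iM N)) subee//; exact: integrable_fin_num (iM N).
apply: le_integral => //.
- exact: (integrableB measurableT (itau (iM N)) (iM N)).
- exact: (itau (ind_int N)).
- by move=> u _; rewrite lee_fin; exact: garsia.
Qed.

Definition partial_sum_exceeds (C : nat) : set U := [set u | exists k, (C%:R < S k u)%R].

Lemma measurable_partial_sum_exceeds C : measurable (partial_sum_exceeds C).
Proof.
rewrite (_ : partial_sum_exceeds C = \bigcup_k [set u | (C%:R < S k u)%R]).
  apply: bigcupT_measurable => k; rewrite -[X in measurable X]setTI.
  by apply: measurable_fun_ltr => //; exact: measurable_cst.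
by apply/seteqP; split => [u [k Sk]|u [k _ Sk]]; exists k.
Qed.

Let unb := \bigcap_C partial_sum_exceeds C.

Let unb_inv : tau @^-1` unb = unb.
Proof.
apply/seteqP; split => u Hu C _ /=.
  have [C' HC'] : exists C' : nat, (C%:R + phi 0%N (tau u) <= C'%:R)%R.
    exists (Num.bound `|C%:R + phi 0%N (tau u)|%R).
    by apply: (le_trans (ler_norm _)); apply/ltW/archi_boundP.
  have [[|k]] := Hu (maxn C C') I.
    by rewrite /S /partial_sum big_ord0 ltNge ler0n.
  rewrite SS => Hk; exists k.
  have : (C'%:R <= (maxn C C')%:R :> R)%R by rewrite ler_nat leq_maxr.
  by move: Hk HC'; lra.
have [C' HC'] : exists C' : nat, (C%:R - phi 0%N (tau u) <= C'%:R)%R.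
  exists (Num.bound `|C%:R - phi 0%N (tau u)|%R).
  by apply: (le_trans (ler_norm _)); apply/ltW/archi_boundP.
have [k Hk] := Hu C' I; exists k.+1; rewrite SS.
by move: Hk HC'; lra.
Qed.

Hypothesis neg : \int[mu]_u (phi 0%N u)%:E < 0.

(** The event that the partial sums are unbounded is invariant. If it had full
    measure, the indicators in the maximal inequality would tend to 1 and the
    integral of phi 0 would be nonnegative. *)
Lemma partial_sum_unbounded_null : mu unb = 0.
Proof.
have munb : measurable unb by apply: bigcapT_measurable => C; exact: measurable_partial_sum_exceeds.
have [//|mu1] := erg munb unb_inv.
have muC : mu (~` unb) = 0 by rewrite probability_setC// mu1 subee.
have [|||||_ _ cv] := @dominated_convergence _ U R mu [set: U] measurableT
  (fun N u => (phi 0%N u * \1_[set v | 0 < M N v] u)%:E)%R (EFin \o phi 0%N)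
  (fun u => `|(phi 0%N u)%:E|).
- by move=> N; case/integrableP: (ind_int N).
- exact/measurable_EFinP.
- exists (~` unb); split => //; first exact: measurableC.
  move=> u /= nc; rewrite /unb => Hu; apply: nc => _.
  have [k Hk] := Hu 0%N I.
  apply: cvg_near_cst; exists k => // N /= kN.
  by rewrite indicE mem_set ?mulr1//=; apply: lt_le_trans Hk (M_ge _ kN).
- exact: integrable_abse.
- apply: aeW => u N _ /=; rewrite lee_fin normrM indicE; case: (_ \in _) => /=.
    by rewrite normr1 mulr1.
  by rewrite normr0 mulr0.
have : 0 <= \int[mu]_u (phi 0%N u)%:E.
  by apply: (cvge_ge _ cv); apply: nearW => N /=; exact: maximal_ergodic.
by rewrite leNgt neg.
Qed.

Lemma partial_sum_sup_tight (eps : R) : (0 < eps)%R -> exists C : nat, mu (partial_sum_exceeds C) <= eps%:E.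
Proof.
move=> e0.
have cv : mu \o partial_sum_exceeds @ \oo --> mu unb.
  apply: nonincreasing_cvg_mu.
  - by rewrite -ge0_fin_numE// fin_num_measure//; exact: measurable_partial_sum_exceeds.
  - by move=> C; exact: measurable_partial_sum_exceeds.
  - by apply: bigcapT_measurable => C; exact: measurable_partial_sum_exceeds.
  - move=> C C' CC'; apply/subsetPset => u [k Hk]; exists k; apply: le_lt_trans Hk.
    by rewrite ler_nat.
rewrite partial_sum_unbounded_null in cv; move/fine_cvgP : cv => [_].
move=> /cvgrPdist_le/(_ _ e0)[C _ /(_ C (leqnn C))] /=.
rewrite sub0r normrN => H; exists C.
rewrite -(@fineK _ (mu (partial_sum_exceeds C))) ?fin_num_measure//; last exact: measurable_partial_sum_exceeds.
by rewrite lee_fin (le_trans (ler_norm _)).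
Qed.

End MaximalErgodic.

(** * Stationary processes on path space *)

Section PathSpace.
Context {R : realType} {dO dT : measure_display} {Omega : measurableType dO}
  {T : measurableType dT} (P : probability Omega R).

Definition path_gen : set_system (int -> T) :=
  \bigcup_(n in [set: int])
        preimage_set_system [set: int -> T] (fun u => u n) measurable.

Definition path_space : Type := g_sigma_algebraType path_gen.
HB.instance Definition _ := Measurable.on path_space.

Lemma measurable_coord (n : int) :
  measurable_fun [set: path_space] (fun u : path_space => u n).
Proof.
move=> _ A mA; rewrite setTI; apply: sub_sigma_algebra; exists n => //.
by exists A => //; rewrite setTI.
Qed.

Lemma measurable_path dW (W : measurableType dW) (h : W -> path_space) :
  (forall n, measurable_fun [set: W] (fun w => h w n)) -> measurable_fun [set: W] h.
Proof.
move=> mh; apply: (@measurability _ _ _ _ _ h path_gen) => //.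
move=> _ [_ [n _ [A mA <-]] <-]; rewrite setTI.
by have := mh n measurableT A mA; rewrite !setTI.
Qed.

Lemma measurable_shift : measurable_fun [set: path_space] (@shift_path dT T : path_space -> path_space).
Proof. by apply: measurable_path => n; exact: measurable_coord. Qed.

Variable Z : int -> Omega -> T.
Hypothesis mZ : forall n, measurable_fun [set: Omega] (Z n).
Hypothesis sZ : stationary_process P Z.
Hypothesis eZ : ergodic_process P Z.

Lemma measurable_trajectory :
  measurable_fun [set: Omega] (trajectory Z : Omega -> path_space).
Proof. exact: measurable_path. Qed.

(** Sums run backwards in time from the present, as the blocks do. *)
Definition excess (f : T -> R) (C : nat) : set (int -> T) :=
  [set u | exists k, (C%:R < \sum_(j < k) f (u (- (j : nat)%:Z)%R))%R].

(** [partial_sum_sup_tight] for the shift on path space under the law of the trajectory. *)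
Lemma excess_tight (f : T -> R) (eps : R) :
  measurable_fun [set: T] f -> P.-integrable [set: Omega] (fun w => (f (Z 0%R w))%:E) ->
  \int[P]_w (f (Z 0%R w))%:E < 0 -> (0 < eps)%R ->
  exists C : nat, path_measurable (excess f C) /\
    P (trajectory Z @^-1` excess f C) <= eps%:E.
Proof.
move=> mf intf neg e0.
pose X : {RV P >-> path_space} :=
  HB.pack (trajectory Z : Omega -> path_space)
    (isMeasurableFun.Build _ _ _ _ _ measurable_trajectory).
pose phi j (u : path_space) : R := f (u (- (j : nat)%:Z)%R).
have mphi j : measurable_fun [set: path_space] (phi j).
  by apply: measurableT_comp => //; exact: measurable_coord.
have mphi0 : measurable_fun [set: path_space] (EFin \o phi 0%N) by exact/measurable_EFinP.
have iphi0 : P.-integrable (X @^-1` [set: path_space]) ((EFin \o phi 0%N) \o X).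
  by rewrite preimage_setT.
pose sh : path_space -> path_space := @shift_path dT T.
have inv (A : set path_space) : measurable A -> distribution P X (sh @^-1` A) = distribution P X A.
  by move=> mA; exact: sZ.
have erg (A : set path_space) : measurable A -> sh @^-1` A = A ->
    distribution P X A = 0 \/ distribution P X A = 1 by move=> mA; exact: eZ.
have phiS j u : phi j.+1 (sh u) = phi j u.
  rewrite /phi /sh /shift_path; congr (f (u _)); lia.
have iphi : (distribution P X).-integrable [set: path_space] (EFin \o phi 0%N).
  exact: (integrable_pushforward measurable_trajectory mphi0 iphi0 measurableT).
have neg' : \int[distribution P X]_u (phi 0%N u)%:E < 0.
  rewrite (integral_pushforward measurable_trajectory mphi0 iphi0 measurableT).
  by rewrite preimage_setT.
have [C HC] := partial_sum_sup_tight measurable_shift inv erg phiS mphi iphi neg' e0.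
exists C; split; last exact: HC.
exact: (measurable_partial_sum_exceeds mphi).
Qed.

End PathSpace.

Section Blocks.
Context {R : realType} {dO dT : measure_display} {Omega : measurableType dO}
  {T : measurableType dT} (P : probability Omega R) (Y : int -> {RV P >-> T}) (r : nat).
Hypothesis sY : stationary_process P Y.

Definition blocks (t : nat) (j : int) : Omega -> r.-tuple T :=
  block Y (t%:Z + j * r%:Z)%R r.

Lemma measurable_block k m : measurable_fun [set: Omega] (block Y k m).
Proof.
apply/measurable_fun_tnthP => i.
rewrite (_ : _ \o _ = Y (k + (i : nat)%:Z)%R); first exact: measurable_funP.
by apply/funext => w /=; rewrite tnth_mktuple.
Qed.

(** Stationarity is stated for one step of the shift; this iterates it. *)
Lemma stationary_shift (t : nat) (A : set (int -> T)) : path_measurable A ->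
  P [set w | A (fun n => Y (n + t%:Z)%R w)] = P (trajectory Y @^-1` A).
Proof.
elim: t A => [|t IH] A mA.
  have E w : (fun n : int => Y (n + 0%N%:Z)%R w) = trajectory Y w.
    by apply/funext => n; congr (Y _ w); lia.
  by congr (P _); apply/seteqP; split => w /=; rewrite E.
have mA' : path_measurable (@shift_path dT T @^-1` A).
  by have := measurable_shift measurableT mA; rewrite setTI.
rewrite -(sY mA) -(IH _ mA'); congr (P _).
have E w : shift_path (fun n : int => Y (n + t%:Z)%R w) = (fun n : int => Y (n + t.+1%:Z)%R w).
  by apply/funext => n; rewrite /shift_path; congr (Y _ w); lia.
by apply/seteqP; split => w /=; rewrite E.
Qed.

Let cut (t : nat) (u : int -> T) : int -> r.-tuple T :=
  fun j => [tuple u (t%:Z + j * r%:Z + (i : nat)%:Z)%R | i < r].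

Let cut_measurable t A : path_measurable A -> path_measurable (cut t @^-1` A).
Proof.
move=> mA; have mc : measurable_fun [set: @path_space _ T] (cut t : _ -> @path_space _ (r.-tuple T)).
  apply: measurable_path => n; apply/measurable_fun_tnthP => i.
  rewrite (_ : _ \o _ = fun u : @path_space _ T => u (t%:Z + n * r%:Z + (i : nat)%:Z)%R).
    exact: measurable_coord.
  by apply/funext => u /=; rewrite tnth_mktuple.
by have := mc measurableT A mA; rewrite setTI.
Qed.

(** Blocks counted from t are a fixed measurable function of the path shifted by
    t, so their joint law does not depend on t. *)
Lemma blocks_law t A : path_measurable A ->
  P (trajectory (blocks t) @^-1` A) = P (trajectory (blocks 0) @^-1` A).
Proof.
move=> mA.
have -> : trajectory (blocks 0) @^-1` A = trajectory Y @^-1` (cut 0 @^-1` A) by [].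
rewrite -(stationary_shift t (cut_measurable 0 mA)); congr (P _).
have E w : cut 0 (fun n : int => Y (n + t%:Z)%R w) = trajectory (blocks t) w.
  apply/funext => n; apply: eq_from_tnth => i; rewrite !tnth_mktuple.
  by congr (Y _ w); ring.
by apply/seteqP; split => w /=; rewrite E.
Qed.

Lemma stationary_blocks : stationary_process P (blocks 0).
Proof.
move=> A mA; rewrite -(blocks_law r mA); congr (P _).
have E w : shift_path (trajectory (blocks 0) w) = trajectory (blocks r) w.
  apply/funext => n; rewrite /shift_path /trajectory /blocks.
  by congr (block Y _ r w); ring.
by apply/seteqP; split => w /=; rewrite E.
Qed.

End Blocks.

(** * Integration against set functions given by positive functionals *)

Section SetFunctionIntegral.
Context {R : realType} {d : measure_display} {X : measurableType d}.
Implicit Types (F G : X -> \bar R) (L : (X -> \bar R) -> \bar R).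

Definition nonneg_meas F := measurable_fun [set: X] F /\ forall x, 0 <= F x.

(** The properties of an integral that determine it by its values on indicator
    functions. The predictor and the filter are mere set functions, for which
    they hold only through an explicit formula. *)
Definition daniell L :=
  [/\ forall F G, nonneg_meas F -> nonneg_meas G -> (forall x, F x <= G x) -> L F <= L G,
      forall F G, nonneg_meas F -> nonneg_meas G -> L (fun x => F x + G x) = L F + L G,
      forall (r : R) F, (0 <= r)%R -> nonneg_meas F -> L (fun x => r%:E * F x) = r%:E * L F &
      forall (Fn : (X -> \bar R)^nat) F, (forall n, nonneg_meas (Fn n)) ->
        (forall x, nondecreasing_seq (Fn ^~ x)) ->
        (forall x, Fn ^~ x @ \oo --> F x) -> (L \o Fn) @ \oo --> L F].

Lemma nonneg_meas_cst0 : nonneg_meas (fun=> 0).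
Proof. by split => //; exact: measurable_cst. Qed.

Lemma nonneg_measD F G : nonneg_meas F -> nonneg_meas G -> nonneg_meas (fun x => F x + G x).
Proof.
by move=> [mF F0] [mG G0]; split=> [|x]; [exact: emeasurable_funD|exact: adde_ge0].
Qed.

Lemma nonneg_measM F G : nonneg_meas F -> nonneg_meas G -> nonneg_meas (fun x => F x * G x).
Proof.
by move=> [mF F0] [mG G0]; split=> [|x]; [exact: emeasurable_funM|exact: mule_ge0].
Qed.

Lemma nonneg_meas_indic (A : set X) : measurable A -> nonneg_meas (fun x => (\1_A x)%:E).
Proof.
move=> mA; split => [|x]; last by rewrite lee_fin indicE.
by apply/measurable_EFinP; exact: measurable_indic.
Qed.

Lemma nonneg_meas_EFin (f : X -> R) : measurable_fun [set: X] f -> (forall x, (0 <= f x)%R) ->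
  nonneg_meas (fun x => (f x)%:E).
Proof. by move=> mf f0; split=> [|x]; [exact/measurable_EFinP|rewrite lee_fin]. Qed.

Lemma nonneg_meas_funepos F : measurable_fun [set: X] F -> nonneg_meas (F^\+).
Proof. by move=> mF; split=> [|x]; [exact: measurable_funepos|exact: funepos_ge0]. Qed.

Lemma nonneg_meas_funeneg F : measurable_fun [set: X] F -> nonneg_meas (F^\-).
Proof. by move=> mF; split=> [|x]; [exact: measurable_funeneg|exact: funeneg_ge0]. Qed.

Lemma daniell0 L : daniell L -> L (fun=> 0) = 0.
Proof.
move=> [_ _ LZ _]; have := LZ 0%R _ (lexx 0%R) nonneg_meas_cst0.
by under eq_fun do rewrite mule0; rewrite mul0e.
Qed.

Lemma daniell_ge0 L F : daniell L -> nonneg_meas F -> 0 <= L F.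
Proof.
move=> dL nF; have [Lle _ _ _] := dL; rewrite -(daniell0 dL).
by apply: Lle => //; case: nF.
Qed.

Section Represented.
Variables (m : set X -> \bar R) (L : (X -> \bar R) -> \bar R).
Hypothesis dL : daniell L.
Hypothesis mL : forall A, measurable A -> m A = L (fun x => (\1_A x)%:E).

Import HBNNSimple.

Let m0 : m set0 = 0.
Proof.
rewrite mL//; rewrite -[RHS](daniell0 dL); congr L; apply/funext => x.
by rewrite indic0.
Qed.

Lemma sintegral_range (h : {nnsfun X >-> R}) :
  sintegral m h = \sum_(r \in range h) r%:E * m (h @^-1` [set r]).
Proof.
rewrite /sintegral (fsbig_widen (range h) setT)//= => x [_ Nfx] /=.
by rewrite preimage10// m0 mule0.
Qed.

(** A simple function is a finite combination of the indicators of its fibres,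
    which are measurable, so L is evaluated on it by linearity. *)
Let sintegral_daniell (h : {nnsfun X >-> R}) :
  sintegral m h = L (fun x => (h x)%:E).
Proof.
have [Lle LD LZ _] := dL.
rewrite sintegral_range fsbig_finite//=.
have -> : (fun x => (h x)%:E) =
    (fun x => \sum_(r <- finmap.enum_fset (fset_set (range h))) (r%:E * (\1_(h @^-1` [set r]) x)%:E)).
  apply/funext => x; rewrite fimfunE fsbig_finite//= -sumEFin.
  by apply: eq_bigr => r _; rewrite EFinM.
have : forall r, r \in finmap.enum_fset (fset_set (range h)) -> (0 <= r)%R.
  by move=> r rs; have : r \in range h by [rewrite -(@in_fset_set _ (range h))]; rewrite inE => -[x _ <-].
elim: (finmap.enum_fset _) => [_|r s IH rs].
  rewrite big_nil; rewrite -[LHS](daniell0 dL); congr L; apply/funext => x.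
  by rewrite big_nil.
rewrite big_cons IH; last by move=> r' r's; apply: rs; rewrite inE r's orbT.
have r0 : (0 <= r)%R by apply: rs; rewrite inE eqxx.
have nterm r' : (0 <= r')%R -> nonneg_meas (fun x => r'%:E * (\1_(h @^-1` [set r']) x)%:E).
  move=> r'0; apply: nonneg_measM; last exact: nonneg_meas_indic.
  by split => //; exact: measurable_cst.
rewrite mL// -LZ//; last exact: nonneg_meas_indic.
rewrite -LD//.
- by congr L; apply/funext => x; rewrite big_cons.
- exact: nterm.
- split=> [|x].
    apply: emeasurable_sum => r'.
    apply: emeasurable_funM; first exact: measurable_cst.
    by apply/measurable_EFinP; exact: measurable_indic.
  rewrite big_seq; apply: sume_ge0 => r' r's; apply: mule_ge0.
    by rewrite lee_fin; apply: rs; rewrite inE r's orbT.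
  by rewrite lee_fin indicE.
Qed.

Let nonneg_meas_nnsfun (h : {nnsfun X >-> R}) : nonneg_meas (fun x => (h x)%:E).
Proof. by apply: nonneg_meas_EFin => // x; exact: fun_ge0. Qed.

Lemma sup_daniell F : nonneg_meas F ->
  ereal_sup [set sintegral m h | h in
    [set h : {nnsfun X >-> R} | forall x, (h x)%:E <= F x]] = L F.
Proof.
move=> nF; have [Lle LD LZ Lcv] := dL; have [mF F0] := nF.
apply/eqP; rewrite eq_le; apply/andP; split.
  apply: ge_ereal_sup => _ [h hF <-]; rewrite sintegral_daniell.
  by apply: Lle.
pose a := nnsfun_approx measurableT mF.
have nd x : nondecreasing_seq (fun n => (a n x)%:E).
  by move=> k l kl; rewrite lee_fin; exact/lefP/nd_nnsfun_approx.
have cv x : (fun n => (a n x)%:E) @ \oo --> F x by exact: cvg_nnsfun_approx.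
have := Lcv (fun n x => (a n x)%:E) F (fun n => nonneg_meas_nnsfun (a n)) nd cv.
apply: cvge_le; apply: nearW => n /=; apply: ereal_sup_ubound.
exists (a n); last by rewrite sintegral_daniell.
by move=> x /=; apply: (cvge_ge _ (cv x)); exists n => // k /= nk; exact: nd.
Qed.

(** The integral is a difference of suprema of integrals of simple functions, each
    equal to L by monotone approximation, for any set function m. *)
Lemma integral_daniell_signed f : measurable_fun [set: X] f ->
  \int[m]_x f x = L f^\+ - L f^\-.
Proof.
move=> mf; rewrite /integral patch_setT.
by rewrite (sup_daniell (nonneg_meas_funepos mf)) (sup_daniell (nonneg_meas_funeneg mf)).
Qed.

Lemma integral_daniell F : nonneg_meas F -> \int[m]_x F x = L F.
Proof.
move=> [mF F0]; rewrite integral_daniell_signed//.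
have -> : F^\+ = F by apply/funext => x; rewrite funeposE; exact/max_idPl.
have -> : F^\- = fun=> 0.
  by apply/funext => x; rewrite funenegE; apply/max_idPr; rewrite oppe_le0.
by rewrite (daniell0 dL) sube0.
Qed.

End Represented.

Section Comparison.
Import HBNNSimple.

(** An inequality between two set functions extends to integrals; it turns the
    local Doeblin condition, stated on sets, into one on functions. *)
Lemma daniell_le_indic L L' : daniell L -> daniell L' ->
  (forall A, measurable A -> L (fun x => (\1_A x)%:E) <= L' (fun x => (\1_A x)%:E)) ->
  forall F, nonneg_meas F -> L F <= L' F.
Proof.
move=> dL dL' LL' F nF.
pose m (A : set X) := L (fun x => (\1_A x)%:E).
pose m' (A : set X) := L' (fun x => (\1_A x)%:E).
rewrite -(sup_daniell (m := m) dL)// -(sup_daniell (m := m') dL')//.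
apply: ge_ereal_sup => _ [f fF <-].
apply: (@le_trans _ _ (sintegral m' f)); last by apply: ereal_sup_ubound; exists f.
rewrite (sintegral_range (m := m) dL)// (sintegral_range (m := m') dL')//.
apply: lee_fsum => // r [x _ <-]; apply: lee_wpmul2l; last exact: LL'.
by rewrite lee_fin; exact: fun_ge0.
Qed.

End Comparison.

Lemma daniell_eq_ge0 L L' : daniell L -> (forall F, nonneg_meas F -> L' F = L F) -> daniell L'.
Proof.
move=> [Lle LD LZ Lcv] E; split.
- by move=> F G nF nG FG; rewrite !E//; exact: Lle.
- by move=> F G nF nG; rewrite !E//; [exact: LD|exact: nonneg_measD].
- move=> r F r0 nF; rewrite !E//; first exact: LZ.
  by apply: nonneg_measM => //; split => //; exact: measurable_cst.
- move=> Fn F nFn nd cv; rewrite E; last first.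
    split; first by apply: (emeasurable_fun_cvg Fn) => [n|x _]; [case: (nFn n)|exact: cv].
    by move=> x; apply: (cvge_ge _ (cv x)); apply: nearW => n; case: (nFn n).
  have -> : L' \o Fn = L \o Fn by apply/funext => n /=; rewrite E.
  exact: Lcv.
Qed.

Lemma daniell_scale L (r : R) : (0 <= r)%R -> daniell L -> daniell (fun F => r%:E * L F).
Proof.
move=> r0 dL; have [Lle LD LZ Lcv] := dL; split.
- by move=> F G nF nG FG; apply: lee_wpmul2l => //; exact: Lle.
- move=> F G nF nG; rewrite LD// ge0_muleDr//; exact: daniell_ge0.
- by move=> s F s0 nF; rewrite LZ// muleCA.
- by move=> Fn F nFn nd cv; apply: cvgeZl => //; exact: Lcv.
Qed.

Lemma daniell_eval x : daniell (fun F => F x).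
Proof. by split => // Fn F _ _ cv; exact: cv. Qed.

Lemma daniell_zero : daniell (fun=> 0).
Proof.
split => //.
- by move=> F G _ _; rewrite adde0.
- by move=> r F _ _; rewrite mule0.
- by move=> Fn F _ _ _; exact: cvg_cst.
Qed.

Lemma daniell_weight L (f : X -> R) : measurable_fun [set: X] f ->
  (forall x, (0 <= f x)%R) -> daniell L -> daniell (fun F => L (fun x => F x * (f x)%:E)).
Proof.
move=> mf f0 [Lle LD LZ Lcv].
have nf := nonneg_meas_EFin mf f0.
split.
- move=> F G nF nG FG; apply: Lle; [exact: nonneg_measM|exact: nonneg_measM|].
  by move=> x; apply: lee_wpmul2r => //; rewrite lee_fin.
- move=> F G nF nG; rewrite -LD; [|exact: nonneg_measM|exact: nonneg_measM].
  congr L; apply/funext => x; rewrite ge0_muleDl//; [by case: nF|by case: nG].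
- move=> r F r0 nF; rewrite -LZ//; last exact: nonneg_measM.
  by congr L; apply/funext => x; rewrite muleA.
- move=> Fn F nFn nd cv; apply: Lcv.
  + by move=> n; exact: nonneg_measM.
  + by move=> x k l kl; apply: lee_wpmul2r; [rewrite lee_fin|exact: nd].
  + by move=> x; apply: cvgeZr => //; exact: cv.
Qed.

End SetFunctionIntegral.

Section DaniellMixture.
Context {R : realType} {d d' : measure_display} {X : measurableType d}
  {X' : measurableType d'}.

Lemma daniell_mixture (mu : {measure set X' -> \bar R}) (K : X' -> (X -> \bar R) -> \bar R) :
  (forall x, daniell (K x)) -> (forall F, nonneg_meas F -> measurable_fun [set: X'] (K ^~ F)) ->
  daniell (fun F => \int[mu]_x K x F).
Proof.
move=> dK mK; split.
- move=> F G nF nG FG; apply: ge0_le_integral => //.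
  + by move=> x _; exact: (daniell_ge0 (dK x)).
  + exact: mK.
  + exact: mK.
  + by move=> x _; have [le _ _ _] := dK x; exact: le.
- move=> F G nF nG; rewrite -ge0_integralD//.
  + by apply: eq_integral => x _; have [_ D _ _] := dK x; exact: D.
  + by move=> x _; exact: (daniell_ge0 (dK x)).
  + exact: mK.
  + by move=> x _; exact: (daniell_ge0 (dK x)).
  + exact: mK.
- move=> r F r0 nF; rewrite -ge0_integralZl//.
  + by apply: eq_integral => x _; have [_ _ Z _] := dK x; exact: Z.
  + exact: mK.
  + by move=> x _; exact: (daniell_ge0 (dK x)).
- move=> Fn F nFn nd cv.
  have lim x : (fun n => K x (Fn n)) @ \oo --> K x F.
    by have [_ _ _ C] := dK x; exact: C.
  have -> : \int[mu]_x K x F = \int[mu]_x limn (fun n => K x (Fn n)).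
    by apply: eq_integral => x _; apply/esym/cvg_lim => //; exact: lim.
  apply: cvg_monotone_convergence => //.
  + by move=> n; exact: mK.
  + by move=> n x _; exact: (daniell_ge0 (dK x)).
  + by move=> x _ k l kl; have [le _ _ _] := dK x; apply: le => // y; exact: nd.
Qed.

End DaniellMixture.

(** * Likelihood operators and measurability of the asymptotic variance *)

Section MeasurabilityTools.
Context {R : realType} {d : measure_display} {T : measurableType d}.

Lemma measurable_funV (F : T -> \bar R) : nonneg_meas F -> measurable_fun [set: T] (fun x => (F x)^-1).
Proof.
move=> [mF F0].
rewrite (_ : (fun x => (F x)^-1) = (fun x => if F x == 0 then +oo else
    if F x == +oo then 0 else (powR (fine (F x)) (-1))%:E)).
  apply: measurable_fun_ifT => //; first by apply: measurable_fun_eqe.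
  apply: measurable_fun_ifT => //; first by apply: measurable_fun_eqe.
  apply/measurable_EFinP.
  apply: (@measurableT_comp _ _ _ _ _ _ (fun r : R => powR r (-1)) _ (fun x => fine (F x))).
    exact: measurable_powR.
  by apply: measurableT_comp => //; exact: fine_measurable.
apply/funext => x; have := F0 x; case: (F x) => [r| |]//=; rewrite lee_fin => r0.
by rewrite inver eqe; case: ifPn => // _; rewrite powR_inv1.
Qed.

Lemma measurable_fun_div (F G : T -> \bar R) : measurable_fun [set: T] F -> nonneg_meas G ->
  measurable_fun [set: T] (fun x => F x / G x).
Proof. by move=> mF nG; apply: emeasurable_funM => //; exact: measurable_funV. Qed.

Lemma integral_gt0 (P : {measure set T -> \bar R}) (F : T -> \bar R) :
  P [set: T] = 1 -> measurable_fun [set: T] F -> (forall x, 0 < F x) -> 0 < \int[P]_x F x.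
Proof.
move=> P1 mF F0; rewrite lt_def integral_ge0 ?andbT; last by move=> x _; exact: ltW.
apply/negP => /eqP I0.
have : \int[P]_x `|F x| = 0.
  by rewrite -[RHS]I0; apply: eq_integral => x _; rewrite gee0_abs// ltW.
move/(ae_eq_integral_abs P measurableT mF) => [N [mN N0 sub]].
have NT : N = [set: T].
  by apply/seteqP; split => // x _; apply: sub => /= /(_ I) Fx0; have := F0 x; rewrite Fx0 ltxx.
by have := P1; rewrite -NT N0 => /eqP; rewrite eq_sym onee_eq0.
Qed.

End MeasurabilityTools.

Section LikelihoodOperator.
Context {R : realType} {dX dY : measure_display} {X : measurableType dX}
  {Y : measurableType dY} (Q : R.-pker X ~> X) (g : X -> Y -> R).
Hypothesis g_pos : forall x y, (0 < g x y)%R.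
Hypothesis g_meas : measurable_fun [set: X * Y] (fun p => g p.1 p.2).

(** The action on functions of the kernel whose values on sets are [Lker]. *)
Fixpoint elikelihood (s : seq Y) (F : X -> \bar R) (x : X) : \bar R :=
  if s is y :: s' then \int[Q x]_x' ((g x y)%:E * elikelihood s' F x') else F x.

Lemma LkerE s x A : Lker Q g s x A = elikelihood s (fun x => (\1_A x)%:E) x.
Proof.
elim: s x => [|y s IH] x /=; first by rewrite diracE indicE.
by apply: eq_integral => x' _; rewrite IH.
Qed.

Section ObservationMaps.
Context {dW : measure_display} {W : measurableType dW}.

(** The kernel Q with an idle parameter, which lets the function integrated by Q
    depend on the observations. *)
Let pullback (p : W * X) : {measure set X -> \bar R} := Q p.2.

Let measurable_pullback U : measurable U ->
  measurable_fun [set: W * X] (pullback ^~ U).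
Proof.
by move=> mU; apply: (measurableT_comp (measurable_kernel Q U mU)); exact: measurable_snd.
Qed.

HB.instance Definition _ := isKernel.Build _ _ _ _ R pullback measurable_pullback.

Let pullback1 p : pullback p [set: X] = 1.
Proof. exact: prob_kernel. Qed.

HB.instance Definition _ :=
  Kernel_isProbability.Build _ _ _ _ R pullback pullback1.

Lemma measurable_elikelihood (ys : seq (W -> Y)) (F : W * X -> \bar R) :
  (forall y, List.In y ys -> measurable_fun [set: W] y) -> nonneg_meas F ->
  nonneg_meas (fun p : W * X => elikelihood [seq y p.1 | y <- ys] (fun x => F (p.1, x)) p.2).
Proof.
move=> + nF; elim: ys => [_|y ys IH mys] /=.
  by rewrite (_ : (fun p => _) = F)//; apply/funext => -[].
have [mG G0] := IH (fun z zs => mys z (or_intror zs)).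
have my : measurable_fun [set: W] y by apply: mys; left.
split=> [|p]; last first.
  by apply: integral_ge0 => x _; apply: mule_ge0; [rewrite lee_fin ltW|exact: (G0 (p.1, x))].
pose k (px : (W * X) * X) : \bar R := (g px.1.2 (y px.1.1))%:E *
  elikelihood [seq y px.1.1 | y <- ys] (fun x => F (px.1.1, x)) px.2.
have k0 px : 0 <= k px.
  by apply: mule_ge0; [rewrite lee_fin ltW|exact: (G0 (px.1.1, px.2))].
have mk : measurable_fun [set: (W * X) * X] k.
  apply: emeasurable_funM.
    apply/measurable_EFinP.
    apply: (@measurableT_comp _ _ _ _ _ _ (fun p : X * Y => g p.1 p.2)
      _ (fun px : (W * X) * X => (px.1.2, y px.1.1))) => //.
    by apply: measurable_fun_pair;
      [exact: measurableT_comp|do 2 apply: measurableT_comp => //].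
  apply: (@measurableT_comp _ _ _ _ _ _ _ _ (fun px : (W * X) * X => (px.1.1, px.2)) mG).
  by apply: measurable_fun_pair => //; exact: measurableT_comp.
exact: (@measurable_fun_integral_finite_kernel _ _ _ _ R k pullback k0 mk).
Qed.

End ObservationMaps.

Lemma nonneg_meas_elikelihood s F : nonneg_meas F -> nonneg_meas (elikelihood s F).
Proof.
move=> nF; pose ys : seq (X -> Y) := [seq (fun=> y) | y <- s].
have mys y : List.In y ys -> measurable_fun [set: X] y.
  by rewrite /ys; elim: (s) => //= y' s' IH [<-|/IH//]; exact: measurable_cst.
have nF' : nonneg_meas (fun p : X * X => F p.2).
  by case: nF => mF F0; split => //; exact: measurableT_comp.
have [mG G0] := measurable_elikelihood mys nF'.
have E x : [seq y x | y <- ys] = s by rewrite /ys -map_comp map_id.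
split=> [|x]; last by have := G0 (x, x); rewrite /= E.
have -> : elikelihood s F = (fun p : X * X => elikelihood [seq y p.1 | y <- ys] (fun x => F (p.1, x).2) p.2)
    \o (fun x => (x, x)) by apply/funext => x /=; rewrite E.
by apply: measurableT_comp => //; exact: measurable_fun_pair.
Qed.

Lemma daniell_elikelihood s x : daniell (fun F => elikelihood s F x).
Proof.
elim: s x => [|y s IH] x /=; first exact: daniell_eval.
have g0 : (0 <= g x y)%R by exact: ltW.
have mK F : nonneg_meas F -> measurable_fun [set: X] (fun x' => elikelihood s F x').
  by move=> nF; case: (nonneg_meas_elikelihood s nF).
apply: (daniell_eq_ge0 (daniell_scale g0 (daniell_mixture (Q x) IH mK))).
move=> F nF; have [mL L0] := nonneg_meas_elikelihood s nF.
by rewrite ge0_integralZl// lee_fin.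
Qed.

Lemma elikelihood_gt0 s F : nonneg_meas F -> (forall x, 0 < F x) -> forall x, 0 < elikelihood s F x.
Proof.
move=> nF F0; elim: s => [//|y s IH] x /=.
have [mL L0] := nonneg_meas_elikelihood s nF.
apply: (@integral_gt0 _ _ _ (Q x)); first exact: prob_kernel.
  by apply: emeasurable_funM => //; exact: measurable_cst.
by move=> x'; rewrite mule_gt0// lte_fin.
Qed.

Lemma integral_Lker s x f : measurable_fun [set: X] f ->
  \int[Lker Q g s x]_x' f x' = elikelihood s f^\+ x - elikelihood s f^\- x.
Proof.
move=> mf; apply: (integral_daniell_signed (daniell_elikelihood s x)) => //.
by move=> A mA; rewrite LkerE.
Qed.

Section Initial.
Variable chi : probability X R.

Definition einit_likelihood s F := \int[chi]_x elikelihood s F x.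

Lemma daniell_einit_likelihood s : daniell (einit_likelihood s).
Proof.
apply: daniell_mixture => [x|F nF]; first exact: daniell_elikelihood.
by case: (nonneg_meas_elikelihood s nF).
Qed.

Lemma einit_likelihood_gt0 s F : nonneg_meas F -> (forall x, 0 < F x) -> 0 < einit_likelihood s F.
Proof.
move=> nF F0; apply: integral_gt0; [exact: probability_setT|by case: (nonneg_meas_elikelihood s nF)|].
exact: elikelihood_gt0.
Qed.

Let one : X -> \bar R := fun=> 1.
Let nnm1 : nonneg_meas one. Proof. by split => //; exact: measurable_cst. Qed.

(** The mass may be infinite, its inverse then being 0: in all cases normalizing
    amounts to multiplying by a nonnegative real number. *)
Let inv_mass s : exists2 r : R, (0 <= r)%R & (einit_likelihood s one)^-1 = r%:E.
Proof.
have c0 : 0 < einit_likelihood s one by apply: einit_likelihood_gt0 => // x; exact: lte01.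
case: (einit_likelihood s one) c0 => [c| |]//; last by move=> _; exists 0%R => //; rewrite invey.
rewrite lte_fin => c0; exists c^-1%R; first by rewrite invr_ge0 ltW.
by rewrite inver gt_eqF.
Qed.

Lemma predictorE s A : predictor Q g chi s A = einit_likelihood s (fun x => (\1_A x)%:E) / einit_likelihood s one.
Proof.
rewrite /predictor /einit_likelihood; congr (_ / _); apply: eq_integral => x _; rewrite LkerE//.
by congr (elikelihood _ _ _); apply/funext => z; rewrite indicT.
Qed.

Lemma daniell_predictor s : daniell (fun F => einit_likelihood s F / einit_likelihood s one).
Proof.
have [r r0 ->] := inv_mass s.
apply: (daniell_eq_ge0 (daniell_scale r0 (daniell_einit_likelihood s))).
by move=> F nF; rewrite muleC.
Qed.

Lemma integral_predictor_signed s f : measurable_fun [set: X] f ->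
  \int[predictor Q g chi s]_x f x = einit_likelihood s f^\+ / einit_likelihood s one - einit_likelihood s f^\- / einit_likelihood s one.
Proof.
move=> mf; apply: (integral_daniell_signed (daniell_predictor s)) => //.
by move=> A mA; rewrite predictorE.
Qed.

Lemma integral_predictor s F : nonneg_meas F ->
  \int[predictor Q g chi s]_x F x = einit_likelihood s F / einit_likelihood s one.
Proof.
move=> nF; apply: (integral_daniell (daniell_predictor s)) => //.
by move=> A mA; rewrite predictorE.
Qed.

Let gy y : X -> R := g ^~ y.
Let mgy y : measurable_fun [set: X] (gy y).
Proof.
by apply: (@measurableT_comp _ _ _ _ _ _ (fun p : X * Y => g p.1 p.2)
    _ (fun x => (x, y))) => //; exact: measurable_fun_pair.
Qed.

Let gy0 y x : (0 <= gy y x)%R. Proof. exact: ltW (g_pos x y). Qed.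

Definition efilter s y F := einit_likelihood s (fun x => F x * (g x y)%:E) / einit_likelihood s one /
   (einit_likelihood s (fun x => (g x y)%:E) / einit_likelihood s one).

Lemma daniell_filtering s y : daniell (efilter s y).
Proof.
have ng : nonneg_meas (fun x => (g x y)%:E) := nonneg_meas_EFin (mgy y) (gy0 y).
have pg : 0 < einit_likelihood s (fun x => (g x y)%:E).
  by apply: einit_likelihood_gt0 => // x; rewrite lte_fin.
have dW := daniell_weight (mgy y) (gy0 y) (daniell_predictor s).
have [r r0 E] := inv_mass s.
have : 0 <= einit_likelihood s (fun x => (g x y)%:E) / einit_likelihood s one.
  by rewrite E mule_ge0 ?lee_fin// ltW.
have [D0|D0] := eqVneq (einit_likelihood s (fun x => (g x y)%:E) / einit_likelihood s one) 0.
  move=> _; apply: (daniell_eq_ge0 (@daniell_zero R dX X)) => F nF.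
  move: D0; rewrite /efilter E => /eqP; rewrite mule_eq0 gt_eqF//= => /eqP ->.
  by rewrite mule0 mul0e.
move=> D_ge0.
have [r' r'0 E'] : exists2 r' : R, (0 <= r')%R &
    (einit_likelihood s (fun x => (g x y)%:E) / einit_likelihood s one)^-1 = r'%:E.
  move: D0 D_ge0; case: (_ / _) => [c| |]//; last first.
    by move=> _ _; exists 0%R => //; rewrite invey.
  rewrite eqe lee_fin => c0 c_ge0; exists c^-1%R; first by rewrite invr_ge0.
  by rewrite inver (negbTE c0).
apply: (daniell_eq_ge0 (daniell_scale r'0 dW)) => F nF.
by rewrite /efilter E' muleC.
Qed.

Lemma filteringE s y A : measurable A ->
  filtering Q g chi s y A = efilter s y (fun x => (\1_A x)%:E).
Proof.
move=> mA; rewrite /filtering /efilter !integral_predictor//.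
- exact: nonneg_meas_EFin (mgy y) (gy0 y).
- apply: nonneg_measM; first exact: nonneg_meas_indic.
  exact: nonneg_meas_EFin (mgy y) (gy0 y).
Qed.

Lemma integral_filtering s y f : measurable_fun [set: X] f ->
  \int[filtering Q g chi s y]_x f x = efilter s y f^\+ - efilter s y f^\-.
Proof.
move=> mf; apply: (integral_daniell_signed (daniell_filtering s y)) => //.
by move=> A mA; rewrite filteringE.
Qed.

Section FilterVariance.
Context {dW : measure_display} {W : measurableType dW}.
Variables (ys : seq (W -> Y)) (yn : W -> Y) (h : X -> R).
Hypothesis mys : forall y, List.In y ys -> measurable_fun [set: W] y.
Hypothesis myn : measurable_fun [set: W] yn.
Hypothesis mh : measurable_fun [set: X] h.

Let sw (w : W) : seq Y := [seq y w | y <- ys].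

Lemma measurable_einit_likelihood (zs : seq (W -> Y)) (F : W * X -> \bar R) :
  (forall y, List.In y zs -> measurable_fun [set: W] y) -> nonneg_meas F ->
  nonneg_meas (fun w => einit_likelihood [seq y w | y <- zs] (fun x => F (w, x))).
Proof.
move=> mzs nF; have [mG G0] := measurable_elikelihood mzs nF.
split=> [|w]; last by apply: integral_ge0 => x _; exact: (G0 (w, x)).
rewrite /einit_likelihood.
have := measurable_fun_fubini_tonelli_F (m2 := chi) _ mG G0.
by rewrite /fubini_F.
Qed.

Let nonneg_meas_fst (F : X -> \bar R) : nonneg_meas F -> nonneg_meas (fun p : W * X => F p.2).
Proof. by move=> [mF F0]; split => //; exact: measurableT_comp. Qed.

Let npos (f : W * X -> \bar R) : measurable_fun [set: W * X] f ->
  nonneg_meas (fun p => (fun x => f (p.1, x))^\+ p.2).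
Proof.
move=> mf; rewrite (_ : (fun p => _) = f^\+); first exact: nonneg_meas_funepos.
by apply/funext => -[w x]; rewrite !funeposE.
Qed.

Let nneg (f : W * X -> \bar R) : measurable_fun [set: W * X] f ->
  nonneg_meas (fun p => (fun x => f (p.1, x))^\- p.2).
Proof.
move=> mf; rewrite (_ : (fun p => _) = f^\-); first exact: nonneg_meas_funeneg.
by apply/funext => -[w x]; rewrite !funenegE.
Qed.

Let msec (f : W * X -> \bar R) w : measurable_fun [set: W * X] f ->
  measurable_fun [set: X] (fun x => f (w, x)).
Proof. by move=> mf; exact: measurable_fun_pair2. Qed.

Let measurable_integral_Lker zs (f : W * X -> \bar R) :
  (forall y, List.In y zs -> measurable_fun [set: W] y) ->
  measurable_fun [set: W * X] f ->
  measurable_fun [set: W * X]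
    (fun p => \int[Lker Q g [seq y p.1 | y <- zs] p.2]_x f (p.1, x)).
Proof.
move=> mzs mf.
under eq_fun => p do rewrite (integral_Lker _ _ (msec p.1 mf)).
by apply: emeasurable_funB;
  [case: (measurable_elikelihood mzs (npos mf))|case: (measurable_elikelihood mzs (nneg mf))].
Qed.

Let nonneg_meas_mass zs : (forall y, List.In y zs -> measurable_fun [set: W] y) ->
  nonneg_meas (fun w => einit_likelihood [seq y w | y <- zs] one).
Proof. by move=> mzs; apply: (measurable_einit_likelihood mzs (nonneg_meas_fst nnm1)). Qed.

Let measurable_integral_predictor zs (f : W * X -> \bar R) :
  (forall y, List.In y zs -> measurable_fun [set: W] y) ->
  measurable_fun [set: W * X] f ->
  measurable_fun [set: W]
    (fun w => \int[predictor Q g chi [seq y w | y <- zs]]_x f (w, x)).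
Proof.
move=> mzs mf.
under eq_fun => w do rewrite (integral_predictor_signed _ (msec w mf)).
apply: emeasurable_funB; (apply: measurable_fun_div; last exact: nonneg_meas_mass).
- by case: (measurable_einit_likelihood mzs (npos mf)).
- by case: (measurable_einit_likelihood mzs (nneg mf)).
Qed.

Let nonneg_meas_integral_predictor zs (F : W * X -> \bar R) :
  (forall y, List.In y zs -> measurable_fun [set: W] y) -> nonneg_meas F ->
  nonneg_meas (fun w => \int[predictor Q g chi [seq y w | y <- zs]]_x F (w, x)).
Proof.
move=> mzs nF; have [mF F0] := nF; split; first exact: measurable_integral_predictor.
move=> w; rewrite integral_predictor; last by split => //; exact: msec.
have [_ h1] := measurable_einit_likelihood mzs nF; have [_ h2] := nonneg_meas_mass mzs.
by rewrite mule_ge0 ?inve_ge0//.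
Qed.

Let ng : nonneg_meas (fun p : W * X => (g p.2 (yn p.1))%:E).
Proof.
split=> [|p]; last by rewrite lee_fin ltW.
apply/measurable_EFinP.
apply: (@measurableT_comp _ _ _ _ _ _ (fun p : X * Y => g p.1 p.2)
  _ (fun p : W * X => (p.2, yn p.1))) => //.
by apply: measurable_fun_pair => //; exact: measurableT_comp.
Qed.

Let measurable_integral_filtering :
  measurable_fun [set: W] (fun w => \int[filtering Q g chi (sw w) (yn w)]_x (h x)%:E).
Proof.
have mhE : measurable_fun [set: X] (EFin \o h) by exact/measurable_EFinP.
under eq_fun => w do rewrite (integral_filtering _ _ mhE).
have mFop F : nonneg_meas F -> measurable_fun [set: W] (fun w => efilter (sw w) (yn w) F).
  move=> nF; apply: measurable_fun_div.
    apply: measurable_fun_div; last exact: nonneg_meas_mass.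
    by case: (measurable_einit_likelihood mys (nonneg_measM (nonneg_meas_fst nF) ng)).
  have [mP P0] := measurable_einit_likelihood mys ng; have [m1 m0] := nonneg_meas_mass mys.
  split=> [|w]; first exact: measurable_fun_div.
  by apply: mule_ge0; [exact: P0|rewrite inve_ge0; exact: m0].
by apply: emeasurable_funB; apply: mFop; [exact: nonneg_meas_funepos|exact: nonneg_meas_funeneg].
Qed.

Let nonneg_meas_sqr (d : measure_display) (T : measurableType d) (F : T -> \bar R) :
  measurable_fun [set: T] F -> nonneg_meas (fun x => F x ^+ 2).
Proof.
move=> mF; split=> [|x]; last by rewrite expe2; exact: sqre_ge0.
by under eq_fun do rewrite expe2; exact: emeasurable_funM.
Qed.

(** Every integral in the definition of the variance is a difference of quotients
    of likelihoods, jointly measurable in the observations and the state. *)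
Lemma measurable_filter_variance :
  measurable_fun [set: W] (fun w => filter_variance Q g chi (sw w) (yn w) h).
Proof.
apply: measurable_fun_div; last first.
  apply: nonneg_meas_sqr.
  apply: (@measurable_integral_predictor ys (fun p => (g p.2 (yn p.1))%:E) mys).
  by case: ng.
pose f (p : W * X) : \bar R :=
  (g p.2 (yn p.1))%:E * ((h p.2)%:E - \int[filtering Q g chi (sw p.1) (yn p.1)]_x' (h x')%:E).
have mf : measurable_fun [set: W * X] f.
  apply: emeasurable_funM; first by case: ng.
  apply: emeasurable_funB; first by apply/measurable_EFinP; exact: measurableT_comp.
  exact: (measurableT_comp measurable_integral_filtering).
rewrite /predictor_variance.
under eq_fun do rewrite size_map.
apply: emeasurable_sum => k.
pose tk := take k ys. pose dk := drop k ys.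
have mtk y : List.In y tk -> measurable_fun [set: W] y.
  move=> ytk; apply: mys; rewrite -(cat_take_drop k ys).
  by apply/List.in_or_app; left.
have mdk y : List.In y dk -> measurable_fun [set: W] y.
  move=> ytk; apply: mys; rewrite -(cat_take_drop k ys).
  by apply/List.in_or_app; right.
under eq_fun => w do rewrite -map_take -map_drop -/(tk) -/(dk).
have nLT : nonneg_meas (fun p : W * X => Lker Q g [seq y p.1 | y <- dk] p.2 [set: X]).
  under eq_fun do rewrite LkerE.
  exact: (measurable_elikelihood mdk (nonneg_meas_fst (nonneg_meas_indic measurableT))).
pose G (p : W * X) := ((\int[Lker Q g [seq y p.1 | y <- dk] p.2]_x' f (p.1, x') -
   (\int[predictor Q g chi (sw p.1)]_x' f (p.1, x')) *
    Lker Q g [seq y p.1 | y <- dk] p.2 [set: X]) /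
   \int[predictor Q g chi [seq y p.1 | y <- tk]]_x'
      Lker Q g [seq y p.1 | y <- dk] x' [set: X]) ^+ 2.
suff nG : nonneg_meas G by case: (nonneg_meas_integral_predictor mtk nG).
apply: nonneg_meas_sqr; apply: measurable_fun_div; last first.
  have [m0 m1] := nonneg_meas_integral_predictor mtk nLT.
  by split=> [|p //]; exact: (measurableT_comp m0).
apply: emeasurable_funB; first exact: measurable_integral_Lker.
apply: emeasurable_funM; last by case: nLT.
exact: (measurableT_comp (measurable_integral_predictor mys mf)).
Qed.

End FilterVariance.

End Initial.

End LikelihoodOperator.

(** * Real-valued likelihoods and the variance of the filter *)

Section ProbabilityFunctional.
Local Open Scope ring_scope.
Context {R : realType} {d : measure_display} {X : measurableType d}.

Definition mean (m : {measure set X -> \bar R}) (f : X -> R) : R :=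
  fine (\int[m]_x (f x)%:E)%E.

Variable m : {measure set X -> \bar R}.
Hypothesis m1 : (m [set: X] = 1)%E.

Lemma bounded_meas_integrable (f : X -> R) : bounded_meas f -> m.-integrable [set: X] (EFin \o f).
Proof.
move=> [mf [M HM]]; apply: measurable_bounded_integrable => //.
  by rewrite m1 ltry.
exists M; split; first exact: num_real.
by move=> x Mx y _; exact: le_trans (HM y) (ltW Mx).
Qed.

Lemma meanE (f : X -> R) : bounded_meas f -> (\int[m]_x (f x)%:E = (mean m f)%:E)%E.
Proof. by move=> bf; rewrite fineK//; exact: integrable_fin_num (bounded_meas_integrable bf). Qed.

Lemma mean_cst (a : R) : mean m (fun=> a) = a.
Proof. by rewrite /mean integral_cst// m1 mule1. Qed.

Lemma posfun_mean : posfun (mean m).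
Proof.
split=> [a f g bf bg|f bf f0].
- apply: EFin_inj; rewrite -meanE; last by apply: bounded_measD => //; exact: bounded_measZ.
  rewrite EFinD EFinM -!meanE// -integralZl//; last exact: bounded_meas_integrable.
  rewrite -integralD//; last exact: bounded_meas_integrable.
  apply: (bounded_meas_integrable (bounded_measZ a bf)).
- by apply: fine_ge0; apply: integral_ge0 => x _; rewrite lee_fin.
Qed.

End ProbabilityFunctional.

Section RealLikelihood.
Local Open Scope ring_scope.
Context {R : realType} {dX dY : measure_display} {X : measurableType dX}
  {Y : measurableType dY} (Q : R.-pker X ~> X) (g : X -> Y -> R).
Hypothesis g_pos : forall x y, 0 < g x y.
Hypothesis g_meas : measurable_fun [set: X * Y] (fun p => g p.1 p.2).

Definition bdd_obs (y : Y) := exists c, forall x, g x y <= c.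

Let Qint (f : X -> R) x := mean (Q x) f.

Let Q1 x : (Q x [set: X] = 1)%E. Proof. exact: prob_kernel. Qed.

Let posop_Qint : posop Qint.
Proof.
split=> [x|f bf]; first exact: posfun_mean.
split.
  apply: (@measurableT_comp _ _ _ _ _ _ fine _ (fun x => (\int[Q x]_x' (f x')%:E)%E)).
    exact: fine_measurable.
  under eq_fun do rewrite integralE.
  have mf : measurable_fun [set: X] (EFin \o f) by case: bf => ? _; exact/measurable_EFinP.
  apply: emeasurable_funB; apply: measurable_fun_integral_kernel.
  - by move=> U mU; exact: measurable_kernel.
  - by move=> z; exact: funepos_ge0.
  - exact: measurable_funepos.
  - by move=> U mU; exact: measurable_kernel.
  - by move=> z; exact: funeneg_ge0.
  - exact: measurable_funeneg.
have [_ [M HM]] := bf; exists M => x.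
have pm := posfun_mean (Q1 x).
have h1 : mean (Q x) (fun=> - M) <= Qint f x.
  apply: (posfun_le pm) => //; first exact: bounded_meas_cst.
  by move=> y; have := HM y; rewrite ler_norml => /andP[].
have h2 : Qint f x <= mean (Q x) (fun=> M).
  apply: (posfun_le pm) => //; first exact: bounded_meas_cst.
  by move=> y; have := HM y; rewrite ler_norml => /andP[].
by rewrite mean_cst// in h1; rewrite mean_cst// in h2; rewrite ler_norml h1.
Qed.

Lemma measurable_density y : measurable_fun [set: X] (g ^~ y).
Proof.
by apply: (@measurableT_comp _ _ _ _ _ _ (fun p : X * Y => g p.1 p.2)
    _ (fun x => (x, y))) => //; exact: measurable_fun_pair.
Qed.

Lemma bounded_meas_density y : bdd_obs y -> bounded_meas (g ^~ y).
Proof.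
move=> [c gc]; split; first exact: measurable_density.
by exists c => x; rewrite ger0_norm// ltW.
Qed.

Lemma posop_density y : bdd_obs y -> posop (fun (f : X -> R) x => g x y * f x).
Proof.
move=> by_; split=> [x|f bf]; last by apply: bounded_measM => //; exact: bounded_meas_density.
split=> [a f f' _ _|f _ f0]; first by ring.
by rewrite mulr_ge0// ltW.
Qed.

Fixpoint likelihood (s : seq Y) (f : X -> R) (x : X) : R :=
  if s is y :: s' then g x y * Qint (likelihood s' f) x else f x.

Definition bdd_seq (s : seq Y) := forall y, List.In y s -> bdd_obs y.

Lemma bdd_cons y s : bdd_seq (y :: s) -> bdd_obs y /\ bdd_seq s.
Proof. by move=> H; split=> [|z zs]; apply: H; [left|right]. Qed.

Lemma bdd_cat s1 s2 : bdd_seq (s1 ++ s2) <-> bdd_seq s1 /\ bdd_seq s2.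
Proof.
split=> [H|[H1 H2] y ys].
  by split=> y ys; apply: H; apply/List.in_or_app; [left|right].
by case: (List.in_app_or _ _ _ ys); [exact: H1|exact: H2].
Qed.

Lemma posop_likelihood s : bdd_seq s -> posop (likelihood s).
Proof.
elim: s => [_|y s IH] /=; first exact: posop_id.
move=> /bdd_cons[by_ /IH pL].
exact: (posop_comp (posop_density by_) (posop_comp posop_Qint pL)).
Qed.

Lemma likelihood_cat s1 s2 f : likelihood (s1 ++ s2) f = likelihood s1 (likelihood s2 f).
Proof. by elim: s1 => [//|y s IH] /=; rewrite IH. Qed.

Lemma likelihood_rcons s y : likelihood (rcons s y) (fun=> 1) = likelihood s (g ^~ y).
Proof.
rewrite -cats1 likelihood_cat; congr (likelihood s); apply/funext => x /=.
by rewrite /Qint mean_cst// mulr1.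
Qed.

Lemma likelihood_gt0 s f : bdd_seq s -> bounded_meas f -> (forall x, 0 < f x) -> forall x, 0 < likelihood s f x.
Proof.
move=> + bf f0; elim: s => [//|y s IH] /bdd_cons[by_ bs] x /=.
rewrite mulr_gt0// -lte_fin.
have bL : bounded_meas (likelihood s f) by case: (posop_likelihood bs) => _; exact.
rewrite /Qint -meanE//; apply: integral_gt0 => //.
  by case: bL => ? _; exact/measurable_EFinP.
by move=> x'; rewrite lte_fin IH.
Qed.

Lemma likelihood_le s f (lg : Y -> R) M : bounded_meas f -> (forall x, 0 <= f x <= M) ->
  (forall y, List.In y s -> forall x, g x y <= expR (lg y)) ->
  forall x, likelihood s f x <= expR (\sum_(y <- s) lg y) * M.
Proof.
move=> bf f0; elim: s => [_ x|y s IH H x] /=.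
  by rewrite big_nil expR0 mul1r; have /andP[] := f0 x.
have bs : bdd_seq s by move=> z zs; exists (expR (lg z)); apply: H; right.
have pL := posop_likelihood bs.
have bL : bounded_meas (likelihood s f) by case: pL => _; exact.
rewrite big_cons expRD -mulrA ler_pM ?(ltW (g_pos x y))//.
- apply: (posfun_ge0 (posop_Qint.1 x)) => // z.
  by apply: (posfun_ge0 (pL.1 z)) => // z'; have /andP[] := f0 z'.
- by apply: H; left.
- rewrite -(mean_cst (Q1 x) (expR _ * M)); apply: (posfun_le (posop_Qint.1 x)) => //.
    exact: bounded_meas_cst.
  by move=> z; apply: IH => y' y's; apply: H; right.
Qed.

Lemma elikelihoodE s f x : bdd_seq s -> bounded_meas f -> (forall x, 0 <= f x) ->
  elikelihood Q g s (EFin \o f) x = (likelihood s f x)%:E.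
Proof.
move=> + bf f0; elim: s x => [//|y s IH] x /bdd_cons[by_ bs] /=.
have pL := posop_likelihood bs.
have bL : bounded_meas (likelihood s f) by case: pL => _; exact.
have L0 z : 0 <= likelihood s f z by exact: (posfun_ge0 (pL.1 z)).
under eq_integral do rewrite IH//.
rewrite ge0_integralZl//.
- by rewrite (meanE (Q1 x) bL) -EFinM.
- by case: bL => ? _; exact/measurable_EFinP.
- by move=> z _; rewrite lee_fin.
- by rewrite lee_fin ltW.
Qed.

Lemma Lker_likelihood s x A : bdd_seq s -> measurable A ->
  Lker Q g s x A = (likelihood s \1_A x)%:E.
Proof.
by move=> bs mA; rewrite LkerE -elikelihoodE//; exact: bounded_meas_indic.
Qed.

Lemma Lker_likelihood1 s x : bdd_seq s -> Lker Q g s x [set: X] = (likelihood s (fun=> 1) x)%:E.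
Proof.
move=> bs; rewrite Lker_likelihood//; congr (likelihood s _ x)%:E; apply/funext => z.
by rewrite indicT.
Qed.

Let rpos (f : X -> R) x := Num.max (f x) 0.
Let rneg (f : X -> R) x := Num.max (- f x) 0.

Let rpos_ge0 f x : 0 <= rpos f x. Proof. by rewrite /rpos le_max lexx orbT. Qed.
Let rneg_ge0 f x : 0 <= rneg f x. Proof. by rewrite /rneg le_max lexx orbT. Qed.

Let bounded_meas_rpos f : bounded_meas f -> bounded_meas (rpos f).
Proof.
move=> [mf [M HM]]; split; first by apply: measurable_maxr => //; exact: measurable_cst.
exists M => x; rewrite ger0_norm// ge_max.
by rewrite (le_trans (ler_norm _) (HM x)) (le_trans (normr_ge0 _) (HM x)).
Qed.

Let bounded_meas_rneg f : bounded_meas f -> bounded_meas (rneg f).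
Proof.
move=> bf; have : bounded_meas (fun x => - f x).
  by under eq_fun do rewrite -mulN1r; exact: bounded_measZ.
exact: bounded_meas_rpos.
Qed.

Let rposneg (f : X -> R) : f = (fun x => -1 * rneg f x + rpos f x).
Proof.
by apply/funext => x; rewrite /rpos /rneg; case: (leP (f x) 0) => h1;
  case: (leP (- f x) 0) => h2; lra.
Qed.

Let eposE (f : X -> R) : ((EFin \o f)^\+ = EFin \o rpos f)%E.
Proof. by apply/funext => x; rewrite funeposE /= EFin_max. Qed.

Let enegE (f : X -> R) : ((EFin \o f)^\- = EFin \o rneg f)%E.
Proof. by apply/funext => x; rewrite funenegE /= -EFin_max. Qed.

Let posfun_rposneg L f : posfun L -> bounded_meas f -> L f = L (rpos f) - L (rneg f).
Proof.
move=> pL bf; rewrite {1}(rposneg f); have [lin _] := pL.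
rewrite lin; [lra|exact: bounded_meas_rneg|exact: bounded_meas_rpos].
Qed.

Lemma integral_Lker_likelihood s x f : bdd_seq s -> bounded_meas f ->
  (\int[Lker Q g s x]_x' (f x')%:E = (likelihood s f x)%:E)%E.
Proof.
move=> bs bf; have [mf _] := bf.
rewrite (integral_Lker _ g_pos g_meas); last exact/measurable_EFinP.
rewrite -/(EFin \o f) eposE enegE !elikelihoodE//; [|exact: bounded_meas_rneg|exact: bounded_meas_rpos].
by rewrite -EFinB -(posfun_rposneg ((posop_likelihood bs).1 x)).
Qed.

Section Initial.
Variable chi : probability X R.

Definition init_likelihood s f := mean chi (likelihood s f).

Let chi1 : (chi [set: X] = 1)%E. Proof. exact: probability_setT. Qed.

Lemma posfun_init_likelihood s : bdd_seq s -> posfun (init_likelihood s).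
Proof. by move=> bs; apply: posop_posfun; [exact: posop_likelihood|exact: posfun_mean]. Qed.

Lemma init_likelihood_gt0 s f : bdd_seq s -> bounded_meas f -> (forall x, 0 < f x) -> 0 < init_likelihood s f.
Proof.
move=> bs bf f0; have bL : bounded_meas (likelihood s f) by case: (posop_likelihood bs) => _; exact.
rewrite -lte_fin /init_likelihood -meanE//; apply: integral_gt0 => //.
  by case: bL => ? _; exact/measurable_EFinP.
by move=> x; rewrite lte_fin likelihood_gt0.
Qed.

Lemma init_likelihood_cat s1 s2 f : init_likelihood (s1 ++ s2) f = init_likelihood s1 (likelihood s2 f).
Proof. by rewrite /init_likelihood likelihood_cat. Qed.

Lemma Pop_init_likelihood s f : bdd_seq s -> bounded_meas f -> (forall x, 0 <= f x) ->
  einit_likelihood Q g chi s (EFin \o f) = (init_likelihood s f)%:E.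
Proof.
move=> bs bf f0; rewrite /einit_likelihood; under eq_integral do rewrite elikelihoodE//.
by rewrite meanE//; case: (posop_likelihood bs) => _; exact.
Qed.

Definition predicted s f := init_likelihood s f / init_likelihood s (fun=> 1).

Let mass_gt0 s : bdd_seq s -> 0 < init_likelihood s (fun=> 1).
Proof. by move=> bs; apply: init_likelihood_gt0 => //; exact: bounded_meas_cst. Qed.

Lemma posfun_predicted s : bdd_seq s -> posfun (predicted s).
Proof.
move=> bs; have [lin pos] := posfun_init_likelihood bs; split=> [a f f' bf bf'|f bf f0].
  by rewrite /predicted lin//; ring.
by apply: divr_ge0; [exact: pos|exact: ltW (mass_gt0 bs)].
Qed.

Let Pop1 s : bdd_seq s -> einit_likelihood Q g chi s (fun=> 1%E) = (init_likelihood s (fun=> 1))%:E.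
Proof. by move=> bs; rewrite -Pop_init_likelihood//; exact: bounded_meas_cst. Qed.

Lemma integral_predictor_likelihood s f : bdd_seq s -> bounded_meas f ->
  (\int[predictor Q g chi s]_x (f x)%:E = (predicted s f)%:E)%E.
Proof.
move=> bs bf; have [mf _] := bf.
rewrite (integral_predictor_signed _ g_pos g_meas); last exact/measurable_EFinP.
rewrite -/(EFin \o f) eposE enegE Pop1// !Pop_init_likelihood//; [|exact: bounded_meas_rneg|exact: bounded_meas_rpos].
rewrite inver gt_eqF ?mass_gt0// -!EFinM -EFinB /predicted; congr (_%:E).
by rewrite (posfun_rposneg (posfun_init_likelihood bs) bf) mulrBl.
Qed.

Lemma integral_filtering_likelihood s y f : bdd_seq s -> bdd_obs y -> bounded_meas f ->
  (\int[filtering Q g chi s y]_x (f x)%:E =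
   (init_likelihood s (fun x => g x y * f x) / init_likelihood s (g ^~ y))%:E)%E.
Proof.
move=> bs bdy bf; have [mf _] := bf.
have bg := bounded_meas_density bdy.
rewrite (integral_filtering _ g_pos g_meas); last exact/measurable_EFinP.
rewrite -/(EFin \o f) eposE enegE /efilter.
have E f' : bounded_meas f' -> (forall x, 0 <= f' x) ->
    einit_likelihood Q g chi s (fun x => (EFin \o f') x * (g x y)%:E)%E = (init_likelihood s (fun x => g x y * f' x))%:E.
  move=> bf' f'0; rewrite -Pop_init_likelihood//; last by move=> x; rewrite mulr_ge0// ltW.
    by congr einit_likelihood; apply/funext => x /=; rewrite -EFinM mulrC.
  exact: bounded_measM.
have Eg : einit_likelihood Q g chi s (fun x => (g x y)%:E) = (init_likelihood s (g ^~ y))%:E.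
  by rewrite -Pop_init_likelihood// => x; rewrite ltW.
have cg0 : 0 < init_likelihood s (g ^~ y) by exact: init_likelihood_gt0.
have c0 := mass_gt0 bs.
rewrite !E//; [|exact: bounded_meas_rneg|exact: bounded_meas_rpos].
rewrite Pop1// Eg inver gt_eqF// -!EFinM inver gt_eqF; last by rewrite divr_gt0.
rewrite -!EFinM -EFinB; congr (_%:E).
have pg : posfun (fun f => init_likelihood s (fun x => g x y * f x)).
  exact: (posop_posfun (posop_density bdy) (posfun_init_likelihood bs)).
rewrite (posfun_rposneg pg bf); field.
by rewrite !gt_eqF.
Qed.

(** With A the filter mean of h, the function f = g_y (h - A) has predictor mean
    zero, so that the k-th summand is the mean of the square of
    L_k f / (normalization), and L_k f times chi L g_y is the cross difference. *)
Lemma filter_variance_le s y h (U : nat -> R) : bdd_seq s -> bdd_obs y -> bounded_meas h ->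
  (forall k x, (k <= size s)%N ->
    `|likelihood (drop k s) (fun x => g x y * h x) x * init_likelihood s (g ^~ y) -
      likelihood (drop k s) (g ^~ y) x * init_likelihood s (fun x => g x y * h x)| *
    init_likelihood (take k s) (fun=> 1) <= U k * init_likelihood s (g ^~ y) ^+ 2) ->
  (`|filter_variance Q g chi s y h| <= (\sum_(k < (size s).+1) U k ^+ 2)%:E)%E.
Proof.
move=> bs bdy bh HU.
have bg := bounded_meas_density bdy.
have cg0 : 0 < init_likelihood s (g ^~ y) by exact: init_likelihood_gt0.
set A := init_likelihood s (fun x => g x y * h x) / init_likelihood s (g ^~ y).
pose f x := g x y * (h x + - A * 1).
have bf : bounded_meas f.
  apply: bounded_measM => //; apply: bounded_measD => //; apply: bounded_measZ; exact: bounded_meas_cst.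
have fE L : posfun L -> L f = L (fun x => g x y * h x) - A * L (g ^~ y).
  move=> pL; have -> : f = (fun x => - A * g x y + g x y * h x).
    by apply/funext => x; rewrite /f; ring.
  by have [lin _] := pL; rewrite lin//; [ring|exact: bounded_measM].
have pf0 : predicted s f = 0.
  rewrite (fE _ (posfun_predicted bs)) /predicted /A; field.
  by rewrite !gt_eqF ?mass_gt0.
have btd k : bdd_seq (take k s) /\ bdd_seq (drop k s).
  by apply/bdd_cat; rewrite cat_take_drop.
rewrite /filter_variance (integral_filtering_likelihood bs bdy bh) -/A.
rewrite (integral_predictor_likelihood bs bg).
have -> : (fun x => (g x y)%:E * ((h x)%:E - A%:E))%E = EFin \o f.
  by apply/funext => x /=; rewrite -EFinB -EFinM /f; congr (_%:E); ring.
rewrite /predictor_variance.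
have pg0 : 0 < predicted s (g ^~ y) by rewrite divr_gt0// mass_gt0.
pose u k x := likelihood (drop k s) f x / predicted (take k s) (likelihood (drop k s) (fun=> 1)).
have bu k : bounded_meas (u k).
  rewrite /u; under eq_fun do rewrite mulrC.
  by apply: bounded_measZ; case: (posop_likelihood (btd k).2) => _; exact.
have term k : (k <= size s)%N ->
   (\int[predictor Q g chi (take k s)]_x
      ((((\int[Lker Q g (drop k s) x]_x' (EFin \o f) x') -
      (\int[predictor Q g chi s]_x' (EFin \o f) x') *
       Lker Q g (drop k s) x [set: X]) /
     \int[predictor Q g chi (take k s)]_x' Lker Q g (drop k s) x' [set: X]) ^+ 2))%E =
   (predicted (take k s) (fun x => u k x * u k x))%:E.
  move=> ks; have [bt bd] := btd k.
  have bL1 : bounded_meas (likelihood (drop k s) (fun=> 1)).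
    by case: (posop_likelihood bd) => _; apply; exact: bounded_meas_cst.
  have p0 : 0 < predicted (take k s) (likelihood (drop k s) (fun=> 1)).
    rewrite /predicted divr_gt0 ?mass_gt0// init_likelihood_gt0// => x.
    by apply: likelihood_gt0 => //; exact: bounded_meas_cst.
  rewrite -integral_predictor_likelihood//; last exact: bounded_measM.
  congr integral; apply/funext => x.
  rewrite (integral_Lker_likelihood x bd bf) (integral_predictor_likelihood bs bf) pf0 mul0e sube0.
  rewrite (_ : (\int[predictor Q g chi (take k s)]_x' Lker Q g (drop k s) x' [set: X])%E =
     (predicted (take k s) (likelihood (drop k s) (fun=> 1)))%:E).
    by rewrite inver gt_eqF// -EFinM expe2 -EFinM.
  rewrite -integral_predictor_likelihood//; congr integral; apply/funext => x'.
  by rewrite Lker_likelihood1.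
have -> : (\sum_(k < (size s).+1)
   \int[predictor Q g chi (take k s)]_x
      ((((\int[Lker Q g (drop k s) x]_x' (EFin \o f) x') -
      (\int[predictor Q g chi s]_x' (EFin \o f) x') *
       Lker Q g (drop k s) x [set: X]) /
     \int[predictor Q g chi (take k s)]_x' Lker Q g (drop k s) x' [set: X]) ^+ 2))%E =
   (\sum_(k < (size s).+1) predicted (take k s) (fun x => u k x * u k x))%:E.
  by rewrite -sumEFin; apply: eq_bigr => k _; apply: term; rewrite -ltnS ltn_ord.
rewrite expe2 -EFinM inver gt_eqF; last by rewrite mulr_gt0.
rewrite -EFinM abse_EFin lee_fin ger0_norm; last first.
  apply: divr_ge0; last by rewrite mulr_ge0// ltW.
  apply: sumr_ge0 => k _.
  apply: (posfun_ge0 (posfun_predicted (btd k).1)); first exact: bounded_measM.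
  by move=> x; rewrite -expr2 sqr_ge0.
rewrite (ler_pdivrMr _ _ (mulr_gt0 pg0 pg0)) mulr_suml; apply: ler_sum => k _.
have ks : (k <= size s)%N by rewrite -ltnS ltn_ord.
have [bt bd] := btd k.
have ct0 := mass_gt0 bt. have cs0 := mass_gt0 bs.
rewrite -(_ : predicted (take k s) (fun=> U k ^+ 2 * (predicted s (g ^~ y) * predicted s (g ^~ y))) =
  U k ^+ 2 * (predicted s (g ^~ y) * predicted s (g ^~ y))); last first.
  set c := _ * _; rewrite -[in LHS](mulr1 c) (posfunZ c (posfun_predicted bt)); last exact: bounded_meas_cst.
  by rewrite /predicted divff ?mulr1// gt_eqF.
apply: (posfun_le (posfun_predicted bt)); [exact: bounded_measM|exact: bounded_meas_cst|].
move=> x; rewrite -!expr2 -exprMn -[leLHS]ger0_norm ?sqr_ge0// normrX.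
have p0 : predicted (take k s) (likelihood (drop k s) (fun=> 1)) = init_likelihood s (fun=> 1) / init_likelihood (take k s) (fun=> 1).
  by rewrite /predicted -init_likelihood_cat cat_take_drop.
have main : `|u k x| <= U k * predicted s (g ^~ y).
  rewrite /u p0 normrM normfV (ger0_norm (_ : 0 <= _ / init_likelihood (take k s) _)); last first.
    by rewrite divr_ge0// ltW.
  rewrite ler_pdivrMr ?divr_gt0//.
  rewrite (fE _ ((posop_likelihood bd).1 x)).
  have := HU k x ks; set a := likelihood _ (g ^~ y) x; set b := likelihood _ _ x.
  set E := init_likelihood s (g ^~ y); set H := init_likelihood s _ => HU'.
  have E0 : 0 < E by [].
  have -> : U k * predicted s (g ^~ y) * (init_likelihood s (fun=> 1) / init_likelihood (take k s) (fun=> 1)) =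
    U k * E / init_likelihood (take k s) (fun=> 1).
    by rewrite /predicted -/E; field; rewrite !gt_eqF.
  rewrite ler_pdivlMr// -(ler_pM2r E0).
  rewrite -[X in `|_| * _ * X](ger0_norm (ltW E0)) mulrAC -normrM.
  have -> : (b - A * a) * E = b * E - a * H.
    by rewrite /A -/E -/H; field; rewrite gt_eqF.
  by apply: le_trans HU' _; rewrite expr2 mulrA.
by rewrite !expr2 ler_pM.
Qed.

End Initial.

End RealLikelihood.

(** * Time indices in one residue class *)

Section ResidueClass.
Local Open Scope ring_scope.
Context {R : realType} {dX dY : measure_display} {X : measurableType dX}
  {Y : measurableType dY} (Q : R.-pker X ~> X) (g : X -> Y -> R).
Hypothesis g_pos : forall x y, 0 < g x y.
Hypothesis g_meas : measurable_fun [set: X * Y] (fun p => g p.1 p.2).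
Variables (chi : probability X R) (h : X -> R) (Bh : R).
Hypotheses (bh : bounded_meas h) (hB : forall x, `|h x| <= Bh).
Variables (C D : set X) (M kappa C0 w : R) (q j0 : nat).
Hypotheses (mC : measurable C) (mD : measurable D).
Hypotheses (M0 : 0 <= M) (C00 : 0 <= C0) (kappa01 : 0 < kappa < 1) (q0 : (0 < q)%N).
Hypotheses (w01 : 0 < w <= 1) (rhow : 1 - kappa ^+ 2 <= expR (- (64 * w)))
  (qw : 4 * (M + 1) <= w * q%:R).
Hypothesis j08 : 200 * (C0 + 2) <= j0%:R.
Hypothesis j0e : expR (- j0%:R) <= (1 - (1 - kappa ^+ 2)) / 4.

Variables (lg : Y -> R) (obs : nat -> Y).
Hypothesis hlg : forall i x, g x (obs i) <= expR (lg (obs i)).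

(** The observations obs k, ..., obs (k + m - 1). *)
Definition segment k m := [seq obs i | i <- iota k m].
Local Notation sg := segment.
Definition sumlg (s : seq Y) : R := \sum_(y <- s) lg y.

Lemma segment_cat k m1 m2 : sg k (m1 + m2) = sg k m1 ++ sg (k + m1) m2.
Proof. by rewrite /segment iotaD map_cat. Qed.

Lemma sumlg_cat s1 s2 : sumlg (s1 ++ s2) = sumlg s1 + sumlg s2.
Proof. by rewrite /sumlg big_cat. Qed.

Lemma segment_dom k m y : List.In y (sg k m) -> forall x, g x y <= expR (lg y).
Proof.
rewrite /segment; elim: (iota k m) => //= i s IH [<- x|/IH//]; exact: hlg.
Qed.

Lemma bdd_segment k m : bdd_seq g (sg k m).
Proof. by move=> y /segment_dom H; exists (expR (lg y)). Qed.

Variables (r n c : nat) (good_block : nat -> bool) (v : nat -> R).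
Hypotheses (cr : (c < r)%N) (cn : (c <= n)%N).
Let t := (n - c)%N.
Let N1 := (t %/ r)%N.
Let l := (t %% r)%N.
Let N := N1.+1.
Let tau := expR (- (64 * (M + 1))).
Let blk j := sg (t - j * r) r.

Hypothesis kfN : forall j, good_block j -> (0 < j <= N1)%N.
Hypothesis KC : forall j x, good_block j -> ~ C x ->
  likelihood Q g (blk j) (fun=> 1) x <= tau ^+ 2 * expR (sumlg (blk j)).
Hypothesis Km : forall j, good_block j -> minorized C kappa (likelihood Q g (blk j)).
Hypothesis v0 : forall j, 0 <= v j.
Hypothesis hV : forall j x, (j <= N1)%N -> D x ->
  expR (- v j) * expR (sumlg (blk j)) <= likelihood Q g (blk j) \1_D x.
Hypothesis start : expR (- C0) * expR (sumlg (sg 0 l)) <= init_likelihood Q g chi (sg 0 l) \1_D.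
Hypothesis hv : forall lo m, (lo + m <= N)%N ->
  window_sum v lo m <= M * m%:R + (lo + m)%:R / (200 * q%:R) + C0.
Hypothesis hn : forall lo m, (lo + m <= N)%N ->
  (bad_count good_block lo m)%:R <= m%:R / 3 + (lo + m)%:R / (200 * q%:R) + C0.

Let gn := g ^~ (obs n).

Let tE : t = (N1 * r + l)%N. Proof. exact: divn_eq. Qed.

Let bgn : bdd_obs g (obs n). Proof. by exists (expR (lg (obs n))); exact: hlg. Qed.

(** Block j starts j * r steps before t; block 0 is the incomplete block of the
    last c observations before n together with the density of the observation at n, and beyond
    the N1 complete blocks the identity is used. *)
Let raw j : (X -> R) -> X -> R :=
  if j == 0%N then fun f => likelihood Q g (sg t c) (fun x => gn x * f x)
  else if (j <= N1)%N then likelihood Q g (blk j) else fun f => f.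

(** Upper bounds of the masses of the blocks, by which they are normalized. *)
Let wt j : R := if j == 0%N then expR (sumlg (sg t c.+1))
  else if (j <= N1)%N then expR (sumlg (blk j)) else 1.

Let wt_gt0 j : 0 < wt j.
Proof. by rewrite /wt; case: ifP => _; [|case: ifP => _//]; exact: expR_gt0. Qed.

Let B j f x := (wt j)^-1 * raw j f x.

Let pLR k m : posop (likelihood Q g (sg k m)).
Proof. by apply: posop_likelihood => //; exact: bdd_segment. Qed.

Let posop_raw j : posop (raw j).
Proof.
rewrite /raw; case: ifP => _; last by case: ifP => _; [exact: pLR|exact: posop_id].
exact: (posop_comp (pLR t c) (posop_density g_pos g_meas bgn)).
Qed.

Let posfun_scale a (L : (X -> R) -> R) : 0 <= a -> posfun L -> posfun (fun f => a * L f).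
Proof.
move=> a0 [lin pos_]; split=> [b f f' bf bf'|f bf f0]; first by rewrite lin//; ring.
by rewrite mulr_ge0// pos_.
Qed.

Let posop_B j : posop (B j).
Proof.
have [px pb] := posop_raw j; split=> [x|f bf].
  by apply: posfun_scale => //; rewrite invr_ge0 ltW.
by apply: bounded_measZ; exact: pb.
Qed.

Let obs_last : sg t c.+1 = rcons (sg t c) (obs n).
Proof. by rewrite -addn1 segment_cat cats1 /t subnK. Qed.

Let raw0_1 : raw 0 (fun=> 1) = likelihood Q g (sg t c.+1) (fun=> 1).
Proof.
rewrite obs_last likelihood_rcons /raw eqxx; congr (likelihood Q g _ _).
by apply/funext => x; rewrite mulr1.
Qed.

Let LR1_le k m x : likelihood Q g (sg k m) (fun=> 1) x <= expR (sumlg (sg k m)).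
Proof.
rewrite -[leRHS]mulr1; apply: (likelihood_le Q g_pos g_meas) => //; first exact: bounded_meas_cst.
  by move=> y; rewrite ler01 lexx.
by move=> y ys x'; exact: (segment_dom ys).
Qed.

Let raw1_le j x : raw j (fun=> 1) x <= wt j.
Proof.
case: j => [|j]; first by rewrite raw0_1 /wt eqxx.
by rewrite /raw /wt /=; case: ifP => _ //; exact: LR1_le.
Qed.

Let B1 j x : B j (fun=> 1) x <= 1.
Proof. by rewrite /B mulrC ler_pdivrMr// mul1r. Qed.

Let BC j x : good_block j -> ~ C x -> B j (fun=> 1) x <= tau ^+ 2.
Proof.
move=> kj nC; have /andP[j1 jN] := kfN kj.
rewrite /B mulrC ler_pdivrMr// /raw /wt jN; case: j kj j1 jN => // j kj _ jN /=.
exact: KC.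
Qed.

Let Bm j : good_block j -> minorized C kappa (B j).
Proof.
move=> kj; have /andP[j1 jN] := kfN kj.
have [mu [phi [pmu phi0 H]]] := Km kj.
have w0 : 0 < (wt j)^-1 by rewrite invr_gt0.
exists mu, (fun x => (wt j)^-1 * phi x); split => //.
  by move=> x; rewrite mulr_ge0// ltW.
move=> f x bf f0 Cx; have /andP[h1 h2] := H f x bf f0 Cx.
have rE : raw j = likelihood Q g (blk j) by rewrite /raw jN; case: j j1 {kj H jN w0 h1 h2} => // j.
have := ler_wpM2l (ltW w0) h1; have := ler_wpM2l (ltW w0) h2.
by rewrite /B rE => h3 h4; apply/andP; split; lra.
Qed.

Let BD0 x : D x -> expR (- v 0%N) <= B 0 (fun=> 1) x.
Proof.
move=> Dx; rewrite /B mulrC raw0_1 /wt eqxx ler_pdivlMr ?expR_gt0//.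
have := hV (leq0n N1) Dx; rewrite /blk mul0n subn0.
have -> : sg t r = sg t c.+1 ++ sg (t + c.+1) (r - c.+1).
  by rewrite -segment_cat subnKC.
set s1 := sg t c.+1; set s2 := sg _ (r - c.+1).
rewrite sumlg_cat expRD => H.
have e2 : 0 < expR (sumlg s2) by exact: expR_gt0.
rewrite -(ler_pM2r e2) -mulrA; apply: le_trans H _.
have bs : bdd_seq g (s1 ++ s2) by apply/bdd_cat; split; exact: bdd_segment.
apply: (@le_trans _ _ (likelihood Q g (s1 ++ s2) (fun=> 1) x)).
  apply: (posfun_le ((posop_likelihood Q g_pos g_meas bs).1 x)); [exact: bounded_meas_indic|exact: bounded_meas_cst|].
  by move=> y; rewrite indicE; case: (_ \in _).
rewrite likelihood_cat mulrC -(posfunZ _ ((pLR t c.+1).1 x)); last exact: bounded_meas_cst.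
apply: (posfun_le ((pLR t c.+1).1 x)).
- by case: (pLR (t + c.+1) (r - c.+1)) => _; apply; exact: bounded_meas_cst.
- by apply: bounded_measZ; exact: bounded_meas_cst.
- by move=> y; rewrite mulr1; exact: LR1_le.
Qed.

Let BD j x : D x -> expR (- v j.+1) <= B j.+1 \1_D x.
Proof.
move=> Dx; rewrite /B mulrC ler_pdivlMr// /raw /wt /=; case: ifP => [jN|_].
  exact: hV.
rewrite mulr1 indicE mem_set// -[X in _ <= X]expR0 ler_expR oppr_le0//.
Qed.

Let W0 := expR (sumlg (sg 0 l)).
Let psi f := W0^-1 * init_likelihood Q g chi (sg 0 l) f.

Let ppsi : posfun psi.
Proof.
apply: posfun_scale; first by rewrite invr_ge0 expR_ge0.
by apply: posfun_init_likelihood => //; exact: bdd_segment.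
Qed.

Let psi1 : psi (fun=> 1) <= 1.
Proof.
rewrite /psi mulrC ler_pdivrMr ?expR_gt0// mul1r /init_likelihood.
have p1 : (chi [set: X] = 1)%E by exact: probability_setT.
rewrite -(mean_cst p1 W0); apply: (posfun_le (posfun_mean p1)).
- by case: (pLR 0 l) => _; apply; exact: bounded_meas_cst.
- exact: bounded_meas_cst.
- by move=> x; exact: LR1_le.
Qed.

Let psiD : expR (- C0) <= psi \1_D.
Proof. by rewrite /psi mulrC ler_pdivlMr ?expR_gt0. Qed.

Let pw lo m : R := \prod_(i < m) wt (lo + i)%N.

Let pw_gt0 lo m : 0 < pw lo m.
Proof. by apply: prodr_gt0 => i _. Qed.

Let pwD lo a b : pw lo (a + b) = pw lo a * pw (lo + a) b.
Proof.
elim: b => [|b IH]; first by rewrite addn0 /pw big_ord0 mulr1.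
by rewrite addnS /pw !big_ord_recr /= -!/(pw _ _) IH mulrA addnA.
Qed.

Let window_opB lo m f x : bounded_meas f -> window_op B lo m f x = (pw lo m)^-1 * window_op raw lo m f x.
Proof.
move=> bf; elim: m x => [|m IH] x /=.
  by rewrite /pw big_ord0 invr1 mul1r.
have br : bounded_meas (window_op raw lo m f) by case: (posop_window_op posop_raw lo m) => _; exact.
rewrite /B; have -> : window_op B lo m f = (fun x => (pw lo m)^-1 * window_op raw lo m f x).
  by apply/funext => y.
rewrite (posfunZ _ ((posop_raw (lo + m)).1 x))// /pw big_ord_recr /= invfM.
by rewrite mulrA; congr (_ * _); rewrite mulrC.
Qed.

Let window_op_raw1 lo m f : (0 < lo)%N -> (lo + m <= N)%N ->
  window_op raw lo m f = likelihood Q g (sg (t - (lo + m).-1 * r) (m * r)) f.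
Proof.
move=> lo0; elim: m => [//|m IH] lmN /=.
rewrite IH; last by apply: leq_trans lmN; rewrite addnS.
have lm0 : (0 < lo + m)%N by rewrite addn_gt0 lo0.
rewrite addnS /= in lmN *; rewrite /raw gtn_eqF//= ifT; last by move: lmN; rewrite /N ltnS.
have le : ((lo + m) * r <= t)%N.
  by rewrite tE; apply: leq_trans (leq_addr _ _); rewrite leq_mul2r -ltnS lmN orbT.
rewrite /blk mulSn -likelihood_cat segment_cat; congr (likelihood Q g (_ ++ sg _ _) f).
case: (lo + m)%N lm0 le => // k _ /=; rewrite mulSn.
by move: (k * r)%N (t) => kr t'; clear; lia.
Qed.

Let window_op_raw0 m f : (m <= N1)%N ->
  window_op raw 0 m.+1 f = likelihood Q g (sg (t - m * r) (m * r + c)) (fun x => gn x * f x).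
Proof.
move=> mN; rewrite -[m.+1]add1n window_opD /= add0n.
rewrite (@window_op_raw1 1 m _ isT) ?add1n// /= /raw /=.
rewrite -likelihood_cat segment_cat; congr (likelihood Q g (_ ++ sg _ _) _).
rewrite subnK// tE; apply: leq_trans (leq_addr _ _).
by rewrite leq_mul2r mN orbT.
Qed.

(** [stable_bound] for the normalized blocks: both sides are homogeneous of the
    same degree in each block, so the normalizations cancel. *)
Lemma residue_bound k i x : t = (k + i * r)%N ->
  `|likelihood Q g (sg k (n - k)) (fun x => gn x * h x) x * init_likelihood Q g chi (sg 0 n) gn -
    likelihood Q g (sg k (n - k)) gn x * init_likelihood Q g chi (sg 0 n) (fun x => gn x * h x)| *
  init_likelihood Q g chi (sg 0 k) (fun=> 1) <=
  (4 * Bh * expR (2 * (M + 1) * (q * j0)%:R + 2 * C0) + 2 * Bh) *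
    expR (w * (q * j0)%:R) * expR (- (w * i.+1%:R)) * init_likelihood Q g chi (sg 0 n) gn ^+ 2.
Proof.
move=> tk.
have r0 : (0 < r)%N by apply: leq_ltn_trans cr.
have iN : (i <= N1)%N by rewrite /N1 leq_divRL// tk leq_addl.
have iN' : (i.+1 <= N)%N by [].
have main := @stable_bound R dX X B good_block C D M kappa C0 v N psi q mC mD M0 C00 kappa01 q0
  posop_B B1 BC Bm BD0 BD ppsi psi1 psiD hv hn w Bh h w01 rhow qw bh hB j0 j08 j0e
  i.+1 x iN'.
have b1 : bounded_meas ((fun=> 1) : X -> R) := bounded_meas_cst 1.
have kE : (t - i * r = k)%N by rewrite tk addnK.
have nkE : (i * r + c = n - k)%N.
  by move: tk; rewrite /t; move: cn (i * r)%N; clear; lia.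
have lk : (l + (N1 - i) * r = k)%N.
  move: tk; rewrite tE mulnBl.
  have : (i * r <= N1 * r)%N by rewrite leq_mul2r iN orbT.
  by move: (i * r)%N (N1 * r)%N (l); clear; lia.
have W0g : 0 < W0^-1 by rewrite invr_gt0 expR_gt0.
have psiW lo m f : bounded_meas f -> psi (window_op B lo m f) = (pw lo m)^-1 * psi (window_op raw lo m f).
  move=> bf; rewrite -(posfunZ _ ppsi); last by case: (posop_window_op posop_raw lo m) => _; exact.
  by congr psi; apply/funext => y; rewrite window_opB.
have gn1 : (fun x => gn x * 1) = gn by apply/funext => y; rewrite mulr1.
have full : (sg 0 l ++ sg l (N1 * r + c) = sg 0 n).
  rewrite -[X in sg X (_ + _)]add0n -segment_cat; congr (sg 0 _).
  by move: tE; rewrite /t; move: cn (N1 * r)%N (l); clear; lia.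
have rawN f : psi (window_op raw 0 N f) = W0^-1 * init_likelihood Q g chi (sg 0 n) (fun x => gn x * f x).
  have tN : (t - N1 * r = l)%N by rewrite tE addKn.
  by rewrite window_op_raw0// tN /psi -init_likelihood_cat full.
have rawk : psi (window_op raw i.+1 (N - i.+1) (fun=> 1)) = W0^-1 * init_likelihood Q g chi (sg 0 k) (fun=> 1).
  rewrite window_op_raw1//; last by rewrite subnKC.
  rewrite /psi -init_likelihood_cat; congr (_ * init_likelihood _ _ _ _ _).
  rewrite subnKC// /N /= subSS -lk.
  by rewrite tE addKn -[X in sg X (_ * _)]add0n -segment_cat.
have rawi f : window_op raw 0 i.+1 f = likelihood Q g (sg k (n - k)) (fun x => gn x * f x).
  by rewrite window_op_raw0// kE nkE.
move: main; rewrite subn0 !psiW// !rawN rawk !window_opB// !rawi gn1.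
have pwE : pw 0 N = pw 0 i.+1 * pw i.+1 (N - i.+1).
  by rewrite -pwD subnKC.
rewrite pwE; have P1 := pw_gt0 0 i.+1; have P2 := pw_gt0 i.+1 (N - i.+1).
set p1 := pw 0 i.+1 in P1 *; set p2 := pw i.+1 _ in P2 *.
set a := likelihood _ _ _ gn x; set b := likelihood _ _ _ _ x; set E := init_likelihood _ _ _ _ gn; set H := init_likelihood _ _ _ (sg 0 n) _.
set ck := init_likelihood _ _ _ _ _; set K := _ * expR (- _).
have s0 : 0 < p1^-1 * (p1 * p2)^-1 * W0^-1 * p2^-1 * W0^-1.
  by rewrite !mulr_gt0// invr_gt0// mulr_gt0.
have s1 : 0 <= p1^-1 * (p1 * p2)^-1 * W0^-1.
  by rewrite !mulr_ge0 ?invr_ge0 ?mulr_ge0// ?ltW// -invr_gt0.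
have -> : p1^-1 * b * ((p1 * p2)^-1 * (W0^-1 * E)) - p1^-1 * a * ((p1 * p2)^-1 * (W0^-1 * H)) =
  (p1^-1 * (p1 * p2)^-1 * W0^-1) * (b * E - a * H) by ring.
rewrite normrM (ger0_norm s1).
have -> : p1^-1 * (p1 * p2)^-1 * W0^-1 * `|b * E - a * H| * (p2^-1 * (W0^-1 * ck)) =
   (p1^-1 * (p1 * p2)^-1 * W0^-1 * p2^-1 * W0^-1) * (`|b * E - a * H| * ck) by ring.
have -> : K * ((p1 * p2)^-1 * (W0^-1 * E)) ^+ 2 =
   (p1^-1 * (p1 * p2)^-1 * W0^-1 * p2^-1 * W0^-1) * (K * E ^+ 2).
  have n1 : p1 != 0 by rewrite gt_eqF.
  have n2 : p2 != 0 by rewrite gt_eqF.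
  have n3 : W0 != 0 by rewrite gt_eqF// expR_gt0.
  by field; rewrite n1 n2 n3.
by rewrite ler_pM2l.
Qed.

End ResidueClass.

(** * Logarithmic costs, local Doeblin sets and tail bounds *)

Section Logarithms.
Context {R : realType}.
Implicit Types (x : \bar R) (v : R).

Lemma lnm_ge0 x : 0 <= lnm x. Proof. by rewrite /lnm le_max lexx orbT. Qed.

Lemma lnp_ge0 x : 0 <= lnp x. Proof. by rewrite /lnp le_max lexx orbT. Qed.

Lemma lnm_le x v : lnm x <= v%:E -> (expR (- v))%:E <= x.
Proof.
rewrite /lnm ge_max => /andP[+ _]; case: x => [r| |]//=; last by rewrite leey.
case: ifPn => [//|]; rewrite -ltNge => r0.
rewrite -EFinN !lee_fin => h; rewrite -[leRHS]lnK ?posrE// ler_expR; lra.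
Qed.

Lemma lnp_le x v : lnp x <= v%:E -> x <= (expR v)%:E.
Proof.
rewrite /lnp ge_max => /andP[+ _]; case: x => [r| |]//=; last by move=> _; exact: leNye.
case: ifPn => [r0 _|]; first by rewrite lee_fin (le_trans r0)// expR_ge0.
by rewrite -ltNge => r0; rewrite !lee_fin => h; rewrite -[leLHS]lnK ?posrE// ler_expR.
Qed.

End Logarithms.

Section Doeblin.
Context {R : realType} {dX dY : measure_display} {X : measurableType dX}
  {Y : measurableType dY} (Q : R.-pker X ~> X) (g : X -> Y -> R).
Hypothesis g_pos : forall x y, (0 < g x y)%R.
Hypothesis g_meas : measurable_fun [set: X * Y] (fun p => g p.1 p.2).

(** The set-wise inequalities extend to nonnegative functions, and the upper
    constant is absorbed in phi. *)
Lemma doeblin_minorized r (C : set X) (em ep : r.-tuple Y -> R)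
    (mu : r.-tuple Y -> probability X R) (phi : r.-tuple Y -> X -> R)
    (z : r.-tuple Y) (kappa : R) :
  local_doeblin_with Q g C em ep mu phi -> bdd_seq g z ->
  (0 <= kappa)%R -> (kappa <= em z / ep z)%R -> minorized C kappa (likelihood Q g z).
Proof.
move=> [mC LD] bz k0 kem; have [em0 ep0 phi0 muC H] := LD z.
exists (mean (mu z)), (fun x => ep z * phi z x)%R; split.
- by apply: posfun_mean; exact: probability_setT.
- by move=> x; rewrite mulr_ge0// ltW.
move=> f x bf f0 Cx.
have mIC : measurable_fun [set: X] (\1_C : X -> R) by exact: measurable_indic.
have IC0 y : (0 <= \1_C y :> R)%R by rewrite indicE.
have dL := daniell_weight mIC IC0 (daniell_elikelihood Q g_pos g_meas z x).
have dmu : daniell (fun F => \int[mu z]_y F y).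
  by apply: daniell_mixture => [y|F []//]; exact: daniell_eval.
have em0' : (0 <= em z * phi z x)%R by rewrite mulr_ge0// ltW.
have ep0' : (0 <= ep z * phi z x)%R by rewrite mulr_ge0// ltW.
have LI A : elikelihood Q g z (fun y => (\1_A y)%:E * (\1_C y)%:E) x = Lker Q g z x (A `&` C).
  rewrite LkerE; congr (elikelihood _ _ _ _ _); apply/funext => y.
  by rewrite indicI/= EFinM.
have muI A : measurable A -> \int[mu z]_y (\1_A y)%:E = mu z A.
  by move=> mA; rewrite integral_indic// setIT.
have nf : nonneg_meas (EFin \o f).
  by case: bf => mf _; apply: nonneg_meas_EFin.
have Lf : elikelihood Q g z (fun y => (EFin \o f) y * (\1_C y)%:E) x =
    (likelihood Q g z (fun y => \1_C y * f y)%R x)%:E.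
  rewrite -elikelihoodE//; last by move=> y; rewrite mulr_ge0.
    by congr (elikelihood _ _ _ _ _); apply/funext => y /=; rewrite -EFinM mulrC.
  by apply: bounded_measM => //; exact: bounded_meas_indic.
have If : \int[mu z]_y (EFin \o f) y = (mean (mu z) f)%:E.
  by rewrite -meanE//; exact: probability_setT.
have pf0 : (0 <= mean (mu z) f)%R.
  by apply: (posfun_ge0 (posfun_mean _)) => //; exact: probability_setT.
have lo := @daniell_le_indic _ _ _ _ _ (daniell_scale em0' dmu) dL _ _ nf.
have hi := @daniell_le_indic _ _ _ _ _ dL (daniell_scale ep0' dmu) _ _ nf.
move: lo hi; rewrite Lf If -!EFinM !lee_fin => lo hi.
apply/andP; split.
  apply: (le_trans _ (lo _)).
    rewrite !mulrA ler_wpM2r// ler_wpM2r ?(ltW (phi0 x))//.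
    by move: kem; rewrite ler_pdivlMr.
  move=> A mA; rewrite LI muI// EFinM.
  by have /andP[] := H A x mA Cx.
apply: hi => A mA; rewrite LI muI// EFinM.
by have /andP[] := H A x mA Cx.
Qed.

End Doeblin.

Section Integrability.
Context {R : realType} {d : measure_display} {Omega : measurableType d}
  (P : probability Omega R).

Lemma fine_integrable (F : Omega -> \bar R) : nonneg_meas F -> \int[P]_w F w < +oo ->
  P.-integrable [set: Omega] (fun w => (fine (F w))%:E).
Proof.
move=> [mF F0] FI; apply/integrableP; split.
  by apply/measurable_EFinP; apply: measurableT_comp => //; exact: fine_measurable.
apply: le_lt_trans FI; apply: ge0_le_integral => //.
- apply: measurableT_comp => //; apply/measurable_EFinP.
  by apply: measurableT_comp => //; exact: fine_measurable.
- move=> w _; have := F0 w; case: (F w) => [r| |]//= r0; last by rewrite normr0 leey.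
  by rewrite lee_fin ger0_norm.
Qed.

Lemma nonneg_meas_infty_null (F : Omega -> \bar R) : nonneg_meas F -> \int[P]_w F w < +oo ->
  P (F @^-1` [set +oo]) = 0.
Proof.
move=> [mF F0] FI.
have iF : P.-integrable [set: Omega] F.
  apply/integrableP; split => //; apply: le_lt_trans FI.
  by apply: ge0_le_integral => //; [exact: measurableT_comp|move=> w _; rewrite gee0_abs].
have [N [mN N0 sub]] := integrable_ae measurableT iF.
apply/eqP; rewrite eq_le measure_ge0 andbT -N0; apply: le_measure; rewrite ?inE//.
  by rewrite -[X in measurable X]setTI; apply: mF => //; exact: emeasurable_set1.
by move=> w Fw; apply: sub => /= /(_ I); rewrite Fw.
Qed.

Lemma markov_tight (F : Omega -> \bar R) (eps : R) : nonneg_meas F -> \int[P]_w F w < +oo ->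
  (0 < eps)%R -> exists2 c : R, (0 <= c)%R & P [set w | c%:E < F w] <= eps%:E.
Proof.
move=> nF FI e0; have [mF F0] := nF.
have I0 : 0 <= \int[P]_w F w by exact: integral_ge0.
pose I1 := fine (\int[P]_w F w).
have IE : \int[P]_w F w = I1%:E by rewrite fineK// ge0_fin_numE.
have I10 : (0 <= I1)%R by exact: fine_ge0.
exists (I1 / eps + 1)%R; first by rewrite addr_ge0// divr_ge0// ltW.
set c := (I1 / eps + 1)%R.
have c0 : (0 < c)%R by rewrite ltr_wpDl// divr_ge0// ltW.
have mA : measurable [set w | c%:E < F w].
  by rewrite -[X in measurable X]setTI; apply: measurable_lte => //; exact: measurable_cst.
set A := [set w | c%:E < F w] in mA *.
have : c%:E * P A <= I1%:E.
  have mI : measurable_fun [set: Omega] (fun w => (\1_A w)%:E : \bar R).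
    by apply/measurable_EFinP; exact: measurable_indic.
  have I_ge0 w : [set: Omega] w -> 0 <= (\1_A w)%:E :> \bar R.
    by move=> _; rewrite lee_fin indicE.
  rewrite -IE -[X in c%:E * P X]setIT -integral_indic//.
  rewrite -(ge0_integralZl P measurableT mI I_ge0); last by rewrite lee_fin ltW.
  apply: ge0_le_integral => //.
  - by move=> w _; rewrite -EFinM lee_fin mulr_ge0 ?(ltW c0)// indicE.
  - exact: emeasurable_funM.
  - move=> w _; rewrite indicE; have [wA|wA] := boolP (w \in A); last by rewrite mule0.
    by rewrite mule1 ltW//; exact: set_mem wA.
rewrite muleC -lee_pdivlMr// => /le_trans; apply.
rewrite lee_fin ler_pdivrMr// /c mulrDr mulr1 mulrCA divff ?mulr1 ?gt_eqF//.
by rewrite lerDl ltW.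
Qed.

End Integrability.

(** * Window averages of blocks of observations *)

Section MeasurableLogarithm.
Context {R : realType} {d : measure_display} {T : measurableType d}.

Lemma measurable_lne (F : T -> \bar R) : measurable_fun [set: T] F ->
  measurable_fun [set: T] (fun x => lne (F x)).
Proof.
move=> mF.
rewrite (_ : (fun x => _) = (fun x => if F x <= 0 then -oo else
    if F x == +oo then +oo else (ln (fine (F x)))%:E)).
  apply: measurable_fun_ifT => //; first by apply: measurable_fun_lee.
  apply: measurable_fun_ifT => //; first by apply: measurable_fun_eqe.
  apply/measurable_EFinP.
  apply: (@measurableT_comp _ _ _ _ _ _ (@ln R) _ (fun x => fine (F x))).
    exact: measurable_ln.
  by apply: measurableT_comp => //; exact: fine_measurable.
by apply/funext => x; case: (F x) => [r| |]; rewrite ?lee_fin ?leNye ?leye_eq.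
Qed.

Lemma nonneg_meas_lnm (F : T -> \bar R) : measurable_fun [set: T] F -> nonneg_meas (fun x => lnm (F x)).
Proof.
move=> mF; split=> [|x]; last exact: lnm_ge0.
apply: measurable_maxe; last exact: measurable_cst.
by apply: measurableT_comp => //; exact: measurable_lne.
Qed.

End MeasurableLogarithm.

Lemma probability_integral_cst (R : realType) d (T : measurableType d)
  (P : probability T R) (a : R) : \int[P]_w a%:E = a%:E.
Proof.
rewrite integral_cst// -[RHS]mule1; congr (_ * _); exact: probability_setT.
Qed.

Section ErgodicWindows.
Context {R : realType} {dO dT : measure_display} {Omega : measurableType dO}
  {T : measurableType dT} (P : probability Omega R) (Y : int -> {RV P >-> T}) (r : nat).
Hypothesis sY : stationary_process P Y.
Hypothesis eZ : ergodic_process P (blocks Y r 0).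

Lemma stationary_integral (F : T -> \bar R) (k : nat) : nonneg_meas F ->
  \int[P]_w F (Y k%:Z w) = \int[P]_w F (Y 0%R w).
Proof.
move=> [mF F0].
have I j : \int[P]_w F (Y j w) = \int[pushforward P (Y j)]_y F y.
  by rewrite ge0_integral_pushforward.
rewrite !I; apply: eq_measure_integral => A mA _; rewrite /= /pushforward.
have mA' : path_measurable [set u : int -> T | A (u 0%R)].
  have mc : measurable_fun [set: @path_space _ T] (fun u : @path_space _ T => u 0%R).
    exact: measurable_coord.
  by have := mc measurableT A mA; rewrite setTI.
by rewrite -[RHS](stationary_shift sY k mA'); congr (P _).
Qed.

Lemma stationary_block_null (F : r.-tuple T -> \bar R) (k : nat) :
  measurable_fun [set: r.-tuple T] F ->
  P [set w | F (block Y k%:Z r w) = +oo] = P [set w | F (block Y 0%R r w) = +oo].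
Proof.
move=> mF; pose A := [set u : int -> r.-tuple T | F (u 0%R) = +oo].
have mA : path_measurable A.
  have mc : measurable_fun [set: @path_space _ (r.-tuple T)]
      (fun u : @path_space _ (r.-tuple T) => F (u 0%R)).
    by apply: measurableT_comp => //; exact: measurable_coord.
  by have := mc measurableT _ (emeasurable_set1 +oo); rewrite setTI.
have := blocks_law sY k mA.
rewrite /trajectory /blocks /A /preimage /= .
by under eq_set do rewrite mul0r addr0; under [in RHS]eq_set do rewrite mul0r addr0.
Qed.

(** A window sum is a difference of two sums over initial segments of blocks;
    the longer one is bounded above by applying [excess_tight] to
    f - E f - kappa, the shorter one below by applying it to E f - f - kappa.
    The constant C serves all t because the law of the blocks counted from t does
    not depend on t. *)
Lemma ergodic_windows (f : r.-tuple T -> R) (kappa delta : R) :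
  measurable_fun [set: r.-tuple T] f ->
  P.-integrable [set: Omega] (fun w => (f (blocks Y r 0 0%R w))%:E) ->
  (0 < kappa)%R -> (0 < delta)%R ->
  exists (C : nat) (E : nat -> set Omega),
    [/\ forall t, measurable (E t), forall t, P (E t) <= (delta + delta)%:E &
     forall t w, ~ E t w -> forall lo m,
      (window_sum (fun j => f (blocks Y r t (- (j : nat)%:Z)%R w)) lo m <=
       fine (\int[P]_w (f (blocks Y r 0 0%R w))%:E)%E * m%:R
        + 2 * kappa * (lo + m)%:R + C%:R)%R].
Proof.
move=> mf intf k0 d0.
set mean := fine _.
have meanE : \int[P]_w (f (blocks Y r 0 0%R w))%:E = mean%:E.
  by rewrite fineK//; exact: (integrable_fin_num measurableT intf).
have mZ n : measurable_fun [set: Omega] (blocks Y r 0 n) by exact: measurable_block.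
have sZ : stationary_process P (blocks Y r 0) by exact: stationary_blocks.
have cst_int (a : R) : P.-integrable [set: Omega] (fun=> a%:E).
  exact: finite_measure_integrable_cst.
have key (s : R) : P.-integrable [set: Omega]
    (fun w => (s * f (blocks Y r 0 0%R w) - (s * mean + kappa))%:E) /\
   \int[P]_w (s * f (blocks Y r 0 0%R w) - (s * mean + kappa))%:E < 0.
  have is_ : P.-integrable [set: Omega] (fun w => s%:E * (f (blocks Y r 0 0%R w))%:E).
    exact: integrableZl.
  under eq_fun do rewrite EFinB EFinM.
  split; first exact: integrableB.
  rewrite integralB// integralZl// meanE probability_integral_cst.
  by rewrite -EFinM -EFinB lte_fin; lra.
pose f1 z := (1 * f z - (1 * mean + kappa))%R.
pose f2 z := (-1 * f z - (-1 * mean + kappa))%R.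
have mlin s : measurable_fun [set: r.-tuple T] (fun z => s * f z - (s * mean + kappa))%R.
  by apply: measurable_funB => //; exact: measurable_funM.
have [C1 [mE1 P1]] := excess_tight mZ sZ eZ (mlin 1%R) (key 1%R).1 (key 1%R).2 d0.
have [C2 [mE2 P2]] := excess_tight mZ sZ eZ (mlin (-1)%R) (key (-1)%R).1 (key (-1)%R).2 d0.
pose E t := (trajectory (blocks Y r t) @^-1` excess f1 C1) `|`
            (trajectory (blocks Y r t) @^-1` excess f2 C2).
have mtr t A : path_measurable A -> measurable (trajectory (blocks Y r t) @^-1` A).
  move=> mA.
  have mZt n : measurable_fun [set: Omega] (blocks Y r t n) by exact: measurable_block.
  by have := measurable_trajectory mZt measurableT mA; rewrite setTI.
exists (C1 + C2)%N, E; split.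
- by move=> t; apply: measurableU; exact: mtr.
- move=> t; apply: (le_trans (measureU2 _ _ _)); [exact: mtr|exact: mtr|].
  rewrite EFinD; apply: leeD.
    by apply: le_trans P1; rewrite le_eqVlt; apply/orP; left; apply/eqP; exact: (blocks_law sY t mE1).
  by apply: le_trans P2; rewrite le_eqVlt; apply/orP; left; apply/eqP; exact: (blocks_law sY t mE2).
move=> t w nE lo m; rewrite natrD.
pose F (j : nat) := f (blocks Y r t (- j%:Z)%R w).
have S1 k : (\sum_(j < k) F j <= (mean + kappa) * k%:R + C1%:R)%R.
  apply: contrapT => /negP; rewrite -ltNge => H; apply: nE; left; exists k.
  rewrite /f1 /trajectory -/(F _).
  under eq_bigr do rewrite !mul1r.
  by rewrite sumrB sumr_const card_ord -[X in (_ - X)%R]mulr_natr; move: H; rewrite /F; lra.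
have S2 k : (mean * k%:R - kappa * k%:R - C2%:R <= \sum_(j < k) F j)%R.
  apply: contrapT => /negP; rewrite -ltNge => H; apply: nE; right; exists k.
  rewrite /f2 /trajectory -/(F _).
  rewrite sumrB -mulr_sumr sumr_const card_ord -[X in (_ - X)%R]mulr_natr; move: H; rewrite /F; lra.
have split_ : (\sum_(j < lo + m) F j = \sum_(j < lo) F j + window_sum F lo m)%R.
  by rewrite /window_sum big_split_ord.
have := S1 (lo + m)%N; have := S2 lo; rewrite split_ natrD.
have : (0 <= kappa * m%:R)%R by rewrite mulr_ge0// ltW.
rewrite -/F; lra.
Qed.

End ErgodicWindows.

(** * Summation over the time indices *)

Section Pathwise.
Local Open Scope ring_scope.
Context {R : realType} {dX dY : measure_display} {X : measurableType dX}
  {Y : measurableType dY} (Q : R.-pker X ~> X) (g : X -> Y -> R).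
Hypothesis g_pos : forall x y, 0 < g x y.
Hypothesis g_meas : measurable_fun [set: X * Y] (fun p => g p.1 p.2).
Variables (chi : probability X R) (h : X -> R) (Bh : R).
Hypotheses (bh : bounded_meas h) (hB : forall x, `|h x| <= Bh).
Variables (C D : set X) (M kappa C0 w : R) (q j0 : nat).
Hypotheses (mC : measurable C) (mD : measurable D).
Hypotheses (M0 : 0 <= M) (C00 : 0 <= C0) (kappa01 : 0 < kappa < 1) (q0 : (0 < q)%N).
Hypotheses (w01 : 0 < w <= 1) (rhow : 1 - kappa ^+ 2 <= expR (- (64 * w)))
  (qw : 4 * (M + 1) <= w * q%:R).
Hypothesis j08 : 200 * (C0 + 2) <= j0%:R.
Hypothesis j0e : expR (- j0%:R) <= (1 - (1 - kappa ^+ 2)) / 4.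

Variables (lg : Y -> R) (obs : nat -> Y).
Hypothesis hlg : forall i x, g x (obs i) <= expR (lg (obs i)).

Variables (r n : nat) (good_block : nat -> nat -> bool) (v : nat -> nat -> R).
Hypothesis r0 : (0 < r)%N.
Let tau := expR (- (64 * (M + 1))).
Let blk t j := segment obs (t - j * r) r.

Hypothesis kfN : forall t j, good_block t j -> (0 < j <= t %/ r)%N.
Hypothesis KC : forall t j x, good_block t j -> ~ C x ->
  likelihood Q g (blk t j) (fun=> 1) x <= tau ^+ 2 * expR (sumlg lg (blk t j)).
Hypothesis Km : forall t j, good_block t j -> minorized C kappa (likelihood Q g (blk t j)).
Hypothesis v0 : forall t j, 0 <= v t j.
Hypothesis hV : forall t j x, (j <= t %/ r)%N -> D x ->
  expR (- v t j) * expR (sumlg lg (blk t j)) <= likelihood Q g (blk t j) \1_D x.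
Hypothesis start : forall l, (l < r)%N ->
  expR (- C0) * expR (sumlg lg (segment obs 0 l)) <= init_likelihood Q g chi (segment obs 0 l) \1_D.
Hypothesis hv : forall t lo m, (t <= n < t + r)%N -> (lo + m <= (t %/ r).+1)%N ->
  window_sum (v t) lo m <= M * m%:R + (lo + m)%:R / (200 * q%:R) + C0.
Hypothesis hn : forall t lo m, (t <= n < t + r)%N -> (lo + m <= (t %/ r).+1)%N ->
  (bad_count (good_block t) lo m)%:R <= m%:R / 3 + (lo + m)%:R / (200 * q%:R) + C0.

Let gn := g ^~ (obs n).

Definition coupling_constant : R :=
  (4 * Bh * expR (2 * (M + 1) * (q * j0)%:R + 2 * C0) + 2 * Bh) * expR (w * (q * j0)%:R).

Lemma geometric_sum_le (z : R) m : 0 <= z < 1 -> \sum_(k < m) z ^+ k <= (1 - z)^-1.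
Proof.
move=> /andP[z0 z1]; have z1' : 0 < 1 - z by rewrite subr_gt0.
rewrite -[leRHS]mul1r ler_pdivlMr// mulrC -[X in X * _]opprB mulNr -subrX1 opprB.
by rewrite gerBl exprn_ge0.
Qed.

(** Each k is treated in the residue class of n - k, with (n - k) %/ r + 1 blocks,
    at least (n - k) / r of them, so the squares of the bounds are dominated by a
    geometric sequence of ratio exp (- 2 w / r). *)
Lemma pathwise_variance_bound :
  (`|filter_variance Q g chi (segment obs 0 n) (obs n) h| <=
    (coupling_constant ^+ 2 / (1 - expR (- (2 * w / r%:R))))%:E)%E.
Proof.
have szn : size (segment obs 0 n) = n by rewrite size_map size_iota.
have /andP[w0 _] := w01.
have rr0 : 0 < r%:R :> R by rewrite ltr0n.
pose U k := coupling_constant * expR (- (w * ((n - k) %/ r).+1%:R)).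
have bs : bdd_seq g (segment obs 0 n) by apply: bdd_segment; exact: hlg.
have bo : bdd_obs g (obs n) by exists (expR (lg (obs n))); exact: hlg.
have HU k x : (k <= size (segment obs 0 n))%N ->
   `|likelihood Q g (drop k (segment obs 0 n)) (fun x => g x (obs n) * h x) x *
       init_likelihood Q g chi (segment obs 0 n) gn -
     likelihood Q g (drop k (segment obs 0 n)) gn x *
       init_likelihood Q g chi (segment obs 0 n) (fun x => g x (obs n) * h x)| *
   init_likelihood Q g chi (take k (segment obs 0 n)) (fun=> 1) <=
   U k * init_likelihood Q g chi (segment obs 0 n) gn ^+ 2.
  rewrite szn => kn.
  pose c := ((n - k) %% r)%N.
  have cr : (c < r)%N by rewrite ltn_mod.
  have nk : (n - k = (n - k) %/ r * r + c)%N by exact: divn_eq.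
  have cn : (c <= n)%N.
    exact: leq_trans (leq_mod _ _) (leq_subr k n).
  have tk : (n - c = k + (n - k) %/ r * r)%N.
    by move: nk kn; move: (_ * r)%N; clear; lia.
  have tn : (n - c <= n < n - c + r)%N.
    by move: cr cn; clear; move: c => c; lia.
  have E1 : segment obs 0 n = segment obs 0 k ++ segment obs k (n - k).
    by rewrite -[in LHS](subnKC kn) segment_cat.
  have szk : size (segment obs 0 k) = k by rewrite size_map size_iota.
  have -> : take k (segment obs 0 n) = segment obs 0 k.
    by rewrite E1 -{1}szk take_size_cat.
  have -> : drop k (segment obs 0 n) = segment obs k (n - k).
    by rewrite E1 -{1}szk drop_size_cat.
  apply: (@residue_bound R dX dY X Y Q g g_pos g_meas chi h Bh bh hB C D M kappa C0 w
    q j0 mC mD M0 C00 kappa01 q0 w01 rhow qw j08 j0e lg obs hlg r n c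
    (good_block (n - c)) (v (n - c)) cr cn) => //.
  - by move=> j /kfN.
  - by move=> j; exact: KC.
  - by move=> j; exact: Km.
  - by move=> j x'; exact: hV.
  - by apply: start; rewrite ltn_mod.
  - by move=> lo m; exact: hv.
  - by move=> lo m; exact: hn.
have fv := @filter_variance_le _ _ _ _ _ Q g g_pos g_meas chi _ _ h U bs bo bh HU.
apply: (le_trans fv).
rewrite szn lee_fin; set z := expR (- (2 * w / r%:R)).
have z01 : 0 <= z < 1.
  by rewrite expR_ge0 -expR0 ltr_expR oppr_lt0 divr_gt0// mulr_gt0.
have step (k : 'I_n.+1) : U k ^+ 2 <= coupling_constant ^+ 2 * z ^+ (n - k).
  rewrite /U exprMn ler_wpM2l ?sqr_ge0// /z -!expRM_natl ler_expR.
  rewrite !mulrN lerN2.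
  have /ltnW := ltn_ceil (n - k) r0; rewrite -(ler_nat R) natrM => H.
  have -> : (n - k)%:R * (2 * w / r%:R) = 2 * (w * ((n - k)%:R / r%:R)) :> R by ring.
  by rewrite ler_pM2l// ler_pM2l// ler_pdivrMr.
apply: (le_trans (ler_sum _ (fun k _ => step k))).
rewrite -mulr_sumr ler_wpM2l ?sqr_ge0//.
apply: le_trans (geometric_sum_le n.+1 z01); rewrite le_eqVlt; apply/orP; left; apply/eqP.
rewrite [RHS](reindex_inj rev_ord_inj)/=; apply: eq_bigr => k _.
by rewrite subSS.
Qed.

End Pathwise.

(** * Trajectories with controlled costs *)

Section GoodTrajectory.
Local Open Scope ring_scope.
Context {R : realType} {dX dY dO : measure_display} {X : measurableType dX}
  {Y : measurableType dY} {Omega : measurableType dO} (Q : R.-pker X ~> X) (g : X -> Y -> R).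
Hypothesis g_pos : forall x y, 0 < g x y.
Hypothesis g_meas : measurable_fun [set: X * Y] (fun p => g p.1 p.2).

Definition log_density (y : Y) : \bar R := lnp (supnorm (fun x => (g x y)%:E)).
Definition log_sup (y : Y) : R := fine (log_density y).

Lemma log_sup_ge0 y : 0 <= log_sup y.
Proof. by apply: fine_ge0; exact: lnp_ge0. Qed.

Lemma density_le y x : log_density y <> +oo%E -> g x y <= expR (log_sup y).
Proof.
move=> fin; rewrite -lee_fin.
have : (log_density y <= (log_sup y)%:E)%E.
  by rewrite /log_sup fineK// ge0_fin_numE ?lnp_ge0// ltey; exact/eqP.
move/lnp_le; apply: le_trans; apply: (@le_trans _ _ `|(g x y)%:E|%E).
  by rewrite lee_fin ler_norm.
by apply: ereal_sup_ubound; exists x.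
Qed.

Variables (r : nat) (D : set X).

Definition log_return (z : r.-tuple Y) : \bar R :=
  lnm (ereal_inf [set Lker Q g z x D | x in D]).
(** The logarithmic cost of a return to D, relative to the largest likelihood of
    the block. *)
Definition return_cost (z : r.-tuple Y) : R := fine (log_return z) + sumlg log_sup z.

Lemma return_cost_ge0 z : 0 <= return_cost z.
Proof.
apply: addr_ge0; first by apply: fine_ge0; exact: lnm_ge0.
by apply: sumr_ge0 => y _; exact: log_sup_ge0.
Qed.

Lemma return_costP (z : r.-tuple Y) x : measurable D -> bdd_seq g z -> log_return z <> +oo%E -> D x ->
  expR (- return_cost z) * expR (sumlg log_sup z) <= likelihood Q g z \1_D x.
Proof.
move=> mD bz fin Dx; rewrite -expRD /return_cost opprD addrNK -lee_fin.
rewrite -Lker_likelihood//.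
have : (log_return z <= (fine (log_return z))%:E)%E.
  by rewrite fineK// ge0_fin_numE ?lnm_ge0// ltey; exact/eqP.
move/lnm_le/le_trans; apply; apply: ereal_inf_lbound; by exists x.
Qed.

Lemma likelihood_le_log_sup (z : seq Y) x :
  (forall y, List.In y z -> forall x', g x' y <= expR (log_sup y)) ->
  likelihood Q g z (fun=> 1) x <= expR (sumlg log_sup z).
Proof.
move=> H; rewrite -[leRHS]mulr1; apply: (likelihood_le Q g_pos g_meas) => //.
  exact: bounded_meas_cst.
by move=> y; rewrite ler01 lexx.
Qed.

Variables (chi : probability X R) (h : X -> R) (Bh : R).
Hypotheses (bh : bounded_meas h) (hB : forall x, `|h x| <= Bh).
Variables (C : set X) (M kappa C0 w : R) (q j0 : nat).
Hypotheses (mD : measurable D).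
Hypotheses (M0 : 0 <= M) (C00 : 0 <= C0) (kappa01 : 0 < kappa < 1) (q0 : (0 < q)%N).
Hypotheses (w01 : 0 < w <= 1) (rhow : 1 - kappa ^+ 2 <= expR (- (64 * w)))
  (qw : 4 * (M + 1) <= w * q%:R).
Hypothesis j08 : 200 * (C0 + 2) <= j0%:R.
Hypothesis j0e : expR (- j0%:R) <= (1 - (1 - kappa ^+ 2)) / 4.
Hypothesis r0 : (0 < r)%N.
Variables (K : set (r.-tuple Y)) (em ep : r.-tuple Y -> R)
  (mu : r.-tuple Y -> probability X R) (phi : r.-tuple Y -> X -> R).
Hypothesis doeblin : local_doeblin_with Q g C em ep mu phi.
Hypothesis doeblin_ratio : forall z, K z -> kappa <= em z / ep z.
Let tau := expR (- (64 * (M + 1))).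
Hypothesis outside : forall z, K z ->
  (ereal_sup [set Lker Q g z x [set: X] | x in ~` C]
    <= (tau ^+ 2)%:E * supnorm (fun x => Lker Q g z x [set: X]))%E.

Variables (P : probability Omega R) (Yn : int -> {RV P >-> Y}) (om : Omega) (n : nat).
Hypothesis fin_lg : forall k : nat, log_density (Yn k%:Z om) <> +oo%E.
Hypothesis fin_ret : forall k : nat, log_return (block Yn k%:Z r om) <> +oo%E.
Hypothesis start : forall l, (l < r)%N ->
  (lnm (\int[chi]_x Lker Q g (block Yn 0 l om) x D) +
    \sum_(i < l) log_density (Yn i%:Z om) <= C0%:E)%E.
Variables (C1 pK : R).
Hypotheses (C1C0 : C1 + 1 <= C0) (pK3 : pK <= 1 / 3).
Hypothesis windows_cost : forall t lo m, (t <= n < t + r)%N ->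
  window_sum (fun j => return_cost (blocks Yn r t (- (j : nat)%:Z) om)) lo m <=
    M * m%:R + (lo + m)%:R / (200 * q%:R) + C1.
Hypothesis windows_bad : forall t lo m, (t <= n < t + r)%N ->
  window_sum (fun j => \1_(~` K) (blocks Yn r t (- (j : nat)%:Z) om)) lo m <=
    pK * m%:R + (lo + m)%:R / (200 * q%:R) + C1.

(** The hypotheses of [pathwise_variance_bound] hold along om: C0 bounds both the
    initial cost and the constants of the windows, one unit being kept for the
    incomplete block. *)
Lemma good_trajectory_bound :
  (`|filter_variance Q g chi (block Yn 0%R n om) (Yn n%:Z om) h| <=
    (coupling_constant Bh M C0 w q j0 ^+ 2 / (1 - expR (- (2 * w / r%:R))))%:E)%E.
Proof.
pose obs (i : nat) := Yn i%:Z om.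
have hlg i x : g x (obs i) <= expR (log_sup (obs i)) by apply: density_le; exact: fin_lg.
have segE k m : tval (block Yn k%:Z m om) = segment obs k m.
  apply: (@eq_from_nth _ (obs 0%N)); first by rewrite size_tuple size_map size_iota.
  move=> i; rewrite size_tuple => im.
  rewrite -[i]/(nat_of_ord (Ordinal im)) -tnth_nth tnth_mktuple.
  by rewrite (nth_map 0%N) ?size_iota// nth_iota//.
have blkE t j : (j * r <= t)%N -> blocks Yn r t (- j%:Z) om = block Yn (t - j * r)%N%:Z r om.
  move=> jt; rewrite /blocks; congr (block Yn _ r om).
  by rewrite -subzn// PoszM mulNr.
pose good_block t j := (0 < j <= t %/ r)%N && `[< K (blocks Yn r t (- (j : nat)%:Z) om) >].
have jr t j : (j <= t %/ r)%N -> (j * r <= t)%N.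
  by move=> jt; rewrite -leq_divRL.
have zE t j : (j <= t %/ r)%N -> tval (blocks Yn r t (- j%:Z) om) = segment obs (t - j * r) r.
  by move=> jt; rewrite blkE ?jr// segE.
have bds k m : bdd_seq g (segment obs k m) by apply: bdd_segment; exact: hlg.
have fv := @pathwise_variance_bound R dX dY X Y Q g g_pos g_meas chi h Bh bh hB C D M kappa
  C0 w q j0 doeblin.1 mD M0 C00 kappa01 q0 w01 rhow qw j08 j0e log_sup obs hlg
  r n good_block (fun t j => return_cost (blocks Yn r t (- (j : nat)%:Z) om)) r0.
have -> : tval (block Yn 0%R n om) = segment obs 0 n by exact: segE.
apply: fv.
- by move=> t j /andP[].
- move=> t j x /andP[/andP[_ jt] /asboolP Kz] nC.
  rewrite -zE//; set z := blocks _ _ _ _ _ in Kz *.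
  have bz : bdd_seq g z by rewrite /z zE.
  have Lle x' : likelihood Q g z (fun=> 1) x' <= expR (sumlg log_sup z).
    apply: likelihood_le_log_sup => y; rewrite /z zE// => yin x''.
    exact: (segment_dom hlg yin).
  rewrite -lee_fin -Lker_likelihood1//.
  apply: (@le_trans _ _ (ereal_sup [set Lker Q g z x [set: X] | x in ~` C])).
    by apply: ereal_sup_ubound; exists x.
  apply: (le_trans (outside Kz)); rewrite [leRHS]EFinM; apply: lee_pmul => //.
  - by rewrite lee_fin sqr_ge0.
  - apply: (@le_trans _ _ `|Lker Q g z x [set: X]|%E) => //.
    by apply: ereal_sup_ubound; exists x.
  - apply: ge_ereal_sup => _ [x' _ <-]; rewrite Lker_likelihood1// abse_EFin lee_fin ger0_norm//.
    apply: (posfun_ge0 ((posop_likelihood Q g_pos g_meas bz).1 x')) => //.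
    exact: bounded_meas_cst.
- move=> t j /andP[/andP[_ jt] /asboolP Kz].
  rewrite -zE//; apply: (doeblin_minorized g_pos g_meas doeblin).
  + by rewrite zE.
  + by case/andP: kappa01 => /ltW.
  + exact: doeblin_ratio.
- by move=> t j; exact: return_cost_ge0.
- move=> t j x jt Dx; rewrite -zE//; apply: return_costP => //.
    by rewrite zE.
  by rewrite blkE ?jr//; exact: fin_ret.
- move=> l lr; rewrite -expRD; have := start lr.
  set I := (\int[chi]_x _)%E.
  have -> : (\sum_(i < l) log_density (Yn i%:Z om))%E = (sumlg log_sup (segment obs 0 l))%:E.
    rewrite /sumlg /segment big_map -sumEFin -(subn0 l) big_mkord/= subn0.
    apply: eq_bigr => i _; rewrite /log_sup fineK// ge0_fin_numE ?lnp_ge0// ltey.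
    exact/eqP/fin_lg.
  rewrite -leeBrDr// -EFinB => /lnm_le.
  rewrite /I segE.
  have -> : (\int[chi]_x Lker Q g (segment obs 0 l) x D)%E = (init_likelihood Q g chi (segment obs 0 l) \1_D)%:E.
    rewrite /init_likelihood -meanE; [|exact: probability_setT|].
      by apply: eq_integral => x _; rewrite Lker_likelihood.
    by case: (posop_likelihood Q g_pos g_meas (bds 0%N l)) => _; apply; exact: bounded_meas_indic.
  by rewrite lee_fin opprB addrC.
- by move=> t lo m tn _; apply: le_trans (windows_cost lo m tn) _; rewrite lerD2l; move: C1C0; lra.
- move=> t lo m tn lm; have := windows_bad lo m tn.
  have : (bad_count (good_block t) lo m)%:R <=
      window_sum (fun j => \1_(~` K) (blocks Yn r t (- (j : nat)%:Z) om)) lo m + 1 :> R.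
    rewrite /bad_count /window_sum natr_sum.
    apply: (@le_trans _ _ (\sum_(i < m) (\1_(~` K) (blocks Yn r t (- ((lo + i)%N : nat)%:Z) om)
       + ((lo + i == 0)%N)%:R))).
      apply: ler_sum => i _; rewrite /good_block.
      have iN : (lo + i <= t %/ r)%N.
        by rewrite -ltnS; apply: leq_trans lm; rewrite ltn_add2l ltn_ord.
      rewrite iN andbT lt0n; case: eqP => _ /=.
        by rewrite -[leLHS]add0r lerD// indicE.
      rewrite addr0 indicE; case: asboolP => [_|nK] /=; first by rewrite ler0n.
      by rewrite mem_set.
    (* the incomplete block 0 counts as bad whatever its observations: the extra 1 *)
    rewrite big_split/= lerD2l; case: m {lm} => [|m]; first by rewrite big_ord0.
    rewrite big_ord_recl big1 ?addr0.
      by case: (_ == _).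
    by move=> i _; rewrite /= /bump /= add1n addnS.
  have : pK * m%:R <= m%:R / 3.
    by rewrite mulrC ler_wpM2l//; move: pK3; rewrite div1r.
  move: C1C0; lra.
Qed.

End GoodTrajectory.

(** * Costs with finite mean *)

Section FiniteMeans.
Context {R : realType} {d : measure_display} {T : measurableType d}.

Lemma nonneg_meas_sum I (s : seq I) (F : I -> T -> \bar R) :
  (forall i, nonneg_meas (F i)) -> nonneg_meas (fun x => \sum_(i <- s) F i x).
Proof.
move=> nF; split=> [|x]; first by apply: emeasurable_sum => i; case: (nF i).
by apply: sume_ge0 => i _; case: (nF i).
Qed.

Lemma integral_sum_lty I (s : seq I) (F : I -> T -> \bar R) (m : measure T R) :
  (forall i, nonneg_meas (F i)) -> (forall i, \int[m]_x F i x < +oo) ->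
  \int[m]_x (\sum_(i <- s) F i x) < +oo.
Proof.
move=> nF FI; rewrite ge0_integral_sum//.
- by apply: lte_sum_pinfty => i _; exact: FI.
- by move=> i; case: (nF i).
- by move=> i x _; case: (nF i).
Qed.

Lemma lee_sum_term n (a : 'I_n -> \bar R) j : (forall i, 0 <= a i) -> a j <= \sum_(i < n) a i.
Proof. by move=> a0; rewrite (bigD1 j)//= leeDl// sume_ge0. Qed.

End FiniteMeans.

Section Costs.
Context {R : realType} {dX dY dO : measure_display} {X : measurableType dX}
  {Y : measurableType dY} {Omega : measurableType dO} (Q : R.-pker X ~> X) (g : X -> Y -> R).
Hypothesis g_pos : forall x y, (0 < g x y)%R.
Hypothesis g_meas : measurable_fun [set: X * Y] (fun p => g p.1 p.2).
Variables (P : probability Omega R) (Yn : int -> {RV P >-> Y}) (r : nat) (D : set X).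
Hypothesis sY : stationary_process P Yn.
Hypothesis mLG : measurable_fun [set: Y] (log_density g).
Hypothesis iLG : \int[P]_w log_density g (Yn 0%R w) < +oo.
Hypothesis mD : measurable D.
Hypothesis mVV : measurable_fun [set: r.-tuple Y] (log_return Q g D).
Hypothesis iVV : \int[P]_w log_return Q g D (block Yn 0%R r w) < +oo.

Let nLG : nonneg_meas (log_density g).
Proof. by split=> // y; exact: lnp_ge0. Qed.

Let nLGn (k : nat) : nonneg_meas (fun w => log_density g (Yn k%:Z w)).
Proof.
split=> [|w]; last exact: lnp_ge0.
by apply: measurableT_comp => //; exact: measurable_funP.
Qed.

Let iLGn (k : nat) : \int[P]_w log_density g (Yn k%:Z w) < +oo.
Proof. by rewrite (stationary_integral sY k nLG). Qed.

Let nVVn (k : nat) : nonneg_meas (fun w => log_return Q g D (block Yn k%:Z r w)).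
Proof.
split=> [|w]; last exact: lnm_ge0.
by apply: measurableT_comp => //; exact: measurable_block.
Qed.

Lemma blocks00 : blocks Yn r 0 0%R = block Yn 0%R r.
Proof. by rewrite /blocks mul0r addr0. Qed.

Lemma measurable_return_cost :
  measurable_fun [set: r.-tuple Y] (return_cost Q g D : r.-tuple Y -> R).
Proof.
apply: measurable_funD; first by apply: measurableT_comp => //; exact: fine_measurable.
under eq_fun do rewrite /sumlg big_tuple.
apply: measurable_sum => i.
apply: (@measurableT_comp _ _ _ _ _ _ fine _ (fun z : r.-tuple Y => log_density g (tnth z i))).
  exact: fine_measurable.
by apply: measurableT_comp => //; exact: measurable_tnth.
Qed.

Lemma integrable_return_cost :
  P.-integrable [set: Omega] (fun w => (return_cost Q g D (blocks Yn r 0 0%R w))%:E).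
Proof.
rewrite (_ : (fun w => _) = (fun w => (fine (log_return Q g D (block Yn 0%R r w)))%:E
    + \sum_(i < r) (fine (log_density g (Yn (i : nat)%:Z w)))%:E)); last first.
  apply/funext => w; rewrite blocks00 /return_cost /sumlg big_tuple EFinD sumEFin.
  by under eq_bigr do rewrite tnth_mktuple add0r.
apply: integrableD => //.
  by apply: fine_integrable => //; exact: (nVVn 0).
apply: integrable_sum => // i _.
exact: fine_integrable.
Qed.

(** The null event on which some logarithmic cost, replaced by 0 by [fine],
    is infinite. *)
Definition infinite_cost : set Omega :=
  \bigcup_k ([set w | log_density g (Yn (k : nat)%:Z w) = +oo] `|`
             [set w | log_return Q g D (block Yn (k : nat)%:Z r w) = +oo]).

Let minf (F : Omega -> \bar R) : nonneg_meas F -> measurable [set w | F w = +oo].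
Proof.
move=> [mF _]; rewrite -[X in measurable X]setTI.
exact: (mF measurableT _ (emeasurable_set1 +oo)).
Qed.

Lemma measurable_infinite_cost : measurable infinite_cost.
Proof. by apply: bigcup_measurable => k _; apply: measurableU; exact: minf. Qed.

Lemma infinite_cost_null : P infinite_cost = 0.
Proof.
apply/negligibleP; first exact: measurable_infinite_cost.
apply: negligible_bigcup => k; apply: negligibleU.
  apply/negligibleP; first exact: minf.
  exact: (nonneg_meas_infty_null (nLGn k) (iLGn k)).
apply/negligibleP; first exact: minf.
exact: etrans (stationary_block_null sY k mVV) (nonneg_meas_infty_null (nVVn 0) iVV).
Qed.

Variable chi : probability X R.
Hypothesis hchi : initial_class Q g Yn D r chi.

(** The initial stretch has l < r observations, l depending on n and on the residue
    class; summing over l gives a single random variable that bounds its cost in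
    all cases. *)
Definition start_cost (w : Omega) : \bar R := \sum_(l < r)
  (lnm (\int[chi]_x Lker Q g (block Yn 0%R l w) x D) +
   \sum_(i < l) log_density g (Yn (i : nat)%:Z w)).

Lemma block_seq n w : tval (block Yn 0%R n w) =
  [seq y w | y <- [seq (Yn (i : nat)%:Z : Omega -> Y) | i <- iota 0 n]].
Proof.
rewrite -map_comp; apply: (@eq_from_nth _ (Yn 0%R w)).
  by rewrite size_tuple size_map size_iota.
move=> i; rewrite size_tuple => im.
rewrite -[i]/(nat_of_ord (Ordinal im)) -tnth_nth tnth_mktuple.
by rewrite (nth_map 0%N) ?size_iota// nth_iota//= add0r.
Qed.

Lemma measurable_obs n y :
  List.In y [seq (Yn (i : nat)%:Z : Omega -> Y) | i <- iota 0 n] -> measurable_fun [set: Omega] y.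
Proof.
elim: (iota 0 n) => //= i s IH [<-|/IH//]; exact: measurable_funP.
Qed.

Let nstart l : nonneg_meas (fun w => lnm (\int[chi]_x Lker Q g (block Yn 0%R l w) x D)).
Proof.
apply: nonneg_meas_lnm.
have nF : nonneg_meas (fun p : Omega * X => (\1_D p.2)%:E : \bar R).
  split=> [|p]; last by rewrite lee_fin indicE.
  apply/measurable_EFinP; apply: (@measurableT_comp _ _ _ _ _ _ (\1_D : X -> R) _ snd).
    exact: measurable_indic.
  exact: measurable_snd.
have [mP _] := measurable_einit_likelihood Q g_pos g_meas chi (@measurable_obs l) nF.
apply: eq_measurable_fun mP => w _; rewrite /einit_likelihood.
by apply: eq_integral => x _; rewrite LkerE block_seq.
Qed.

Let nSl (l : 'I_r) : nonneg_meas (fun w =>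
  lnm (\int[chi]_x Lker Q g (block Yn 0%R l w) x D) +
   \sum_(i < l) log_density g (Yn (i : nat)%:Z w)).
Proof. by apply: nonneg_measD => //; apply: nonneg_meas_sum => i. Qed.

Lemma nonneg_meas_start_cost : nonneg_meas start_cost.
Proof. exact: nonneg_meas_sum. Qed.

Lemma start_cost_lty : \int[P]_w start_cost w < +oo.
Proof.
apply: integral_sum_lty => // l.
have nS : nonneg_meas (fun w => \sum_(i < l) log_density g (Yn (i : nat)%:Z w)).
  exact: nonneg_meas_sum.
have [mS S0] := nS; have [m1 p1] := nstart l.
rewrite ge0_integralD//; apply: lte_add_pinfty; first by apply: hchi; exact: ltnW.
by apply: integral_sum_lty.
Qed.

Lemma start_cost_ge w l : (l < r)%N ->
  lnm (\int[chi]_x Lker Q g (block Yn 0%R l w) x D) +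
   \sum_(i < l) log_density g (Yn (i : nat)%:Z w) <= start_cost w.
Proof.
move=> lr; apply: (@lee_sum_term R r _ (Ordinal lr)) => i.
by have [_ H] := nSl i.
Qed.

End Costs.

(** * Tightness *)

Section Constants.
Context {R : realType}.

Lemma positive_infimum (T : Type) (K : set T) (u : T -> R) :
  0 < ereal_inf [set (u z)%:E | z in K] ->
  exists2 kappa : R, (0 < kappa < 1)%R & forall z, K z -> (kappa <= u z)%R.
Proof.
set I := ereal_inf _ => I0.
have Ile z : K z -> I <= (u z)%:E by move=> Kz; apply: ereal_inf_lbound; exists z.
case: I I0 Ile => [x|_|//]; last first.
  move=> Ile; exists (1 / 2)%R; first lra.
  by move=> z /Ile; rewrite leye_eq.
rewrite lte_fin => x0 Ile; exists (Num.min x (1 / 2))%R.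
  by rewrite lt_min x0 gt_min/=; apply/andP; split; [lra|apply/orP; right; lra].
by move=> z /Ile; rewrite lee_fin; apply: le_trans; rewrite ge_min lexx.
Qed.

(** Capping w by 1 keeps it below M + 1, hence below the rate given by tau. *)
Lemma contraction_rate (kappa : R) : (0 < kappa < 1)%R ->
  exists2 w : R, (0 < w <= 1)%R & (1 - kappa ^+ 2 <= expR (- (64 * w)))%R.
Proof.
move=> /andP[k0 k1].
have kk : (0 < 1 - kappa ^+ 2 < 1)%R.
  by rewrite subr_gt0 expr_lt1 ?(ltW k0)// k1 ltrBlDr ltrDl exprn_gt0.
have /andP[kk0 kk1] := kk.
have ln0 : (ln (1 - kappa ^+ 2) < 0)%R by rewrite ln_lt0.
exists (Num.min 1 (- ln (1 - kappa ^+ 2) / 64))%R.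
  by rewrite lt_min ge_min lexx andbT ltr01 divr_gt0// oppr_gt0.
rewrite -[leLHS]lnK ?posrE// ler_expR lerNr.
have : (Num.min 1 (- ln (1 - kappa ^+ 2) / 64) <= - ln (1 - kappa ^+ 2) / 64)%R.
  by rewrite ge_min lexx orbT.
lra.
Qed.

Lemma expR_small (e : R) : (0 < e)%R -> exists j0 : nat, forall j, (j0 <= j)%N -> (expR (- j%:R) <= e)%R.
Proof.
move=> e0; have := archi_boundP (normr_ge0 (ln e)); set j0 := Num.bound _ => H.
exists j0 => j; rewrite -(ler_nat R) => jj.
rewrite -[leRHS]lnK ?posrE// ler_expR.
have := ler_norm (- ln e)%R; rewrite normrN; lra.
Qed.

End Constants.

Theorem theorem11 (R : realType) (dX dY dO : measure_display)
  (X : measurableType dX) (Y : measurableType dY) (Omega : measurableType dO)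
  (hX : countably_generated X)
  (Q : R.-pker X ~> X)
  (nu : {sigma_finite_measure set Y -> \bar R})
  (g : X -> Y -> R)
  (g_pos : forall x y, (0 < g x y)%R)
  (g_meas : measurable_fun [set: X * Y] (fun p => g p.1 p.2))
  (g_int : forall x, \int[nu]_y (g x y)%:E = 1)
  (P : probability Omega R) (Yn : int -> {RV P >-> Y})
  (r : nat) (D : set X)
  (hA1 : assumption_A1 Q g Yn r D)
  (hA2 : assumption_A2 g Yn)
  (chi : probability X R) (hchi : initial_class Q g Yn D r chi)
  (h : X -> R) (h_meas : measurable_fun [set: X] h) (h_bnd : bounded_fun h) :
  forall eps : R, (0 < eps)%R ->
  exists2 a : R, (0 < a)%R &
    forall n : nat, (0 < n)%N ->
      P [set w | a%:E
                 < `|filter_variance Q g chi (block Yn 0%R n w) (Yn n%:Z w) h|]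
      <= eps%:E.
Proof.
move=> eps e0.
have [r0 sY _ [[K [mK [eZ' PK] A1ii]] [mD [mVV iVV]]]] := hA1.
have [_ [mLG iLG]] := hA2.
have eZ : ergodic_process P (blocks Yn r 0).
  rewrite (_ : blocks Yn r 0 = fun n : int => block Yn (n * r%:Z)%R r)//.
  by apply/funext => n; rewrite /blocks add0r.
have [B [_ HB]] := h_bnd.
have hB x : (`|h x| <= B + 1)%R by apply: (HB (B + 1)%R _ x I); rewrite ltrDl.
have bh : bounded_meas h by split=> //; exists (B + 1)%R.
pose cost : r.-tuple Y -> R := return_cost Q g D.
have mcost : measurable_fun [set: r.-tuple Y] cost by exact: measurable_return_cost.
have icost : P.-integrable [set: Omega] (fun w => (cost (blocks Yn r 0 0%R w))%:E).
  exact: integrable_return_cost.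
pose M := fine (\int[P]_w (cost (blocks Yn r 0 0%R w))%:E)%E.
have M0 : (0 <= M)%R.
  by apply/fine_ge0/integral_ge0 => w _; rewrite lee_fin return_cost_ge0.
have [|C [em [ep [mu [phi [doeblin outside ratio]]]]]] := A1ii (expR (- (64 * (M + 1))) ^+ 2)%R.
  by rewrite exprn_gt0// expR_gt0.
have [kappa kappa01 kappaP] := positive_infimum ratio.
have [w w01 rhow] := contraction_rate kappa01.
have /andP[w0 _] := w01.
have k20 : (0 < kappa ^+ 2)%R by rewrite exprn_gt0//; case/andP: kappa01.
have [q q0 qw] : exists2 q : nat, (0 < q)%N & (4 * (M + 1) <= w * q%:R)%R.
  have M1 : (0 < 4 * (M + 1) / w)%R by rewrite divr_gt0// mulr_gt0// ltr_wpDl.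
  have := archi_boundP (ltW M1); set q := Num.bound _ => qM; exists q.
    by rewrite -(ltr_nat R); apply: lt_trans qM.
  by rewrite (mulrC w) -ler_pdivrMr// ltW.
have qR : (0 < q%:R :> R)%R by rewrite ltr0n.
(* twice this rate is the error 1 / (200 q) allowed in the frequency bounds *)
pose rate : R := (400 * q%:R)^-1%R.
have rate0 : (0 < rate)%R by rewrite invr_gt0; apply: mulr_gt0 qR; rewrite ltr0n.
have rateE m : (2 * rate * m%:R = m%:R / (200 * q%:R))%R.
  by rewrite /rate; field; rewrite gt_eqF.
(* two families of windows at two deltas each for every residue, and the initial cost *)
pose delta : R := (eps / (4 * r%:R + 1))%R.
have rr : (0 < 4 * r%:R + 1 :> R)%R by rewrite ltr_wpDl// mulr_ge0.
have d0 : (0 < delta)%R by rewrite divr_gt0.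
have [Ca [Ea [mEa PEa windows_cost]]] := ergodic_windows sY eZ mcost icost rate0 d0.
pose bad : r.-tuple Y -> R := \1_(~` K).
have mbad : measurable_fun [set: r.-tuple Y] bad by apply: measurable_indic; exact: measurableC.
have mZ0 : measurable_fun [set: Omega] (blocks Yn r 0 0%R) by exact: measurable_block.
have mZK : measurable (blocks Yn r 0 0%R @^-1` K) by rewrite -[X in measurable X]setTI; exact: mZ0.
have badE : (fun w => (bad (blocks Yn r 0 0%R w))%:E) =
    EFin \o \1_(~` (blocks Yn r 0 0%R @^-1` K)) :> (Omega -> \bar R).
  by [].
have ibad : P.-integrable [set: Omega] (fun w => (bad (blocks Yn r 0 0%R w))%:E).
  rewrite badE; exact: (integrable_indic P (measurableC mZK)).
have [Cb [Eb [mEb PEb windows_bad]]] := ergodic_windows sY eZ mbad ibad rate0 d0.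
have pK3 : (fine (\int[P]_w (bad (blocks Yn r 0 0%R w))%:E)%E <= 1 / 3)%R.
  have -> : (\int[P]_w (bad (blocks Yn r 0 0%R w))%:E)%E = 1 - P (blocks Yn r 0 0%R @^-1` K).
    rewrite badE integral_indic//; last exact: measurableC.
    by rewrite setIT; exact: (probability_setC P mZK).
  have : (2 / 3)%:E < P (blocks Yn r 0 0%R @^-1` K).
    by move: PK; rewrite mul0r blocks00.
  have := probability_le1 P mZK.
  case: (P (blocks Yn r 0 0%R @^-1` K)) => [p| |]//.
  by rewrite lee_fin lte_fin -EFinB/=; lra.
have [c5 c50 Pc5] := markov_tight (nonneg_meas_start_cost Q g_pos g_meas Yn r mLG mD chi)
  (start_cost_lty g_pos g_meas sY mLG iLG mD hchi) d0.
pose C1 : R := (Ca%:R + Cb%:R)%R.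
have C10 : (0 <= C1)%R by rewrite addr_ge0.
pose C0 : R := (C1 + 1 + c5)%R.
have C00 : (0 <= C0)%R by rewrite !addr_ge0.
have [ja jaP] := expR_small (divr_gt0 k20 (ltr0n _ 4)).
have [j0 j08 j0e] : exists2 j0 : nat, (200 * (C0 + 2) <= j0%:R)%R &
    (expR (- j0%:R) <= (1 - (1 - kappa ^+ 2)) / 4)%R.
  have C2 : (0 <= 200 * (C0 + 2))%R by apply: mulr_ge0; [exact: ler0n|exact: addr_ge0].
  have := archi_boundP C2; set jb := Num.bound _ => H.
  exists (ja + jb)%N; first by rewrite natrD (le_trans (ltW H))// lerDr.
  by rewrite opprB addrCA subrr addr0; apply: jaP; exact: leq_addr.
pose a0 : R := (coupling_constant (B + 1) M C0 w q j0 ^+ 2 / (1 - expR (- (2 * w / r%:R))))%R.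
exists (Num.max a0 1)%R; first by rewrite lt_max ltr01 orbT.
move=> n _.
pose E := \big[setU/set0]_(c < r) (Ea (n - c)%N `|` Eb (n - c)%N) `|`
  ([set om | c5%:E < start_cost Q g Yn r D chi om] `|` infinite_cost Q g Yn r D).
have mE1 c : measurable (Ea (n - c)%N `|` Eb (n - c)%N) by apply: measurableU.
have mE2 : measurable (\big[setU/set0]_(c < r) (Ea (n - c)%N `|` Eb (n - c)%N)).
  by apply: bigsetU_measurable => c _; exact: mE1.
have mE3 : measurable [set om | c5%:E < start_cost Q g Yn r D chi om].
  rewrite -[X in measurable X]setTI; apply: measurable_lte => //.
  by have [] := nonneg_meas_start_cost Q g_pos g_meas Yn r mLG mD chi.
have mE4 : measurable (infinite_cost Q g Yn r D) by exact: measurable_infinite_cost.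
have mF : measurable [set om | (Num.max a0 1)%:E <
    `|filter_variance Q g chi (block Yn 0%R n om) (Yn n%:Z om) h|].
  rewrite -[X in measurable X]setTI; apply: measurable_lte => //.
  apply: measurableT_comp => //.
  under eq_fun do rewrite (block_seq Yn n).
  exact: (measurable_filter_variance Q g_pos g_meas chi (@measurable_obs _ _ _ _ _ P Yn n)
    (measurable_funPT (Yn n%:Z)) h_meas).
apply: (@le_trans _ _ (P E)).
  apply: le_measure; rewrite ?inE//; first by apply: measurableU => //; exact: measurableU.
  move=> om; apply: contraPP => nE /=; apply/negP; rewrite -leNgt.
  have [nE1 [nE3 nE4]] : ~ (\big[setU/set0]_(c < r) (Ea (n - c)%N `|` Eb (n - c)%N)) om /\
      ~ (c5%:E < start_cost Q g Yn r D chi om) /\ ~ infinite_cost Q g Yn r D om.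
    by split; [|split] => H; apply: nE; [left|right; left|right; right].
  have good t : (t <= n < t + r)%N -> ~ Ea t om /\ ~ Eb t om.
    move=> /andP[tn nt]; have cr : (n - t < r)%N by rewrite ltn_subLR.
    have tE : (n - (n - t) = t)%N by rewrite subKn.
    by split=> H; apply: nE1; rewrite -(bigcup_mkord r (fun c => Ea (n - c)%N `|` Eb (n - c)%N)); exists (n - t)%N => //; rewrite tE; [left|right].
  apply: (@le_trans _ _ a0%:E); last by rewrite lee_fin le_max lexx.
  apply: (@good_trajectory_bound R dX dY dO X Y Omega Q g g_pos g_meas r D chi h (B + 1)
    bh hB C M kappa C0 w q j0 mD M0 C00 kappa01 q0 w01 rhow qw j08 j0e r0 K em ep mu phi
    doeblin kappaP _ P Yn om n _ _ _ C1 _ _ pK3).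
  - by move=> z Kz; have /andP[] := outside z Kz.
  - by move=> k H; apply: nE4; exists k => //; left.
  - by move=> k H; apply: nE4; exists k => //; right.
  - move=> l lr; apply: le_trans (start_cost_ge Q g_pos g_meas Yn mLG mD chi om lr) _.
    apply: (@le_trans _ _ c5%:E); first by rewrite leNgt; exact/negP.
    by rewrite lee_fin lerDr addr_ge0.
  - by rewrite /C0 lerDl.
  - move=> t lo m tn; have [nEa _] := good t tn.
    apply: le_trans (windows_cost t om nEa lo m) _.
    by rewrite rateE lerD2l lerDl.
  - move=> t lo m tn; have [_ nEb] := good t tn.
    apply: le_trans (windows_bad t om nEb lo m) _.
    by rewrite rateE lerD2l lerDr.
apply: (@le_trans _ _ (\sum_(c < r) (4 * delta)%:E + delta%:E)).
  apply: (le_trans (measureU2 _ _ _)) => //; first exact: measurableU.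
  apply: leeD.
    apply: (@le_trans _ _ (\sum_(c < r) P (Ea (n - c)%N `|` Eb (n - c)%N))).
      exact: (@Boole_inequality _ _ _ P (fun c => Ea (n - c)%N `|` Eb (n - c)%N)).
    apply: lee_sum => c _; apply: (le_trans (measureU2 _ _ _)) => //.
    apply: (le_trans (leeD (PEa _) (PEb _))).
    by rewrite -EFinD lee_fin; lra.
  apply: (le_trans (measureU2 _ _ _)) => //.
  rewrite -[delta%:E]adde0; apply: leeD => //.
  by rewrite le_eqVlt; apply/orP; left; apply/eqP; exact: infinite_cost_null.
rewrite sumEFin sumr_const card_ord -EFinD lee_fin -mulr_natr /delta.
rewrite le_eqVlt; apply/orP; left; apply/eqP; field.
by rewrite gt_eqF.
Qed.
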